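(* Let $\theta_1\in\left(\frac{\beta C_A}{1+\beta C_A},1\right)$, $\theta_2\in(0,1)$, and let $v\in W^1_p(\Omega)$ with $|v|_{W^1_p(\Omega)}\neq 0$ satisfy $$|v|_{W^1_p(\Omega)}\le (1-\theta_1)\left(\alpha C_EC_A(1+\beta C_A)\right)^{-1},\qquad |v|_{W^1_p(\Omega)}\le (1-\theta_2)\left(\alpha C_EC_A(1+\beta C_A)^2\right)^{-1}.$$ Then the control-to-state map $G_v:\mathcal U\to\mathbb W^1$ admits a first-order Fréchet derivative $G_v':\mathcal U\to\mathcal L(L^2(I),\mathbb W^1)$. For all $\bar u\in\mathcal U$ and all $h\in L^2(I)$, writing $(\bar\gamma,\bar y)=G_v(\bar u)$, the pair $(\gamma,y):=G_v'(\bar u)h\in\mathbb W^1$ satisfies $$\mathcal B_\Gamma[\gamma,\zeta]+\mathcal D_\Omega[(\gamma,y),z+E\zeta;\bar\gamma,\bar y]=\int_0^1h\,\zeta\,dx_1\qquad\forall(\zeta,z)\in\mathring W^1_1(I)\times\mathring W^1_q(\Omega).$$ Moreover, $$\|(\gamma,y)\|_{\mathbb W^1}\le\frac{\alpha}{\theta_2}(1+\beta C_A)^2|v|_{W^1_p(\Omega)}\|h\|_{L^2(I)}.$$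
   Context: Notation: $I=(0,1)$, $\Omega=(0,1)^2$ with points $x=(x_1,x_2)$, $\Gamma=(0,1)\times\{1\}$ (identified with $I$, as are function spaces on them), $\Sigma=\partial\Omega\setminus\Gamma$. $W^1_r$ denotes the usual Sobolev space with integrability exponent $r$, $\mathring W^1_r$ its subspace of functions with zero boundary trace; $|y|_{W^1_r(\Omega)}:=\|\nabla y\|_{L^r(\Omega)}$ and $|\gamma|_{W^1_r(I)}:=\|\gamma'\|_{L^r(I)}$. $\kappa>0$ is a fixed constant. For $\gamma\in\mathring W^1_\infty(I)$ with $|\gamma'|\le1$ a.e. (the state constraint; then $|\gamma|\le 1/2$), $$A[\gamma](x)=\begin{pmatrix}1+\gamma(x_1) & -\gamma'(x_1)x_2\\ -\gamma'(x_1)x_2 & \frac{1+(\gamma'(x_1)x_2)^2}{1+\gamma(x_1)}\end{pmatrix},$$ and $DA[\gamma]\langle h\rangle$, $D^2A[\gamma]\langle h_1,h_2\rangle$ are its first and second directional derivatives with respect to $\gamma$ in directions $h,h_1,h_2\in\mathring W^1_\infty(I)$. Bilinear forms: $\mathcal B_\Gamma[\gamma,\zeta]=\kappa\int_0^1\gamma'\zeta'\,dx_1$, and $\mathcal B_\Omega[y,z;M]=\int_\Omega M\nabla y\cdot\nabla z\,dx$ for a bounded matrix field $M$. Also $$\mathcal D_\Omega[(\gamma,y),\cdot;\bar\gamma,\bar y]:=\mathcal B_\Omega[y,\cdot;A[\bar\gamma]]+\mathcal B_\Omega[\bar y+v,\cdot;DA[\bar\gamma]\langle\gamma\rangle].$$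 Fixed constants: (1) $C_A<\infty$ such that for all $\gamma\in\mathring W^1_\infty(I)$ with $|\gamma'|\le1$ a.e., $\|A[\gamma]\|_{L^\infty}+\sup_{|h|_{W^1_\infty(I)}=1}\|DA[\gamma]\langle h\rangle\|_{L^\infty}+\sup_{|h_1|_{W^1_\infty(I)}=|h_2|_{W^1_\infty(I)}=1}\|D^2A[\gamma]\langle h_1,h_2\rangle\|_{L^\infty}\le C_A$ (norms in $L^\infty(\Omega)^{2\times2}$, pointwise Euclidean operator norm). (2) $\alpha>0$ such that $|\gamma|_{W^1_\infty(I)}\le\alpha\sup_{0\ne\zeta\in\mathring W^1_1(I)}\mathcal B_\Gamma[\gamma,\zeta]/|\zeta|_{W^1_1(I)}$ for $\gamma\in\mathring W^1_\infty(I)$ and $|s|_{W^1_1(I)}\le\alpha\sup_{0\ne\zeta\in\mathring W^1_\infty(I)}\mathcal B_\Gamma[\zeta,s]/|\zeta|_{W^1_\infty(I)}$ for $s\in\mathring W^1_1(I)$. (3) $Q<2<P$, Hölder conjugate, and $\beta>0$ such that for every $r\in(Q,P)$ with conjugate $r'$, every $\gamma\in\mathring W^1_\infty(I)$ with $|\gamma'|\le1$ a.e. and every $y\in\mathring W^1_r(\Omega)$: $|y|_{W^1_r(\Omega)}\le\beta\sup_{0\ne z\in\mathring W^1_{r'}(\Omega)}\mathcal B_\Omega[y,z;A[\gamma]]/|z|_{W^1_{r'}(\Omega)}$. (4) $2<p<P$ and $q=p/(p-1)$. (5) $E:\mathring W^1_1(I)\to W^1_q(\Omega)$ is a fixed bounded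 linear extension with $E\zeta|_\Gamma=\zeta$, $E\zeta|_\Sigma=0$, and $C_E\ge1$ satisfies $|E\zeta|_{W^1_q(\Omega)}\le C_E|\zeta|_{W^1_1(I)}$. $\mathbb W^1:=\mathring W^1_\infty(I)\times\mathring W^1_p(\Omega)$ with norm $\|(\gamma,y)\|_{\mathbb W^1}:=(1+\beta C_A)|v|_{W^1_p(\Omega)}|\gamma|_{W^1_\infty(I)}+|y|_{W^1_p(\Omega)}$. Control-to-state map: $\mathcal U:=\{u\in L^2(I):\|u\|_{L^2(I)}<\theta_1/\alpha\}$; under the stated conditions on $v$, for $u\in\mathcal U$, $G_v(u)=(\gamma,y)$ is the unique element of $\mathbb W^1$ with $|\gamma'|\le1$ a.e. such that $\mathcal B_\Omega[y+v,z;A[\gamma]]=0$ for all $z\in\mathring W^1_q(\Omega)$ and $\mathcal B_\Gamma[\gamma,\zeta]+\mathcal B_\Omega[y+v,E\zeta;A[\gamma]]=\int_0^1u\zeta\,dx_1$ for all $\zeta\in\mathring W^1_1(I)$. *)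

(* Defs.v *)
From HB Require Import structures.
From mathcomp Require Import all_boot all_order all_algebra.
From mathcomp Require Import all_classical all_reals all_analysis.

Set Implicit Arguments.
Unset Strict Implicit.
Unset Printing Implicit Defensive.

Import Order.TTheory GRing.Theory Num.Theory.
Import numFieldNormedType.Exports.

Local Open Scope classical_set_scope.
Local Open Scope ring_scope.

(* Functions on I = (0,1) and Omega = (0,1)^2 are represented by functions on
   the whole line and plane; only their restriction to I, resp. Omega, matters,
   because they are measured with the restricted Lebesgue measures [muI] and
   [muO] (they are asked to be measurable on the whole line or plane, which
   extension by 0 achieves). Elements of L^r and of the Sobolev spaces are equal when they are
   equal almost everywhere for these measures. *)

Section measures.
Context {R : realType}.

Lemma lebesgue_itv01_lty :
  ((@lebesgue_measure R) `]0%R, 1%R[%classic < +oo)%E.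
Proof. by rewrite lebesgue_measure_itv/= lte01 oppr0 adde0 ltry. Qed.

Definition muI : {finite_measure set (measurableTypeR R) -> \bar R} :=
  mfrestr
    (f := (@lebesgue_measure R : {measure set (measurableTypeR R) -> \bar R}))
    (@measurable_itv R `]0, 1[) lebesgue_itv01_lty.

Definition muO :
    {measure set (measurableTypeR R * measurableTypeR R) -> \bar R} :=
  (muI \x muI)%E.

End measures.

(* A weakly differentiable function is carried together with a representative
   of its weak derivative, resp. weak gradient, which is unique up to null
   sets: in [y : sob1 R] or [y : sob2 R], [y.1] is the function and [y.2] its
   derivative. These types are lmodTypes for the pointwise operations, so that
   directional derivatives with respect to [y] make pointwise sense. *)
Notation sob1 R := ((R -> R) * (R -> R))%type.
Notation sob2 R := ((R * R -> R) * (R * R -> 'cV[R]_2))%type.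

Section sobolev.
Context {R : realType}.
Implicit Types (r : \bar R).

Definition dot (a b : 'cV[R]_2) : R := \sum_i a i 0 * b i 0.
Definition enorm (a : 'cV[R]_2) : R := Num.sqrt (dot a a).

Definition smooth1 (f : R -> R) := forall n x, derivable (derive1n n f) x 1.

Definition e1 : R * R := (1, 0).
Definition e2 : R * R := (0, 1).

Fixpoint Ck2 (k : nat) (f : R * R -> R) : Prop :=
  continuous f /\
  if k is k'.+1 then
    [/\ forall x, derivable f x e1 /\ derivable f x e2,
        Ck2 k' ('D_e1 f) & Ck2 k' ('D_e2 f)]
  else True.

Definition smooth2 (f : R * R -> R) := forall k, Ck2 k f.

Definition grad (f : R * R -> R) (x : R * R) : 'cV[R]_2 :=
  \col_i (if i == 0 then 'D_e1 f x else 'D_e2 f x).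

Definition dom1 : set R := `]0, 1[.
Definition dom2 : set (R * R) := dom1 `*` dom1.

Definition test1 (f : R -> R) := smooth1 f /\
  exists K, [/\ compact K, K `<=` dom1 & forall x, ~ K x -> f x = 0].
Definition test2 (f : R * R -> R) := smooth2 f /\
  exists K, [/\ compact K, K `<=` dom2 & forall x, ~ K x -> f x = 0].

Definition W1I r : set (sob1 R) := [set y : sob1 R |
  [/\ y.1 \in Lfun muI r, y.2 \in Lfun muI r &
      forall phi, test1 phi ->
        \int[muI]_x (y.1 x * derive1 phi x) = - \int[muI]_x (y.2 x * phi x)]].

Definition W1O r : set (sob2 R) := [set y : sob2 R |
  [/\ y.1 \in Lfun muO r, forall i, (fun x => y.2 x i 0) \in Lfun muO r &
      forall phi, test2 phi -> forall i,
        \int[muO]_x (y.1 x * grad phi x i 0)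
        = - \int[muO]_x (y.2 x i 0 * phi x)]].

Definition semi1 r (y : sob1 R) : \bar R := 'N[muI]_r[EFin \o y.2]%E.
Definition semi2 r (y : sob2 R) : \bar R :=
  'N[muO]_r[EFin \o (enorm \o y.2)]%E.

(* The boundary trace is the continuous extension, from functions that are
   smooth up to the boundary to W^1_1, of the restriction to the boundary; the
   trace on W^1_r, r in [1, +oo], is its restriction to W^1_r. *)
Definition trace1 (y : sob1 R) (a b : R) := exists phi : nat -> R -> R,
  [/\ forall n, smooth1 (phi n),
      ('N[muI]_1[EFin \o (y.1 - phi n)%R] +
       'N[muI]_1[EFin \o (y.2 - derive1 (phi n))%R])%E @[n --> \oo] --> 0%E,
      phi n 0 @[n --> \oo] --> a & phi n 1 @[n --> \oo] --> b].

Definition bndL1 (g : R * R -> R) : \bar R :=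
  (\int[muI]_s (`|g (s, 0%R)| + `|g (s, 1%R)|
                + `|g (0%R, s)| + `|g (1%R, s)|)%:E)%E.

Definition trace2 (y : sob2 R) (g : R * R -> R) :=
  exists phi : nat -> R * R -> R,
  [/\ forall n, smooth2 (phi n),
      ('N[muO]_1[EFin \o (y.1 - phi n)%R] +
       'N[muO]_1[EFin \o (enorm \o (y.2 - grad (phi n))%R)])%E
        @[n --> \oo] --> 0%E &
      bndL1 (phi n - g) @[n --> \oo] --> 0%E].

Definition W10I r : set (sob1 R) := [set y : sob1 R | W1I r y /\ trace1 y 0 0].
Definition W10O r : set (sob2 R) := [set y : sob2 R | W1O r y /\ trace2 y (cst 0)].

Definition eq1 (y z : sob1 R) := {ae muI, forall x, y.1 x = z.1 x}.
Definition eq2 (y z : sob2 R) := {ae muO, forall x, y.1 x = z.1 x}.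

End sobolev.

Section forms.
Context {R : realType}.
Implicit Types (g h s : sob1 R) (y z v : sob2 R).

Definition mx22 (a b c d : R) : 'M[R]_2 := \matrix_(i, j)
  if i == 0 then (if j == 0 then a else b) else (if j == 0 then c else d).

Definition Amx g (x : R * R) : 'M[R]_2 :=
  mx22 (1 + g.1 x.1)       (- (g.2 x.1 * x.2))
       (- (g.2 x.1 * x.2)) ((1 + (g.2 x.1 * x.2) ^+ 2) / (1 + g.1 x.1)).

Definition DAmx g h (x : R * R) : 'M[R]_2 :=
  \matrix_(i, j) derive1 (fun t : R => Amx (g + t *: h) x i j) 0.

Definition D2Amx g h1 h2 (x : R * R) : 'M[R]_2 :=
  \matrix_(i, j) derive1 (fun t : R => DAmx (g + t *: h2) h1 x i j) 0.

Definition opnorm (M : 'M[R]_2) : R :=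
  sup [set enorm (M *m a) | a in [set a | enorm a = 1]].

Definition mxLinf (M : R * R -> 'M[R]_2) : \bar R :=
  'N[muO]_(+oo)[EFin \o (opnorm \o M)]%E.

Definition BG (kappa : R) (g z : sob1 R) : R :=
  kappa * \int[muI]_x (g.2 x * z.2 x).

Definition BO y z (M : R * R -> 'M[R]_2) : R :=
  \int[muO]_x dot (M x *m y.2 x) (z.2 x).

Definition DO v (w : sob1 R * sob2 R) z (gb : sob1 R) (yb : sob2 R) : R :=
  BO w.2 z (Amx gb) + BO (yb + v) z (DAmx gb w.1).

Definition admissible g :=
  W10I +oo%E g /\ {ae muI, forall x, `|g.2 x| <= 1}.

Definition A_bound (CA : R) := forall g, admissible g ->
  (mxLinf (Amx g)
   + ereal_sup [set mxLinf (DAmx g h) |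
       h in [set h : sob1 R | W10I +oo%E h /\ semi1 +oo%E h = 1%E]]
   + ereal_sup [set mxLinf (D2Amx g h.1 h.2) |
       h in [set h : sob1 R * sob1 R |
               [/\ W10I +oo%E h.1, W10I +oo%E h.2,
                   semi1 +oo%E h.1 = 1%E & semi1 +oo%E h.2 = 1%E]]]
   <= CA%:E)%E.

Definition infsupI (kappa alpha : R) :=
  (forall g, W10I +oo%E g ->
     (semi1 +oo%E g <= alpha%:E *
        ereal_sup [set (BG kappa g z / fine (semi1 1%E z))%R%:E |
                     z in [set z : sob1 R | W10I 1%E z /\ ~ eq1 z 0%R]])%E) /\
  (forall s, W10I 1%E s ->
     (semi1 1%E s <= alpha%:E *
        ereal_sup [set (BG kappa z s / fine (semi1 +oo%E z))%R%:E |
                     z in [set z : sob1 R | W10I +oo%E z /\ ~ eq1 z 0%R]])%E).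

Definition infsupO (Q P beta : R) := forall r r' : R,
  Q < r < P -> r^-1 + r'^-1 = 1 ->
  forall g, admissible g -> forall y, W10O r%:E y ->
  (semi2 r%:E y <= beta%:E *
     ereal_sup [set (BO y z (Amx g) / fine (semi2 r'%:E z))%R%:E |
                  z in [set z : sob2 R | W10O r'%:E z /\ ~ eq2 z 0%R]])%E.

Definition Gamma : set (R * R) := [set x | dom1 x.1 /\ x.2 = 1].

Definition bounded_extension (q CE : R) (E : sob1 R -> sob2 R) :=
  [/\ forall s, W10I 1%E s ->
        W1O q%:E (E s) /\ trace2 (E s) (fun x => if x \in Gamma then s.1 x.1 else 0),
      forall (a : R) s1 s2, W10I 1%E s1 -> W10I 1%E s2 ->
        eq2 (E (a *: s1 + s2)) (a *: E s1 + E s2) &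
      forall s, W10I 1%E s -> (semi2 q%:E (E s) <= CE%:E * semi1 1%E s)%E].

End forms.

Section control.
Context {R : realType}.
Implicit Types (u h : R -> R) (v : sob2 R) (w : sob1 R * sob2 R).

Definition L2I : set (R -> R) := [set u | u \in Lfun muI 2%:E].
Definition L2norm u : \bar R := 'N[muI]_2%:E[EFin \o u]%E.

Definition Wspace (p : R) : set (sob1 R * sob2 R) :=
  [set w | W10I +oo%E w.1 /\ W10O p%:E w.2].
Definition Wnorm (p beta CA : R) v w : \bar R :=
  ((1 + beta * CA)%:E * semi2 p%:E v * semi1 +oo%E w.1 + semi2 p%:E w.2)%E.
Definition Weq w1 w2 := eq1 w1.1 w2.1 /\ eq2 w1.2 w2.2.

Definition controls (theta1 alpha : R) : set (R -> R) :=
  [set u | L2I u /\ (L2norm u < (theta1 / alpha)%:E)%E].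

Definition is_state (kappa p q : R) (E : sob1 R -> sob2 R) v u w :=
  [/\ Wspace p w, {ae muI, forall x, `|w.1.2 x| <= 1},
      forall z, W10O q%:E z -> BO (w.2 + v) z (Amx w.1) = 0 &
      forall z, W10I 1%E z ->
        BG kappa w.1 z + BO (w.2 + v) (E z) (Amx w.1)
        = \int[muI]_x (u x * z.1 x)].

Definition control_to_state (kappa p q theta1 alpha : R)
    (E : sob1 R -> sob2 R) v (G : (R -> R) -> sob1 R * sob2 R) :=
  forall u, controls theta1 alpha u ->
    is_state kappa p q E v u (G u) /\
    forall w, is_state kappa p q E v u w -> Weq w (G u).

(* [G' u] is a bounded linear operator from L^2(I) to W, and the Fréchet
   derivative of [G] at [u], for every [u] in [U]. *)
Definition frechet_derivative (p beta CA : R) v (U : set (R -> R))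
    (G : (R -> R) -> sob1 R * sob2 R)
    (G' : (R -> R) -> (R -> R) -> sob1 R * sob2 R) :=
  forall u, U u ->
  [/\ forall h, L2I h -> Wspace p (G' u h),
      forall (a : R) h1 h2, L2I h1 -> L2I h2 ->
        Weq (G' u (a *: h1 + h2)) (a *: G' u h1 + G' u h2),
      exists C : R, forall h, L2I h ->
        (Wnorm p beta CA v (G' u h) <= C%:E * L2norm h)%E &
      forall eps : R, 0 < eps -> exists2 delta : R, 0 < delta &
        forall h, L2I h -> (L2norm h < delta%:E)%E -> U (u + h) ->
          (Wnorm p beta CA v (G (u + h) - G u - G' u h)%R
             <= eps%:E * L2norm h)%E].

End control.

(* Main.v *)
(* The derivative is obtained without any solvability theory for the
   linearized system. With t_k -> 0, the quotients (G (u + t_k h) - G u) / t_k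
   satisfy the linearized system up to a residual O(t_k): this follows from the
   second-order expansion of A and a Lipschitz estimate for G. The inf-sup
   conditions and the smallness of v make the linearized system stable: the
   feedback from the bulk to the interface is a contraction with factor
   1 - theta2. Hence the quotients are Cauchy, and the zero-trace spaces
   are complete by Poincare's inequality. The limit solves the linearized
   system; stability then gives uniqueness, hence linearity in h, the norm
   bound, and the quadratic estimate of the remainder. *)

Require Import Defs.
From HB Require Import structures.
From mathcomp Require Import all_boot all_order all_algebra.
From mathcomp Require Import all_classical all_reals all_analysis.
From mathcomp Require Import measurable_realfun ess_sup_inf.
From mathcomp Require Import ring lra.

Set Implicit Arguments.
Unset Strict Implicit.
Unset Printing Implicit Defensive.

Import Order.TTheory GRing.Theory Num.Theory.
Import numFieldNormedType.Exports.

Local Open Scope classical_set_scope.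
Local Open Scope ring_scope.

(** The constants leave no slack, and this shapes the estimates. One bound, [stability], serves both
    the difference of two states, where the coefficient increment is [Amx w'.1 - Amx w.1], and the
    linearized system, where it is [DAmx]. In both cases the increment must be at most [CA] times
    the seminorm of the interface increment, so [A] has to be Lipschitz with the constant [CA]
    itself, not a multiple of it. The square of [1 + beta * CA] in the smallness condition has two
    sources: the gradient of [y + v] is at most [1 + beta * CA] times that of [v], and eliminating
    the bulk unknown adds an indirect feedback, weighted by [beta * CA], to the direct one. Traces
    are defined by approximation with smooth functions, so what is known about zero traces comes
    from the fundamental theorem of calculus for these approximants, applied on the interval and on
    horizontal lines of the square. It yields Poincare inequalities that hold pointwise almost
    everywhere. *)

(** * Euclidean and operator norms in the plane *)

Section plane_linear_algebra.
Context {R : realType}.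
Implicit Types (a b : 'cV[R]_2) (M : 'M[R]_2).

Lemma dotE a b : dot a b = a 0 0 * b 0 0 + a 1 0 * b 1 0.
Proof.
rewrite /dot big_ord_recl big_ord1; congr (_ + a _ _ * b _ _); exact/val_inj.
Qed.

Lemma dotDl a1 a2 b : dot (a1 + a2) b = dot a1 b + dot a2 b.
Proof. by rewrite !dotE !mxE; ring. Qed.

Lemma dotDr a b1 b2 : dot a (b1 + b2) = dot a b1 + dot a b2.
Proof. by rewrite !dotE !mxE; ring. Qed.

Lemma dotZl (t : R) a b : dot (t *: a) b = t * dot a b.
Proof. by rewrite !dotE !mxE; ring. Qed.

Lemma dot_ge0 a : 0 <= dot a a.
Proof. by rewrite dotE -!expr2 addr_ge0 ?sqr_ge0. Qed.

Lemma enorm_ge0 a : 0 <= enorm a.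
Proof. exact: sqrtr_ge0. Qed.

Lemma sqr_enorm a : enorm a ^+ 2 = dot a a.
Proof. by rewrite sqr_sqrtr ?dot_ge0. Qed.

Lemma enorm_le a (c : R) : 0 <= c -> dot a a <= c ^+ 2 -> enorm a <= c.
Proof.
by move=> c0 h; rewrite -(ler_pXn2r (ltn0Sn 1)) ?nnegrE ?enorm_ge0 // sqr_enorm.
Qed.

Lemma dot_le a b : `|dot a b| <= enorm a * enorm b.
Proof.
rewrite -(ler_pXn2r (ltn0Sn 1)) ?nnegrE ?mulr_ge0 ?enorm_ge0 //.
rewrite real_normK ?num_real // exprMn !sqr_enorm !dotE.
have := sqr_ge0 (a 0 0 * b 1 0 - a 1 0 * b 0 0); nra.
Qed.

Lemma enormD a b : enorm (a + b) <= enorm a + enorm b.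
Proof.
apply: enorm_le; first by rewrite addr_ge0 ?enorm_ge0.
rewrite sqrrD !sqr_enorm dotDl !dotDr.
have := ler_norm (dot a b); have := dot_le a b.
have -> : dot b a = dot a b by rewrite !dotE; ring.
by rewrite mulr2n; lra.
Qed.

Lemma enormZ (t : R) a : enorm (t *: a) = `|t| * enorm a.
Proof.
rewrite /enorm dotZl; have -> : dot a (t *: a) = t * dot a a.
  by rewrite !dotE !mxE; ring.
by rewrite mulrA -expr2 sqrtrM ?sqr_ge0 // sqrtr_sqr.
Qed.

Lemma enormN a : enorm (- a) = enorm a.
Proof. by rewrite -scaleN1r enormZ normrN1 mul1r. Qed.

Lemma enormB a b : enorm (a - b) <= enorm a + enorm b.
Proof. by rewrite -(enormN b) enormD. Qed.

Lemma le_norm_enorm a i : `|a i 0| <= enorm a.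
Proof.
rewrite -(ler_pXn2r (ltn0Sn 1)) ?nnegrE ?enorm_ge0 // sqr_enorm.
rewrite real_normK ?num_real // dotE.
have := sqr_ge0 (a 0 0); have := sqr_ge0 (a 1 0).
case: i => -[|[|//]] Hi.
  by rewrite (_ : Ordinal Hi = 0); [nra|exact/val_inj].
by rewrite (_ : Ordinal Hi = 1); [nra|exact/val_inj].
Qed.

Lemma enorm_le_sum a : enorm a <= `|a 0 0| + `|a 1 0|.
Proof.
apply: enorm_le; first by rewrite addr_ge0.
rewrite dotE sqrrD !real_normK ?num_real // -!expr2.
by have := mulr_ge0 (normr_ge0 (a 0 0)) (normr_ge0 (a 1 0)); rewrite mulr2n; lra.
Qed.

Lemma mulmx2E M a i : (M *m a) i 0 = M i 0 * a 0 0 + M i 1 * a 1 0.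
Proof.
rewrite mxE big_ord_recl big_ord1; congr (_ + M i _ * a _ _); exact/val_inj.
Qed.

(** A crude but computable majorant of [opnorm]: it bounds the set whose supremum defines [opnorm],
    and it estimates the norm of explicit matrices. *)
Definition mxsum M : R := `|M 0 0| + `|M 0 1| + `|M 1 0| + `|M 1 1|.

Lemma enorm_mulmx_le_sum M a : enorm (M *m a) <= mxsum M * enorm a.
Proof.
apply: (le_trans (enorm_le_sum _)); rewrite !mulmx2E.
apply: (@le_trans _ _ (`|M 0 0| * `|a 0 0| + `|M 0 1| * `|a 1 0| +
  (`|M 1 0| * `|a 0 0| + `|M 1 1| * `|a 1 0|))).
  by rewrite -!normrM; apply: lerD; exact: ler_normD.
have h i j k := ler_wpM2l (normr_ge0 (M i j)) (le_norm_enorm a k).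
by have := h 0 0 0; have := h 0 1 1; have := h 1 0 0; have := h 1 1 1;
   rewrite /mxsum; lra.
Qed.

(** [sup] is meaningful only for a nonempty set that is bounded above; elsewhere it takes a default
    value. *)
Lemma opnorm_has_sup M : has_sup [set enorm (M *m a) | a in [set a | enorm a = 1]].
Proof.
split.
  exists (enorm (M *m delta_mx 0 0)), (delta_mx 0 0) => //=.
  by rewrite /enorm dotE !mxE !eqxx /= mulr1 mul0r addr0 sqrtr1.
exists (mxsum M) => _ [a /= a1 <-].
by rewrite (le_trans (enorm_mulmx_le_sum _ _)) // a1 mulr1.
Qed.

Lemma enorm_mulmx_le M a : enorm (M *m a) <= opnorm M * enorm a.
Proof.
have [a0|a0] := eqVneq (enorm a) 0.
  by rewrite (le_trans (enorm_mulmx_le_sum _ _)) // a0 !mulr0.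
have a_gt0 : 0 < enorm a by rewrite lt_neqAle eq_sym a0 enorm_ge0.
rewrite -ler_pdivrMr //.
have -> : enorm (M *m a) / enorm a = enorm (M *m ((enorm a)^-1 *: a)).
  by rewrite -scalemxAr enormZ ger0_norm ?invr_ge0 ?enorm_ge0 // mulrC.
apply: sup_upper_bound; first exact: opnorm_has_sup.
exists ((enorm a)^-1 *: a) => //=.
by rewrite enormZ ger0_norm ?invr_ge0 ?enorm_ge0 // mulVf.
Qed.

Lemma opnorm_le M (c : R) :
  (forall a, enorm (M *m a) <= c * enorm a) -> opnorm M <= c.
Proof.
move=> Mc; apply: ge_sup; first exact: (opnorm_has_sup M).1.
by move=> _ [a /= a1 <-]; rewrite (le_trans (Mc a)) // a1 mulr1.
Qed.

Lemma opnorm_le_sum M : opnorm M <= mxsum M.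
Proof. by apply: opnorm_le => a; exact: enorm_mulmx_le_sum. Qed.

Lemma opnorm_ge0 M : 0 <= opnorm M.
Proof.
have [[_ [a /= a1 _]] _] := opnorm_has_sup M.
by rewrite -[opnorm M]mulr1 -a1 (le_trans _ (enorm_mulmx_le _ _)) ?enorm_ge0.
Qed.

Lemma opnormD M1 M2 : opnorm (M1 + M2) <= opnorm M1 + opnorm M2.
Proof.
apply: opnorm_le => a; rewrite mulmxDl (le_trans (enormD _ _)) // mulrDl.
by rewrite lerD // enorm_mulmx_le.
Qed.

Lemma opnormZ_le (t : R) M : opnorm (t *: M) <= `|t| * opnorm M.
Proof.
apply: opnorm_le => a; rewrite -scalemxAl enormZ -mulrA.
by rewrite ler_wpM2l // enorm_mulmx_le.
Qed.

Lemma opnormZ (t : R) M : opnorm (t *: M) = `|t| * opnorm M.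
Proof.
apply/eqP; rewrite eq_le opnormZ_le /=.
have [->|t0] := eqVneq t 0; first by rewrite normr0 mul0r opnorm_ge0.
have := opnormZ_le t^-1 (t *: M); rewrite scalerA mulVf // scale1r normfV.
by rewrite ler_pdivlMl // normr_gt0.
Qed.

Lemma dot_mulmx_le M a b : `|dot (M *m a) b| <= opnorm M * enorm a * enorm b.
Proof.
rewrite (le_trans (dot_le _ _)) // ler_wpM2r ?enorm_ge0 //.
exact: enorm_mulmx_le.
Qed.

End plane_linear_algebra.

(** * Real-valued L^p norms of scalar and vector fields *)

Section Lnorm_real.
Context d (T : measurableType d) (R : realType).
Variable mu : {measure set T -> \bar R}.
Implicit Types (f g : T -> R) (p : \bar R) (Y Z : T -> 'cV[R]_2).

Lemma ae_mp (P Q : T -> Prop) : (forall x, P x -> Q x) ->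
  {ae mu, forall x, P x} -> {ae mu, forall x, Q x}.
Proof. by move=> PQ; apply: filterS. Qed.

Lemma ae_mp2 (P1 P2 Q : T -> Prop) : (forall x, P1 x -> P2 x -> Q x) ->
  {ae mu, forall x, P1 x} -> {ae mu, forall x, P2 x} -> {ae mu, forall x, Q x}.
Proof. by move=> PQ; apply: filterS2. Qed.

Lemma LfunE p f : f \in Lfun mu p <->
  measurable_fun setT f /\ ('N[mu]_p[EFin \o f] < +oo)%E.
Proof.
rewrite inE; split.
  by move=> /andP[]; rewrite !inE.
by move=> [mf Nf]; apply/andP; rewrite !inE.
Qed.

Lemma Lfun_measurable p f : f \in Lfun mu p -> measurable_fun setT f.
Proof. by move=> /LfunE[]. Qed.

(** The value is the norm only for members of [Lfun mu p], since [fine] sends an infinite norm to 0.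
    This is why membership is carried along with the estimates. *)
Definition nrm p f : R := fine 'N[mu]_p[EFin \o f].

Lemma nrm_ge0 p f : 0 <= nrm p f.
Proof. by rewrite fine_ge0 // Lnorm_ge0. Qed.

Lemma nrmE p f : f \in Lfun mu p -> 'N[mu]_p[EFin \o f]%E = (nrm p f)%:E.
Proof.
by move=> /LfunE[_ Nf]; rewrite fineK // ge0_fin_numE // Lnorm_ge0.
Qed.

Lemma le_Lnorm p f g : (1 <= p)%E ->
  measurable_fun setT f -> measurable_fun setT g ->
  {ae mu, forall x, `|f x| <= `|g x|} ->
  ('N[mu]_p[EFin \o f] <= 'N[mu]_p[EFin \o g])%E.
Proof.
move=> p1 mf mg fg; rewrite unlock; case: p p1 => [r|_|//].
- rewrite lee_fin => r1; have r0 : 0 < r by rewrite (lt_le_trans _ r1).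
  have mpow (h : T -> R) : measurable_fun setT h ->
      measurable_fun setT (fun x => `|h x| `^ r).
    move=> mh.
    apply: (@measurableT_comp _ _ _ _ _ _ (@powR R ^~ r)) => //.
    exact: measurableT_comp.
  rewrite gt0_ler_poweR ?invr_ge0 ?(ltW r0) //.
  + by rewrite in_itv/= leey integral_ge0 // => x _; rewrite lee_fin powR_ge0.
  + by rewrite in_itv/= leey integral_ge0 // => x _; rewrite lee_fin powR_ge0.
  + apply: ae_ge0_le_integral => //.
    * by move=> x _; rewrite lee_fin powR_ge0.
    * exact/measurable_EFinP/mpow.
    * by move=> x _; rewrite lee_fin powR_ge0.
    * exact/measurable_EFinP/mpow.
    * apply: filterS fg => x fgx _.
      by rewrite lee_fin ge0_ler_powR // ?nnegrE // ltW.
- case: ifP => // _; apply: le_ess_sup.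
  by apply: filterS fg => x; rewrite /= lee_fin.
Qed.

Lemma le_Lfun p f g : (1 <= p)%E -> measurable_fun setT f -> g \in Lfun mu p ->
  {ae mu, forall x, `|f x| <= `|g x|} -> f \in Lfun mu p /\ nrm p f <= nrm p g.
Proof.
move=> p1 mf gL fg; have [mg Ng] := (LfunE _ _).1 gL.
have le := le_Lnorm p1 mf mg fg.
have fL : f \in Lfun mu p by apply/LfunE; split=> //; exact: le_lt_trans Ng.
by split=> //; rewrite -lee_fin -!nrmE.
Qed.

Lemma LfunD p f g : (1 <= p)%E ->
  f \in Lfun mu p -> g \in Lfun mu p -> f + g \in Lfun mu p.
Proof.
by move=> p1 fL gL; have [_] := Lfun_addr_closed mu p1; apply.
Qed.

Lemma nrmD p f g : (1 <= p)%E -> f \in Lfun mu p -> g \in Lfun mu p ->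
  nrm p (f + g) <= nrm p f + nrm p g.
Proof.
move=> p1 fL gL; rewrite -lee_fin EFinD -!nrmE ?LfunD //.
by apply: eminkowski => //; [exact: Lfun_measurable fL|exact: Lfun_measurable gL].
Qed.

Lemma LfunZ p f (a : R) : (1 <= p)%E -> f \in Lfun mu p -> a *: f \in Lfun mu p.
Proof.
move=> p1 fL.
have [L0 LS] := Lfun_submod_closed mu p1.
by have := LS a f 0 fL L0; rewrite addr0.
Qed.

Lemma nrmZ p f (a : R) : (1 <= p)%E -> f \in Lfun mu p ->
  nrm p (a *: f) = `|a| * nrm p f.
Proof.
move=> p1 fL; have aL := LfunZ a p1 fL.
by apply: EFin_inj; rewrite EFinM -!nrmE // (LnormZ (Lfun_Sub p1 fL) a).
Qed.

Lemma LfunN p f : (1 <= p)%E -> f \in Lfun mu p -> - f \in Lfun mu p.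
Proof. by move=> p1 fL; rewrite -scaleN1r; exact: LfunZ. Qed.

Lemma LfunB p f g : (1 <= p)%E ->
  f \in Lfun mu p -> g \in Lfun mu p -> f - g \in Lfun mu p.
Proof. by move=> p1 fL gL; rewrite LfunD ?LfunN. Qed.

Lemma Lfun_normr p f : (1 <= p)%E -> f \in Lfun mu p -> (fun x => `|f x|) \in Lfun mu p.
Proof.
move=> p1 fL; apply: (le_Lfun p1 _ fL _).1.
  by apply: measurableT_comp => //; exact: Lfun_measurable fL.
by apply: nearW => x /=; rewrite normr_id.
Qed.

Lemma nrm1E f : nrm 1%E f = \int[mu]_x `|f x|.
Proof. by rewrite /nrm Lnorm1. Qed.

(** Unit mass selects the case of the definition in which the norm of exponent [+oo] is the
    essential supremum; on a null space that norm is 0 by convention. *)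
Lemma Lfun_oo_ae f : mu [set: T] = 1%E -> f \in Lfun mu +oo%E ->
  {ae mu, forall x, `|f x| <= nrm +oo%E f}.
Proof.
move=> mu1 fL; have := nrmE fL; rewrite unlock mu1 lte01 => e.
have /ess_supP : (ess_sup mu (abse \o (EFin \o f)) <= (nrm +oo f)%:E)%E by rewrite e.
by apply: filterS => x; rewrite /= lee_fin.
Qed.

Lemma ae_le_Lnorm_oo f (c : R) : 0 <= c ->
  {ae mu, forall x, `|f x| <= c} -> ('N[mu]_+oo[EFin \o f] <= c%:E)%E.
Proof.
move=> c0 fc; rewrite unlock; case: ifP => _; last by rewrite lee_fin.
by apply/ess_supP; apply: filterS fc => x; rewrite /= lee_fin.
Qed.

Lemma ae_le_Lfun_oo f (c : R) : 0 <= c -> measurable_fun setT f ->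
  {ae mu, forall x, `|f x| <= c} -> f \in Lfun mu +oo%E /\ nrm +oo%E f <= c.
Proof.
move=> c0 mf fc; have le := ae_le_Lnorm_oo c0 fc.
have fL : f \in Lfun mu +oo%E.
  by apply/LfunE; split=> //; rewrite (le_lt_trans le) ?ltry.
by split=> //; rewrite -lee_fin -nrmE.
Qed.

Lemma nrm_eq0_ae p f : (1 <= p)%E -> f \in Lfun mu p -> nrm p f = 0 ->
  {ae mu, forall x, f x = 0}.
Proof.
move=> p1 fL f0.
have := @Lnorm_eq0_eq0 _ _ _ mu (EFin \o f) p.
rewrite nrmE // f0 => /(_ _ _ erefl) [].
- by apply/measurable_EFinP; exact: Lfun_measurable fL.
- exact: lt_le_trans p1.
- by move=> N [mN N0 h]; exists N; split=> //; apply: subset_trans h => x /= nf e;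
     apply: nf; have := e I; case.
Qed.

Lemma ae_dominated f g : measurable_fun setT f ->
  mu.-integrable setT (EFin \o g) -> {ae mu, forall x, `|f x| <= g x} ->
  mu.-integrable setT (EFin \o f) /\ `|\int[mu]_x f x| <= \int[mu]_x g x.
Proof.
move=> mf ig fg; have mg : measurable_fun setT g.
  by case/integrableP : ig => /measurable_EFinP.
have le : (\int[mu]_x `|(f x)%:E| <= \int[mu]_x `|(g x)%:E|)%E.
  apply: ae_ge0_le_integral => //.
  - by apply: measurableT_comp => //; exact/measurable_EFinP.
  - by apply: measurableT_comp => //; exact/measurable_EFinP.
  - apply: filterS fg => x fgx _; rewrite /= lee_fin.
    exact: le_trans (ler_norm _).
have if' : mu.-integrable setT (EFin \o f).
  apply/integrableP; split; first exact/measurable_EFinP.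
  by case/integrableP : ig => _; exact: le_lt_trans.
split=> //; apply: (le_trans (le_normr_Rintegral _ _)) => //.
have igl : mu.-integrable setT (EFin \o (fun x => `|g x|)) by exact: integrable_norm.
(* The majorant [g] is nonnegative only almost everywhere, where it dominates the absolute value of
   [f]. *)
have -> : \int[mu]_x g x = \int[mu]_x `|g x|.
  congr fine; apply: ae_eq_integral => //.
  - exact/measurable_EFinP.
  - by apply/measurable_EFinP; exact: measurableT_comp.
  - apply: filterS fg => x fgx _; rewrite /= ger0_norm //.
    exact: le_trans (normr_ge0 _) fgx.
rewrite /Rintegral fine_le //.
- by apply: integrable_fin_num => //; exact: integrable_norm.
- exact: integrable_fin_num.
Qed.

Lemma integrable_addr f g : mu.-integrable setT (EFin \o f) ->
  mu.-integrable setT (EFin \o g) ->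
  mu.-integrable setT (EFin \o (fun x => f x + g x)).
Proof. by move=> if' ig; exact: (integrableD measurableT if' ig). Qed.

Lemma integrable_subr f g : mu.-integrable setT (EFin \o f) ->
  mu.-integrable setT (EFin \o g) ->
  mu.-integrable setT (EFin \o (fun x => f x - g x)).
Proof. by move=> if' ig; exact: (integrableB measurableT if' ig). Qed.

Lemma integrable_mulr f (a : R) : mu.-integrable setT (EFin \o f) ->
  mu.-integrable setT (EFin \o (fun x => a * f x)).
Proof. by move=> if'; exact: (integrableZl measurableT a if'). Qed.

Lemma Rintegral_mulr f (a : R) : mu.-integrable setT (EFin \o f) ->
  \int[mu]_x (a * f x) = a * \int[mu]_x f x.
Proof. by move=> if'; rewrite RintegralZl. Qed.

Lemma ae_le_Rintegral f g : mu.-integrable setT (EFin \o f) ->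
  mu.-integrable setT (EFin \o g) -> {ae mu, forall x, f x <= g x} ->
  \int[mu]_x f x <= \int[mu]_x g x.
Proof.
move=> if' ig fg; rewrite -subr_ge0 -RintegralB //.
have igf : mu.-integrable setT (EFin \o (fun x => g x - f x)) by exact: integrable_subr.
apply: le_trans (normr_ge0 (\int[mu]_x cst (0:R) x)) _.
apply: (@ae_dominated (cst 0) (fun x => g x - f x) _ _ _).2 => //.
by apply: filterS fg => x; rewrite normr0 subr_ge0.
Qed.

Lemma hoelder_nrm (p q : R) f g : 0 < p -> 0 < q -> p^-1 + q^-1 = 1 ->
  f \in Lfun mu p%:E -> g \in Lfun mu q%:E ->
  mu.-integrable setT (EFin \o (f \* g)) /\
  \int[mu]_x `|f x * g x| <= nrm p%:E f * nrm q%:E g.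
Proof.
move=> p0 q0 pq fL gL.
have h : ('N[mu]_1[EFin \o (f \* g)%R] <= (nrm p%:E f * nrm q%:E g)%:E)%E.
  rewrite EFinM -!nrmE //.
  by apply: hoelder => //; [exact: Lfun_measurable fL|exact: Lfun_measurable gL].
have fgL : f \* g \in Lfun mu 1%E.
  apply/LfunE; split; last by rewrite (le_lt_trans h) ?ltry.
  by apply: measurable_funM; [exact: Lfun_measurable fL|exact: Lfun_measurable gL].
by split; [exact/Lfun1_integrable|rewrite -nrm1E -lee_fin -nrmE].
Qed.

Lemma Lfun_le p q f : mu [set: T] = 1%E -> (1 <= p)%E -> (p <= q)%E ->
  f \in Lfun mu q -> f \in Lfun mu p.
Proof.
move=> mu1 p1 pq; apply: Lfun_subset => //; first exact: le_trans pq.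
by rewrite mu1.
Qed.

Lemma Lfun_cst1 p (c : R) : mu [set: T] = 1%E -> (1 <= p)%E -> cst c \in Lfun mu p.
Proof.
move=> mu1 p1; apply: (@Lfun_le p +oo%E) => //; first exact: leey.
by apply: (ae_le_Lfun_oo (normr_ge0 c) _ _).1 => //; exact: nearW.
Qed.

(* Hoelder with the constant function 1. *)
Lemma nrm1_le (p : R) f : mu [set: T] = 1%E -> 1 < p -> f \in Lfun mu p%:E ->
  nrm 1%E f <= nrm p%:E f.
Proof.
move=> mu1 p1 fL; have p0 : 0 < p by rewrite (lt_trans _ p1).
have p10 : 0 < p - 1 by rewrite subr_gt0.
have q0 : 0 < p / (p - 1) by rewrite divr_gt0.
have q1 : (1 <= (p / (p - 1))%:E)%E.
  by rewrite lee_fin ler_pdivlMr // mul1r gerBl.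
have pq : p^-1 + (p / (p - 1))^-1 = 1.
  by rewrite invf_div -[X in X + _]div1r -mulrDl addrC subrK divff // gt_eqF.
have [_] := hoelder_nrm p0 q0 pq fL (Lfun_cst1 1 mu1 q1).
rewrite nrm1E; under eq_Rintegral do rewrite mulr1.
suff -> : nrm (p / (p - 1))%:E (cst 1 : T -> R) = 1 by rewrite mulr1.
by rewrite /nrm (Lnorm_cst1 mu) mu1 poweR_EFin powR1.
Qed.

(** Membership is required of the components, because measurability of the Euclidean norm of a field
    does not give back that of its components. *)
Definition vLfun p Y := forall i, (fun x => Y x i 0) \in Lfun mu p.

Definition vnrm p Y : R := nrm p (enorm \o Y).

Lemma measurable_dot Y Z :
  (forall i, measurable_fun setT (fun x => Y x i 0)) ->
  (forall i, measurable_fun setT (fun x => Z x i 0)) ->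
  measurable_fun setT (fun x => dot (Y x) (Z x)).
Proof.
move=> mY mZ; under eq_fun do rewrite dotE.
by apply: measurable_funD; apply: measurable_funM.
Qed.

Lemma measurable_enorm Y : (forall i, measurable_fun setT (fun x => Y x i 0)) ->
  measurable_fun setT (enorm \o Y).
Proof.
move=> mY; apply: (@measurableT_comp _ _ _ _ _ _ (@Num.sqrt R)).
  by apply: continuous_measurable_fun; exact: sqrt_continuous.
exact: measurable_dot.
Qed.

Lemma vLfun_measurable p Y : vLfun p Y ->
  forall i, measurable_fun setT (fun x => Y x i 0).
Proof. by move=> YL i; exact: Lfun_measurable (YL i). Qed.

Lemma vLfun_enorm p Y : (1 <= p)%E -> vLfun p Y -> enorm \o Y \in Lfun mu p.
Proof.
move=> p1 YL; apply: (le_Lfun p1 _ (LfunD p1 (Lfun_normr p1 (YL 0))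
  (Lfun_normr p1 (YL 1))) _).1.
  by apply: measurable_enorm; exact: vLfun_measurable YL.
apply: nearW => x /=; rewrite ger0_norm ?enorm_ge0 //.
by rewrite (le_trans (enorm_le_sum _)) // ler_norm.
Qed.

Lemma vLfun_le_enorm p Y f : (1 <= p)%E ->
  (forall i, measurable_fun setT (fun x => Y x i 0)) -> f \in Lfun mu p ->
  {ae mu, forall x, enorm (Y x) <= `|f x|} -> vLfun p Y.
Proof.
move=> p1 mY fL Yf i; apply: (le_Lfun p1 (mY i) fL _).1.
by apply: filterS Yf => x; exact: le_trans (le_norm_enorm _ _).
Qed.

Lemma vLfunD p Y Z : (1 <= p)%E -> vLfun p Y -> vLfun p Z -> vLfun p (Y + Z).
Proof.
move=> p1 YL ZL i; under eq_fun do rewrite mxE.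
exact: LfunD (YL i) (ZL i).
Qed.

Lemma vLfunZ p Y (a : R) : (1 <= p)%E -> vLfun p Y -> vLfun p (a *: Y).
Proof.
move=> p1 YL i; under eq_fun do rewrite mxE.
exact: LfunZ (YL i).
Qed.

Lemma vLfunB p Y Z : (1 <= p)%E -> vLfun p Y -> vLfun p Z -> vLfun p (Y - Z).
Proof.
by move=> p1 YL ZL; rewrite -scaleN1r; apply: vLfunD => //; exact: vLfunZ.
Qed.

Lemma vnrmD p Y Z : (1 <= p)%E -> vLfun p Y -> vLfun p Z ->
  vnrm p (Y + Z) <= vnrm p Y + vnrm p Z.
Proof.
move=> p1 YL ZL; have eY := vLfun_enorm p1 YL; have eZ := vLfun_enorm p1 ZL.
apply: le_trans (nrmD p1 eY eZ).
apply: (le_Lfun p1 _ (LfunD p1 eY eZ) _).2.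
  by apply: measurable_enorm; exact: vLfun_measurable (vLfunD p1 YL ZL).
apply: nearW => x /=; rewrite ger0_norm ?enorm_ge0 // (le_trans (enormD _ _)) //.
exact: ler_norm.
Qed.

Lemma vnrmZ p Y (a : R) : (1 <= p)%E -> vLfun p Y ->
  vnrm p (a *: Y) = `|a| * vnrm p Y.
Proof.
move=> p1 YL; rewrite -(normr_id a) -nrmZ ?vLfun_enorm //.
by congr (fine 'N[_]__[_]%E); apply/funext => x /=; rewrite enormZ.
Qed.

End Lnorm_real.

(** * Measures on the interval and the square; smooth functions on slices *)

Section unit_interval_and_square.
Context {R : realType}.
Local Notation leb := (@lebesgue_measure R).

Lemma muI_setT : @muI R setT = 1%E.
Proof.
rewrite /muI /= /mfrestr /mrestr setTI.
have := @lebesgue_measure_itv R `]0, 1[; rewrite /= lte01 => ->.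
by rewrite oppr0 adde0.
Qed.

Lemma muOE (A B : set (measurableTypeR R)) : measurable A -> measurable B ->
  muO (A `*` B) = (muI A * muI B)%E.
Proof. exact: product_measure1E. Qed.

Lemma muO_setT : @muO R setT = 1%E.
Proof.
by rewrite -setXTT muOE // !muI_setT mule1.
Qed.

Lemma muI_setC_dom1 : @muI R (~` dom1) = 0%E.
Proof. by rewrite /muI /= /mfrestr /mrestr setICl measure0. Qed.

Lemma measurable_dom1 : measurable (@dom1 R : set (measurableTypeR R)).
Proof. exact: measurable_itv. Qed.

Lemma ae_muI_dom1 : {ae @muI R, forall x : measurableTypeR R, dom1 x}.
Proof.
by exists (~` dom1); split;
  [apply: measurableC; exact: measurable_dom1|exact: muI_setC_dom1|].
Qed.

Lemma ae_muO_fst (P : measurableTypeR R -> Prop) :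
  {ae @muI R, forall x, P x} -> {ae @muO R, forall x, P x.1}.
Proof.
move=> [N [mN N0 NP]]; exists (N `*` setT); split; first exact: measurableX.
  by rewrite muOE // N0 mul0e.
by move=> x /= /(NP x.1).
Qed.

Lemma ae_muO_snd (P : measurableTypeR R -> Prop) :
  {ae @muI R, forall x, P x} -> {ae @muO R, forall x, P x.2}.
Proof.
move=> [N [mN N0 NP]]; exists (setT `*` N); split; first exact: measurableX.
  by rewrite muOE // N0 mule0.
by move=> x /= /(NP x.2).
Qed.

Lemma ae_muO_dom2 : {ae @muO R, forall x : measurableTypeR R * measurableTypeR R, dom2 x}.
Proof.
have h1 := ae_muO_fst ae_muI_dom1; have h2 := ae_muO_snd ae_muI_dom1.
by apply: filterS2 h1 h2 => x; split.
Qed.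

(** The endpoints are null. On the closed interval, compactness and the fundamental theorem of
    calculus become available. *)
Lemma ge0_integral_muI (f : R -> \bar R) : measurable_fun setT f ->
  (forall x, 0 <= f x)%E ->
  (\int[muI]_x f x = \int[leb]_(x in `[0%R, 1%R]) f x)%E.
Proof.
move=> mf f0.
have mfS (D : set R) : measurable (D : set (measurableTypeR R)) -> measurable_fun D f.
  by move=> mD; exact: measurable_funS mf.
rewrite (ge0_negligible_integral _ _ _ _ muI_setC_dom1) //; last first.
  by apply: measurableC; exact: measurable_dom1.
rewrite setDE setCK setTI.
rewrite (@eq_measure_integral _ _ _ _ leb); last first.
  by move=> A mA AD; rewrite /muI /= /mfrestr /mrestr setIidl.
rewrite /dom1 integral_itv_bndo_bndc; last exact: mfS.
by rewrite integral_itv_obnd_cbnd //; exact: mfS.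
Qed.

Lemma continuous_integrable_itv01 (f : R -> R) : continuous f ->
  leb.-integrable `[0, 1] (EFin \o f).
Proof.
move=> cf; apply: continuous_compact_integrable; first exact: segment_compact.
exact: continuous_subspaceT.
Qed.

Lemma integrable_muI (f : R -> R) : continuous f ->
  (@muI R).-integrable setT (EFin \o f).
Proof.
move=> cf; have mf : measurable_fun setT f by exact: continuous_measurable_fun.
apply/integrableP; split; first exact/measurable_EFinP.
rewrite ge0_integral_muI //; last exact/measurableT_comp/measurable_EFinP.
by case/integrableP : (continuous_integrable_itv01 cf).
Qed.

Lemma Rintegral_muI (f : R -> R) : continuous f ->
  \int[muI]_x f x = \int[leb]_(x in `[0, 1]) f x.
Proof.
move=> cf; have mf : measurable_fun setT f by exact: continuous_measurable_fun.
rewrite /Rintegral; congr fine.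
rewrite integralE [RHS]integralE; congr (_ - _)%E.
- by rewrite ge0_integral_muI //; exact/measurable_funepos/measurable_EFinP.
- by rewrite ge0_integral_muI //; exact/measurable_funeneg/measurable_EFinP.
Qed.

Lemma Rintegral_derive1 (f : R -> R) (a b : R) : a <= b ->
  (forall x, derivable f x 1) -> continuous (derive1 f) ->
  \int[leb]_(x in `[a, b]) derive1 f x = f b - f a.
Proof.
move=> ab df cf'.
have cf : continuous f by move=> x; exact/differentiable_continuous/derivable1_diffP.
move: ab; rewrite le_eqVlt => /predU1P[->|ab].
  by rewrite set_itv1 Rintegral_set1 subrr.
have cw : {within `[a, b], continuous (derive1 f)} by exact: continuous_subspaceT.
have dLR : derivable_oo_LRcontinuous f a b.
  split; first by [].
  - exact/cvg_at_right_filter/cf.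
  - exact/cvg_at_left_filter/cf.
by rewrite /Rintegral (continuous_FTC2 ab cw dLR).
Qed.

(* The two primitives of [f'], from each endpoint, are averaged: this gives the
   factor 1/2, which keeps [1 + gamma] away from 0 under the state constraint. *)
Lemma norm_le_boundary_derive (f : R -> R) (x : R) :
  (forall x, derivable f x 1) -> continuous (derive1 f) -> dom1 x ->
  2 * `|f x| <= `|f 0| + `|f 1| + \int[muI]_s `|derive1 f s|.
Proof.
move=> df cf'; rewrite /dom1 /= in_itv /= => /andP[x0 x1].
have cf'n : continuous (fun s => `|derive1 f s|).
  by move=> s; apply: (@continuous_comp _ _ _ (derive1 f)); [exact: cf'|exact: norm_continuous].
have i01 (g : R -> R) (a b : R) : continuous g -> leb.-integrable `[a, b] (EFin \o g).
  move=> cg; apply: continuous_compact_integrable; first exact: segment_compact.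
  exact: continuous_subspaceT.
have bd (a b : R) : a <= b ->
    `|f b - f a| <= \int[leb]_(s in `[a, b]) `|derive1 f s|.
  move=> ab; rewrite -Rintegral_derive1 //.
  by apply: le_normr_Rintegral => //; exact: i01.
have split01 : \int[leb]_(s in `[0, 1]) `|derive1 f s| =
    \int[leb]_(s in `[0, x]) `|derive1 f s| + \int[leb]_(s in `[x, 1]) `|derive1 f s|.
  rewrite -[in RHS]Rintegral_itv_obnd_cbnd; last first.
    by apply: integrableS (i01 _ x 1 cf'n) => //; exact: subset_itv_oc_cc.
  rewrite -(@Rintegral_itvB _ _ (BLeft 0) (BRight 1) x) ?bnd_simp ?ltW //.
    by rewrite addrC subrK.
  exact: i01.
rewrite Rintegral_muI // split01.
have := bd 0 x (ltW x0); have := bd x 1 (ltW x1).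
have h1 := ler_normD (f 0) (f x - f 0); rewrite subrKC in h1.
have h2 := ler_normD (f 1) (- (f 1 - f x)); rewrite subKr normrN in h2.
lra.
Qed.

(** Around each of its points an open set contains a product of two balls with rational centres and
    radius [n.+1%:R^-1]. These products are countably many, enumerated by [unpickle], and measurable
    for the product sigma-algebra. *)
Lemma measurable_open2 (U : set (R * R)) : open U ->
  measurable (U : set (measurableTypeR R * measurableTypeR R)).
Proof.
move=> oU.
pose B (i : rat * rat * nat) : set (R * R) :=
  ball (ratr i.1.1 : R) i.2.+1%:R^-1 `*` ball (ratr i.1.2 : R) i.2.+1%:R^-1.
pose F (n : nat) : set (R * R) :=
  if unpickle n is Some i then if `[< B i `<=` U >] then B i else set0 else set0.
have -> : U = \bigcup_n F n.
  apply/seteqP; split=> [x Ux|x [n _]]; last first.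
    by rewrite /F; case: unpickle => // i; case: asboolP => // BU /BU.
  have /nbhs_ballP[e /= e0 xe] : nbhs x U by exact: open_nbhs_nbhs.
  (* Half of the available radius: the rational centre itself may be off by [n.+1%:R^-1]. *)
  have [n ne] : exists n : nat, n.+1%:R^-1 < e / 2.
    have [n] := ltr_add_invr (divr_gt0 e0 (ltr0Sn R 1)).
    by rewrite add0r => ?; exists n.
  have n0 : 0 < n.+1%:R^-1 :> R by rewrite invr_gt0.
  have rat_near (t : R) : exists r : rat, `|ratr r - t| < n.+1%:R^-1.
    have := @rat_in_itvoo R (t - n.+1%:R^-1) (t + n.+1%:R^-1).
    rewrite ltrD2l gtrN // => /(_ isT)[r]; rewrite in_itv /= => /andP[r1 r2].
    by exists r; rewrite ltr_distl r1.
  have [r1 hr1] := rat_near x.1; have [r2 hr2] := rat_near x.2.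
  have FB : B (r1, r2, n) `<=` U -> F (pickle (r1, r2, n)) = B (r1, r2, n).
    by move=> BU; rewrite /F pickleK; case: asboolP.
  exists (pickle (r1, r2, n)); first exact: I.
  rewrite FB; first by split.
  case=> y1 y2 [/= h1 h2]; apply: xe; split; rewrite /ball /=.
  + rewrite -(subrK (ratr r1) x.1) -addrA (le_lt_trans (ler_normD _ _)) //.
    by rewrite (splitr e) ltrD // ?(distrC x.1) (lt_trans _ ne).
  + rewrite -(subrK (ratr r2) x.2) -addrA (le_lt_trans (ler_normD _ _)) //.
    by rewrite (splitr e) ltrD // ?(distrC x.2) (lt_trans _ ne).
apply: bigcupT_measurable => n; rewrite /F.
case: unpickle => [i|]; last exact: measurable0.
case: asboolP => _; last exact: measurable0.
by apply: measurableX; apply: open_measurable; apply: ball_open; rewrite invr_gt0.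
Qed.

Lemma continuous2_measurable_fun (f : R * R -> R) : continuous f ->
  measurable_fun setT (f : measurableTypeR R * measurableTypeR R -> R).
Proof.
move=> /continuousP cf; apply: (measurability _ (RGenOpens.measurableE R)).
move=> _ [_ [a [b ->] <-]]; rewrite setTI; apply: measurable_open2.
exact/cf/interval_open.
Qed.

Lemma slice1_derive (f : R * R -> R) (t x : R) : derivable f (x, t) e1 ->
  derivable (fun s => f (s, t)) x 1 /\
  derive1 (fun s => f (s, t)) x = 'D_e1 f (x, t).
Proof.
rewrite derive1E /derivable /derive.
suff -> : (fun h : R => h^-1 *: (f (h *: e1 + (x, t)) - f (x, t))) =
  (fun h : R => h^-1 *: (f (h *: (1 : R) + x, t) - f (x, t))) by [].
apply/funext => h; congr (_ *: (f _ - _)).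
have -> : h *: e1 + (x, t) = (h *: (1 : R) + x, h *: (0 : R) + t) by [].
by rewrite scaler0 add0r.
Qed.

Lemma slice1_continuous (f : R * R -> R) (t : R) : continuous f ->
  continuous (fun s => f (s, t)).
Proof.
move=> cf s A /cf [[B1 B2] [/= h1 h2] h]; apply: filterS h1 => u Bu.
by apply: (h (u, t)); split=> //; exact: nbhs_singleton h2.
Qed.

Lemma smooth2_continuous (f : R * R -> R) : smooth2 f ->
  [/\ continuous f, continuous ('D_e1 f) & continuous ('D_e2 f)].
Proof.
move=> sf; have [cf [_ [c1 _] [c2 _]]] := sf 1%N.
split; [exact: cf|exact: c1|exact: c2].
Qed.

(** The horizontal segment through [x] has both ends on the boundary of the square, so the two end
    values are controlled by the trace. *)
Lemma smooth2_slice_le (f : R * R -> R) (x : R * R) : smooth2 f -> dom1 x.1 ->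
  2 * `|f x| <= `|f (0, x.2)| + `|f (1, x.2)|
    + \int[muI]_s `|'D_e1 f (s, x.2)|.
Proof.
move=> sf; case: x => x t /= x01.
have [_ [df _ _]] := sf 1%N; have [_ c1 _] := smooth2_continuous sf.
have sl s := slice1_derive (df (s, t)).1.
have e : derive1 (fun s => f (s, t)) = (fun s => 'D_e1 f (s, t)).
  by apply/funext => s; exact: (sl s).2.
under eq_Rintegral do rewrite -(sl _).2.
apply: (@norm_le_boundary_derive (fun s => f (s, t))) => //.
  by move=> s; exact: (sl s).1.
rewrite e; exact: (@slice1_continuous ('D_e1 f) t c1).
Qed.

End unit_interval_and_square.

(** * Zero traces through approximation at a prescribed accuracy *)

Section traces.
Context {R : realType}.
Local Notation T1 := (measurableTypeR R).
Local Notation T2 := (measurableTypeR R * measurableTypeR R)%type.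
Implicit Types (y z : sob2 R) (g : sob1 R).

Lemma cvge0_ltP (u : (\bar R)^nat) : (forall n, 0 <= u n)%E ->
  (u @ \oo --> 0%E) <->
  (forall e : R, 0 < e -> \forall n \near \oo, (u n < e%:E)%E).
Proof.
move=> u0; split=> [cu e e0|h].
  apply: (cu [set x | (x < e%:E)%E]); rewrite /nbhs /= /ereal_nbhs /=.
  near=> r; rewrite /= lte_fin; near: r.
  exact: lt_nbhsl.
apply/fine_cvgP; split.
  near=> n; rewrite ge0_fin_numE //.
  apply: (@lt_trans _ _ 1%:E); last exact: ltry.
  by near: n; exact: h.
apply/cvgrPdist_lt => e e0; near=> n.
have ue : (u n < e%:E)%E by near: n; exact: h.
have uf : u n \is a fin_num by rewrite ge0_fin_numE // (lt_trans ue) ?ltry.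
rewrite sub0r normrN ger0_norm ?fine_ge0 //.
by rewrite -lte_fin fineK.
Unshelve. all: by end_near. Qed.

Lemma smooth1_continuous (f : R -> R) : smooth1 f ->
  [/\ continuous f, forall x, derivable f x 1 & continuous (derive1 f)].
Proof.
move=> sf; split.
- by move=> x; exact/differentiable_continuous/derivable1_diffP/(sf 0%N).
- exact: (sf 0%N).
- by move=> x; exact/differentiable_continuous/derivable1_diffP/(sf 1%N).
Qed.

(** The approximating sequence of [trace1] is replaced by one smooth function for each accuracy [e].
    Linear combinations and limits then need no diagonal sequences. *)
Definition near_smooth1 g (e : R) (f : R -> R) : Prop :=
  [/\ smooth1 f,
      g.1 - f \in Lfun muI 1%E /\ nrm muI 1%E (g.1 - f) <= e,
      g.2 - derive1 f \in Lfun muI 1%E /\ nrm muI 1%E (g.2 - derive1 f) <= e,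
      `|f 0| <= e & `|f 1| <= e].

Lemma Lnorm_le_nrm d (T : measurableType d) (mu : {measure set T -> \bar R})
    p (f : T -> R) (e : R) : measurable_fun setT f ->
  ('N[mu]_p[EFin \o f] <= e%:E)%E -> f \in Lfun mu p /\ nrm mu p f <= e.
Proof.
move=> mf Nf; have fL : f \in Lfun mu p.
  by apply/LfunE; split=> //; rewrite (le_lt_trans Nf) ?ltry.
by split=> //; rewrite -lee_fin -nrmE.
Qed.

Lemma trace1_0P g : measurable_fun [set: T1] g.1 -> measurable_fun [set: T1] g.2 ->
  trace1 g 0 0 <-> forall e : R, 0 < e -> exists f, near_smooth1 g e f.
Proof.
move=> m1 m2; split.
  move=> [phi [sphi cphi c0 c1]] e e0.
  have N0 n : (0 <= 'N[muI]_1[EFin \o (g.1 - phi n)%R] +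
                    'N[muI]_1[EFin \o (g.2 - derive1 (phi n))%R])%E.
    by rewrite adde_ge0 ?Lnorm_ge0.
  have hN := (cvge0_ltP N0).1 cphi e e0.
  have h0 : \forall n \near \oo, `|phi n 0| < e by exact: (cvgr0_norm_lt _ c0).
  have h1 : \forall n \near \oo, `|phi n 1| < e by exact: (cvgr0_norm_lt _ c1).
  near \oo => n.
  have [cn _ cn'] := smooth1_continuous (sphi n).
  have hNn : ('N[muI]_1[EFin \o (g.1 - phi n)%R] +
              'N[muI]_1[EFin \o (g.2 - derive1 (phi n))%R] < e%:E)%E by near: n.
  exists (phi n); split=> //.
  - apply: Lnorm_le_nrm.
      by apply: measurable_funB => //; exact: continuous_measurable_fun.
    by apply: le_trans (ltW hNn); rewrite leeDl ?Lnorm_ge0.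
  - apply: Lnorm_le_nrm.
      by apply: measurable_funB => //; exact: continuous_measurable_fun.
    by apply: le_trans (ltW hNn); rewrite leeDr ?Lnorm_ge0.
  - by apply: ltW; near: n.
  - by apply: ltW; near: n.
move=> h.
have hn (n : nat) : {f | near_smooth1 g n.+1%:R^-1 f}.
  by apply/cid/h; rewrite invr_gt0.
exists (fun n => sval (hn n)); split.
- by move=> n; case: (svalP (hn n)).
- apply/cvge0_ltP; first by move=> n; rewrite adde_ge0 ?Lnorm_ge0.
  move=> e e0; near=> n; have [_ [L1 N1] [L2 N2] _ _] := svalP (hn n).
  rewrite !nrmE // -EFinD lte_fin.
  have : n.+1%:R^-1 < e / 2 by near: n; apply: near_infty_natSinv_lt (PosNum _); rewrite divr_gt0.
  by move=> ne; rewrite (le_lt_trans (lerD N1 N2)) // (splitr e) ltrD.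
- apply/cvgr0Pnorm_lt => e e0; near=> n; have [_ _ _ N _] := svalP (hn n).
  apply: le_lt_trans N _; near: n; exact: (near_infty_natSinv_lt (PosNum e0)).
- apply/cvgr0Pnorm_lt => e e0; near=> n; have [_ _ _ _ N] := svalP (hn n).
  apply: le_lt_trans N _; near: n; exact: (near_infty_natSinv_lt (PosNum e0)).
Unshelve. all: by end_near. Qed.

Definition bnd_abs (f : R * R -> R) (s : R) : R :=
  `|f (s, 0)| + `|f (s, 1)| + `|f (0, s)| + `|f (1, s)|.

Lemma slice2_continuous (f : R * R -> R) (t : R) : continuous f ->
  continuous (fun s => f (t, s)).
Proof.
move=> cf s A /cf [[B1 B2] [/= h1 h2] h]; apply: filterS h2 => u Bu.
by apply: (h (t, u)); split=> //; exact: nbhs_singleton h1.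
Qed.

Lemma bnd_abs_continuous (f : R * R -> R) : continuous f -> continuous (bnd_abs f).
Proof.
move=> cf s.
have cn (h : R -> R) : continuous h -> {for s, continuous (fun s => `|h s|)}.
  by move=> ch; apply: (@continuous_comp _ _ _ h); [exact: ch|exact: norm_continuous].
apply: cvgD; [apply: cvgD; [apply: cvgD|]|].
- by apply: (cn (fun s => f (s, 0))); exact: slice1_continuous.
- by apply: (cn (fun s => f (s, 1))); exact: slice1_continuous.
- by apply: (cn (fun s => f (0, s))); exact: slice2_continuous.
- by apply: (cn (fun s => f (1, s))); exact: slice2_continuous.
Qed.

Lemma bndL1E (f : R * R -> R) : continuous f ->
  bndL1 (f - cst 0) = (\int[muI]_s bnd_abs f s)%:E.
Proof.
move=> cf; rewrite /bndL1 /Rintegral fineK; last first.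
  by apply: integrable_fin_num => //; apply: integrable_muI; exact: bnd_abs_continuous.
by apply: eq_integral => s _; rewrite /= !subr0.
Qed.

Definition near_smooth2 y (e : R) (f : R * R -> R) : Prop :=
  [/\ smooth2 f,
      y.1 - f \in Lfun muO 1%E /\ nrm muO 1%E (y.1 - f) <= e,
      vLfun muO 1%E (y.2 - grad f) /\ vnrm muO 1%E (y.2 - grad f) <= e &
      \int[muI]_s bnd_abs f s <= e].

Lemma vfun_subE (T : Type) (Y Z : T -> 'cV[R]_2) x i :
  (Y - Z) x i 0 = Y x i 0 - Z x i 0.
Proof. by rewrite !mxE. Qed.

Lemma measurable_grad (f : R * R -> R) i : smooth2 f ->
  measurable_fun [set: T2] (fun x => grad f x i 0).
Proof.
move=> sf; have [_ c1 c2] := smooth2_continuous sf.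
have [->|i0] := eqVneq i 0.
  rewrite (_ : (fun _ => _) = 'D_e1 f); first exact: (continuous2_measurable_fun c1).
  by apply/funext => x; rewrite mxE eqxx.
rewrite (_ : (fun _ => _) = 'D_e2 f); first exact: (continuous2_measurable_fun c2).
by apply/funext => x; rewrite mxE (negbTE i0).
Qed.

Lemma trace2_0P y : measurable_fun [set: T2] y.1 ->
  (forall i, measurable_fun [set: T2] (fun x => y.2 x i 0)) ->
  trace2 y (cst 0) <-> forall e : R, 0 < e -> exists f, near_smooth2 y e f.
Proof.
move=> m1 m2; split.
  move=> [phi [sphi cphi c0]] e e0.
  have N0 n : (0 <= 'N[muO]_1[EFin \o (y.1 - phi n)%R] +
                    'N[muO]_1[EFin \o (enorm \o (y.2 - grad (phi n))%R)])%E.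
    by rewrite adde_ge0 ?Lnorm_ge0.
  have B0 n : (0 <= bndL1 (phi n - cst 0)%R)%E.
    by apply: integral_ge0 => s _; rewrite lee_fin !addr_ge0.
  have hN := (cvge0_ltP N0).1 cphi e e0.
  have hB := (cvge0_ltP B0).1 c0 e e0.
  near \oo => n.
  have [cn _ _] := smooth2_continuous (sphi n).
  have hNn : ('N[muO]_1[EFin \o (y.1 - phi n)%R] +
              'N[muO]_1[EFin \o (enorm \o (y.2 - grad (phi n))%R)] < e%:E)%E by near: n.
  have mD i : measurable_fun [set: T2] (fun x => (y.2 - grad (phi n)) x i 0).
    under eq_fun do rewrite vfun_subE.
    by apply: measurable_funB => //; exact: measurable_grad.
  have [eL eN] : enorm \o (y.2 - grad (phi n)) \in Lfun muO 1%E /\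
      nrm muO 1%E (enorm \o (y.2 - grad (phi n))) <= e.
    apply: Lnorm_le_nrm; first exact: measurable_enorm.
    by apply: le_trans (ltW hNn); rewrite leeDr ?Lnorm_ge0.
  exists (phi n); split=> //.
  - apply: Lnorm_le_nrm.
      by apply: measurable_funB => //; exact: continuous2_measurable_fun.
    by apply: le_trans (ltW hNn); rewrite leeDl ?Lnorm_ge0.
  - split=> //; apply: (vLfun_le_enorm _ mD eL) => //.
    by apply: nearW => x; rewrite ler_norm.
  - rewrite -lee_fin -bndL1E //; apply: ltW; near: n; exact: hB.
move=> h.
have hn (n : nat) : {f | near_smooth2 y n.+1%:R^-1 f}.
  by apply/cid/h; rewrite invr_gt0.
exists (fun n => sval (hn n)); split.
- by move=> n; case: (svalP (hn n)).
- apply/cvge0_ltP; first by move=> n; rewrite adde_ge0 ?Lnorm_ge0.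
  move=> e e0; near=> n; have [_ [L1 N1] [L2 N2] _] := svalP (hn n).
  rewrite !nrmE ?vLfun_enorm // -EFinD lte_fin.
  have : n.+1%:R^-1 < e / 2 by near: n; apply: near_infty_natSinv_lt (PosNum _); rewrite divr_gt0.
  by move=> ne; rewrite (le_lt_trans (lerD N1 N2)) // (splitr e) ltrD.
- apply/cvge0_ltP; first by move=> n; apply: integral_ge0 => s _; rewrite lee_fin !addr_ge0.
  move=> e e0; near=> n; have [sf _ _ N] := svalP (hn n).
  rewrite bndL1E; last by have [] := smooth2_continuous sf.
  rewrite lte_fin; apply: le_lt_trans N _.
  by near: n; exact: (near_infty_natSinv_lt (PosNum e0)).
Unshelve. all: by end_near. Qed.

End traces.

(** * Fubini on slices and Poincare inequalities *)

Section poincare.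
Context {R : realType}.
Local Notation T1 := (measurableTypeR R).
Local Notation T2 := (measurableTypeR R * measurableTypeR R)%type.
Implicit Types (y z : sob2 R) (g : sob1 R).

(** The extended-real inner integral [fubini_G] and the real one agree for every [t] whose slice is
    integrable, hence almost everywhere. Integrability and the value of the iterated integral are
    transported along this equality. *)
Lemma fubini_slice (F : T2 -> R) : muO.-integrable setT (EFin \o F) ->
  [/\ {ae @muI R, forall t : T1, muI.-integrable setT (EFin \o (fun s => F (s, t)))},
      muI.-integrable setT (EFin \o (fun t => \int[muI]_s F (s, t))) &
      \int[muI]_t (\int[muI]_s F (s, t)) = \int[muO]_x F x].
Proof.
move=> iF.
have ae2 : {ae @muI R, forall t : T1,
    muI.-integrable setT (EFin \o (fun s : T1 => F (s, t)))} := ae_integrable2 iF.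
have mF : measurable_fun setT (EFin \o F) by case/integrableP : iF.
have mG0 : measurable_fun setT (fubini_G muI (EFin \o F)) := measurable_fubini_G iF.
have iG : muI.-integrable setT (fubini_G muI (EFin \o F)).
  apply/integrableP; split; first exact: mG0.
  have lt := (integrable21ltyP muI muI mF).1 iF.
  apply: (le_lt_trans _ lt).
  apply: ae_ge0_le_integral => //.
  - exact: measurableT_comp mG0.
  - by move=> t _; exact: integral_ge0.
  - apply: (measurable_fun_fubini_tonelli_G (abse \o (EFin \o F))) => //.
      exact: measurableT_comp.
    by move=> x; exact: abse_ge0.
  - apply: filterS ae2 => t /integrableP[mt _] _.
    exact: le_abse_integral.
have eG : {ae @muI R, forall t : T1,
    fubini_G muI (EFin \o F) t = (\int[muI]_s F (s, t))%:E}.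
  apply: filterS ae2 => t it; rewrite /fubini_G /Rintegral fineK //.
  exact: integrable_fin_num.
have mG : measurable_fun [set: T1] (fun t => \int[muI]_s F (s, t)).
  apply: measurableT_comp; first exact: fine_measurable.
  by case/integrableP : iG.
split=> //.
  apply/integrableP; split; first exact/measurable_EFinP.
  case/integrableP : (iG) => mG' /le_lt_trans; apply.
  apply: ae_ge0_le_integral => //.
  - by apply: measurableT_comp => //; exact/measurable_EFinP.
  - exact: measurableT_comp mG0.
  - by apply: filterS eG => t -> _.
rewrite /Rintegral; congr fine.
rewrite -[RHS](integral21_prod_meas1 iF); apply: ae_eq_integral => //.
  exact/measurable_EFinP.
by apply: filterS eG => t -> _.
Qed.

Lemma integral_cst_muI (c : \bar R) : (\int[@muI R]_x c = c)%E.
Proof.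
rewrite integral_cst //; set m := (X in (_ * X)%E).
by rewrite (_ : m = 1%E) ?mule1 //; exact: muI_setT.
Qed.

Lemma Rintegral_cst_muI (c : R) : \int[@muI R]_x c = c.
Proof. exact: (congr1 fine (integral_cst_muI c%:E)). Qed.

Lemma integrable_snd (f : T1 -> R) : muI.-integrable setT (EFin \o f) ->
  muO.-integrable setT (EFin \o (fun x : T2 => f x.2)) /\
  \int[muO]_x f x.2 = \int[muI]_t f t.
Proof.
move=> /[dup] if' /integrableP[/measurable_EFinP mf fi].
have mf2 : measurable_fun [set: T2] (fun x => f x.2).
  by apply: measurableT_comp => //; exact: measurable_snd.
have i2 : muO.-integrable setT (EFin \o (fun x : T2 => f x.2)).
  apply/(integrable21ltyP muI muI); first exact/measurable_EFinP.
  rewrite (_ : (\int[_]_t _)%E = (\int[muI]_t `|(EFin \o f) t|)%E) //.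
  apply: eq_integral => t _; exact: (integral_cst_muI `|(f t)%:E|%E).
split=> //; have [_ _ <-] := fubini_slice i2.
by apply: eq_Rintegral => t _; exact: (Rintegral_cst_muI (f t)).
Qed.

(** The positive part of [f - g] is dominated by nonnegative functions of arbitrarily small
    integral, so its L^1 norm is 0. An inequality for smooth approximants thus passes to the limit
    without extracting a subsequence that converges almost everywhere. *)
Lemma ae_le_of_approx d (T : measurableType d) (mu : {measure set T -> \bar R})
    (f g : T -> R) : mu.-integrable setT (EFin \o f) ->
  mu.-integrable setT (EFin \o g) ->
  (forall e : R, 0 < e -> exists h : T -> R, [/\ mu.-integrable setT (EFin \o h),
     \int[mu]_x h x <= e, forall x, 0 <= h x &
     {ae mu, forall x, f x <= g x + h x}]) ->
  {ae mu, forall x, f x <= g x}.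
Proof.
move=> if' ig H.
have mf : measurable_fun setT f by case/integrableP : if' => /measurable_EFinP.
have mg : measurable_fun setT g by case/integrableP : ig => /measurable_EFinP.
pose u x := Num.max (f x - g x) 0.
have mu' : measurable_fun setT u.
  by apply: measurable_maxr => //; exact: measurable_funB.
have u0 x : 0 <= u x by rewrite le_max lexx orbT.
have ub : forall e : R, 0 < e ->
    mu.-integrable setT (EFin \o u) /\ `|\int[mu]_x u x| <= e.
  move=> e /H[h [ih he h0 fgh]].
  have [|iu hu] := @ae_dominated _ _ _ mu u h mu' ih.
    apply: filterS fgh => x fgh; rewrite ger0_norm // ge_max h0 andbT.
    by rewrite lerBlDl.
  by split=> //; exact: le_trans he.
have [iu _] := ub 1 ltr01.
have nu : nrm mu 1%E u = 0.
  apply/eqP; rewrite eq_le nrm_ge0 andbT; apply/ler_addgt0Pl => e e0; rewrite addr0.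
  rewrite nrm1E; under eq_Rintegral do rewrite ger0_norm //.
  exact: le_trans (ler_norm _) (ub e e0).2.
have := nrm_eq0_ae (lexx 1%E) ((Lfun1_integrable _ _).2 iu) nu.
apply: filterS => x ux; rewrite -subr_le0 -ux.
by rewrite le_max lexx.
Qed.

(** The bound for smooth functions survives up to an error of small integral. Its factor 2 is what
    later keeps [1 + g.1] above 1/2 for admissible [g]. *)
Lemma poincare1 g : g.1 \in Lfun muI 1%E -> g.2 \in Lfun muI 1%E ->
  (forall e : R, 0 < e -> exists f, near_smooth1 g e f) ->
  {ae @muI R, forall x : T1, 2 * `|g.1 x| <= nrm muI 1%E g.2}.
Proof.
move=> L1 L2 H.
have icst (c : R) : muI.-integrable setT (EFin \o (fun _ : T1 => c)).
  exact: finite_measure_integrable_cst.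
have iabs (f : T1 -> R) (c : R) : f \in Lfun muI 1%E ->
    muI.-integrable setT (EFin \o (fun x => c * `|f x|)).
  move=> fL; apply/Lfun1_integrable.
  exact: (LfunZ c (lexx 1%E) (Lfun_normr (lexx 1%E) fL)).
apply: ae_le_of_approx => //; first exact: iabs.
(* Error budget in fifths: two for twice the distance from [g.1] to [f], one for each end value, one
   for the derivative. *)
move=> e e0; have [|f [sf [D1 N1] [D2 N2] f0 f1]] := H (e / 5); first by rewrite divr_gt0.
have [cf df cf'] := smooth1_continuous sf.
exists (fun x => 2 * `|(g.1 - f) x| + 3 * (e / 5)); split.
- exact: (integrable_addr (iabs _ 2 D1) (icst _)).
- rewrite RintegralD //; last exact: iabs.
  rewrite (Rintegral_mulr 2
    ((Lfun1_integrable _ _).1 (Lfun_normr (lexx 1%E) D1))).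
  rewrite -nrm1E (Rintegral_cst_muI (3 * (e / 5))).
  by move: N1; set k := nrm _ _ _; lra.
- by move=> x; have := normr_ge0 ((g.1 - f) x); lra.
- apply: (ae_mp _ (@ae_muI_dom1 R)) => x dx.
  have f'L : derive1 f \in Lfun muI 1%E.
    by apply/Lfun1_integrable; exact: integrable_muI.
  have f'le : \int[muI]_s `|derive1 f s| <= e / 5 + nrm muI 1%E g.2.
    rewrite -nrm1E (_ : derive1 f = -1 *: (g.2 - derive1 f) + g.2); last first.
      by rewrite scaleN1r opprB subrK.
    rewrite (le_trans (nrmD (lexx 1%E) (LfunZ _ (lexx 1%E) D2) L2)) //.
    by rewrite nrmZ // normrN1 mul1r lerD2r.
  move: (norm_le_boundary_derive df cf' dx) (ler_normD (g.1 x - f x) (f x)).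
  rewrite subrK (_ : (g.1 - f) x = g.1 x - f x) //.
  by move: f'le; set a := \int[_]_s _; lra.
Qed.

(** The smooth estimate on a horizontal line involves only the first partial derivative, which the
    norm of the gradient dominates; the right-hand side is a function of [x.2] alone. *)
Lemma poincare2 y : y.1 \in Lfun muO 1%E -> vLfun muO 1%E y.2 ->
  (forall e : R, 0 < e -> exists f, near_smooth2 y e f) ->
  {ae @muO R, forall x : T2, 2 * `|y.1 x| <= \int[muI]_s enorm (y.2 (s, x.2))}.
Proof.
move=> L1 L2 H.
have iabs (f : T2 -> R) (c : R) : f \in Lfun muO 1%E ->
    muO.-integrable setT (EFin \o (fun x => c * `|f x|)).
  move=> fL; apply/Lfun1_integrable.
  exact: (LfunZ c (lexx 1%E) (Lfun_normr (lexx 1%E) fL)).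
have ien (Y : T2 -> 'cV[R]_2) : vLfun muO 1%E Y ->
    muO.-integrable setT (EFin \o (fun x => enorm (Y x))).
  by move=> YL; apply/Lfun1_integrable; exact: vLfun_enorm.
have [ae2 i2 _] := fubini_slice (ien _ L2).
apply: ae_le_of_approx; first exact: iabs.
  exact: (integrable_snd i2).1.
(* Error budget in quarters: two for twice the distance from [y.1] to [f], one for the boundary
   values, one for the gradient. *)
move=> e e0; have [|f [sf [D1 N1] [D2 N2] fb]] := H (e / 4); first by rewrite divr_gt0.
have [cf c1 c2] := smooth2_continuous sf.
have [ae3 i3 e3] := fubini_slice (ien _ D2).
have ib : muI.-integrable setT (EFin \o bnd_abs f).
  by apply: integrable_muI; exact: bnd_abs_continuous.
have [i4 e4] := integrable_snd i3.
have [i5 e5] := integrable_snd ib.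
exists (fun x => 2 * `|(y.1 - f) x| + bnd_abs f x.2 +
  \int[muI]_s enorm ((y.2 - grad f) (s, x.2))); split.
- exact: (integrable_addr (integrable_addr (iabs _ 2 D1) i5) i4).
- rewrite RintegralD //; last exact: (integrable_addr (iabs _ 2 D1) i5).
  rewrite RintegralD //; last exact: iabs.
  rewrite (Rintegral_mulr 2
    ((Lfun1_integrable _ _).1 (Lfun_normr (lexx 1%E) D1))).
  rewrite -nrm1E e4 e5 e3.
  have : \int[muO]_x enorm ((y.2 - grad f) x) <= e / 4.
    move: N2; rewrite /vnrm nrm1E.
    by under eq_Rintegral do rewrite ger0_norm ?enorm_ge0 //.
  by move: N1 fb; set k := nrm _ _ _; set k' := \int[_]_x _; set k'' := \int[_]_x _; lra.
- move=> x; rewrite !addr_ge0 ?mulr_ge0 //; apply: Rintegral_ge0 => s _; exact: enorm_ge0.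
- have h1 := ae_muO_fst (@ae_muI_dom1 R).
  have h2 := ae_mp2 (fun x a b => conj a b) (ae_muO_snd ae2) (ae_muO_snd ae3).
  apply: (ae_mp2 _ h1 h2) => x dx [is1 is2].
  have := smooth2_slice_le sf dx.
  have := ler_normD (y.1 x - f x) (f x); rewrite subrK.
  have -> : (y.1 - f) x = y.1 x - f x by [].
  have : `|f (0, x.2)| + `|f (1, x.2)| <= bnd_abs f x.2.
    by rewrite /bnd_abs -[leRHS]addrA lerDr addr_ge0.
  have : \int[muI]_s `|'D_e1 f (s, x.2)| <=
      \int[muI]_s enorm (y.2 (s, x.2)) + \int[muI]_s enorm ((y.2 - grad f) (s, x.2)).
    rewrite -RintegralD //; apply: le_Rintegral => //.
    + apply: integrable_muI => s.
      apply: (@continuous_comp _ _ _ (fun s => 'D_e1 f (s, x.2))).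
        exact: (@slice1_continuous _ ('D_e1 f) x.2 c1).
      exact: norm_continuous.
    + exact: (integrable_addr is1 is2).
    + move=> s _; have := enormB (y.2 (s, x.2)) ((y.2 - grad f) (s, x.2)).
      rewrite opprB addrCA subrr addr0; apply: le_trans.
      have := le_norm_enorm (grad f (s, x.2)) 0.
      by rewrite {1}/grad mxE eqxx.
  set a := \int[_]_s _; set b := \int[_]_s _; set c := \int[_]_s _.
  by lra.
Qed.

(* Jensen on almost every slice. *)
Lemma powR_nrm d (T : measurableType d) (mu : {measure set T -> \bar R}) (p : R)
    (f : T -> R) : p != 0 ->
  nrm mu p%:E f `^ p = \int[mu]_x `|f x| `^ p.
Proof. by move=> p0; rewrite /nrm /Rintegral -fine_poweR powR_Lnorm. Qed.

(** In the completeness proof the gradients converge in L^p, but the functions are only controlled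
    in L^1; this recovers their missing integrability. The p-th power of the pointwise bound is at
    most an integral over the horizontal line, which is an integrable function of [x.2] by
    Fubini. *)
Lemma Lfun_poincare2 (p : R) y : 1 < p -> y.1 \in Lfun muO 1%E ->
  vLfun muO p%:E y.2 ->
  (forall e : R, 0 < e -> exists f, near_smooth2 y e f) ->
  y.1 \in Lfun muO p%:E.
Proof.
move=> p1 L1 Lp H.
have p1e : (1 <= p%:E)%E by rewrite lee_fin ltW.
have p0 : 0 < p by rewrite (lt_trans _ p1).
have L2 : vLfun muO 1%E y.2 by move=> i; exact: Lfun_le muO_setT _ p1e (Lp i).
have eL := vLfun_enorm p1e Lp.
have ip : muO.-integrable setT (EFin \o (fun x => enorm (y.2 x) `^ p)).
  have := Lfun_integrable (ltW p1) eL.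
  by under eq_fun do rewrite ger0_norm ?enorm_ge0 //.
have [ae1 _ _] := fubini_slice ((Lfun1_integrable _ _).1 (vLfun_enorm (lexx 1%E) L2)).
have [ae2 i2 _] := fubini_slice ip.
have [i3 _] := integrable_snd i2.
have [m1 _] := (LfunE _ _ _).1 L1.
have P := poincare2 L1 L2 H.
apply/LfunE; split=> //; rewrite unlock; apply: poweR_lty.
have /integrableP[m3] := i3; apply: le_lt_trans; apply: ae_ge0_le_integral => //.
- by move=> x _; rewrite lee_fin powR_ge0.
- apply/measurable_EFinP; apply: (@measurableT_comp _ _ _ _ _ _ (@powR R ^~ p)) => //.
  exact: measurableT_comp.
- exact: measurableT_comp.
have h := ae_mp2 (fun x a b => conj a b) (ae_muO_snd ae1) (ae_muO_snd ae2).
apply: (ae_mp2 _ P h) => x Px [h1 h2] _.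
rewrite /= lee_fin [leRHS]ger0_norm; last by apply: Rintegral_ge0 => s _; exact: powR_ge0.
have fL : (fun s : T1 => enorm (y.2 (s, x.2))) \in Lfun muI p%:E.
  case/integrableP : (h1) => /measurable_EFinP m1' _.
  apply/LfunE; split=> //; rewrite unlock; apply: poweR_lty.
  case/integrableP : h2 => _; congr (_ < _)%E; apply: eq_integral => s _.
  by rewrite /= !ger0_norm ?powR_ge0 ?enorm_ge0.
have := nrm1_le muI_setT p1 fL.
rewrite nrm1E; under eq_Rintegral do rewrite ger0_norm ?enorm_ge0 //.
move=> J.
have -> : \int[muI]_s enorm (y.2 (s, x.2)) `^ p =
    nrm muI p%:E (fun s : T1 => enorm (y.2 (s, x.2))) `^ p.
  rewrite powR_nrm; last by rewrite gt_eqF.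
  apply: eq_Rintegral => s _.
  by rewrite ger0_norm ?enorm_ge0.
rewrite ge0_ler_powR ?nnegrE ?nrm_ge0 ?(ltW p0) //; apply: le_trans J.
have := normr_ge0 (y.1 x); move: Px; set k := \int[_]_s _; lra.
Qed.

End poincare.

(** * Almost everywhere limits in L^p *)

Section Lp_completeness.
Context d (T : measurableType d) (R : realType).
Variable mu : {measure set T -> \bar R}.
Implicit Types (f g : T -> R) (p : \bar R).

Lemma bounded_mul_le f g (c : R) : f \in Lfun mu 1%E -> measurable_fun setT g ->
  {ae mu, forall x, `|g x| <= c} ->
  mu.-integrable setT (EFin \o (fun x => f x * g x)) /\
  `|\int[mu]_x (f x * g x)| <= c * nrm mu 1%E f.
Proof.
move=> fL mg gc; rewrite nrm1E -Rintegral_mulr; last first.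
  by apply/Lfun1_integrable; exact: (Lfun_normr (lexx 1%E) fL).
apply: ae_dominated.
- by apply: measurable_funM => //; exact: Lfun_measurable fL.
- apply: integrable_mulr; apply/Lfun1_integrable.
  exact: (Lfun_normr (lexx 1%E) fL).
- by apply: filterS gc => x gcx; rewrite normrM mulrC ler_wpM2r.
Qed.

(** By monotone convergence the series of absolute increments has a finite integral, so it is finite
    almost everywhere, and there the telescoping series converges absolutely. *)
Lemma ae_cvg_of_summable (f_ : nat -> T -> R) (C : R) :
  (forall n, f_ n \in Lfun mu 1%E) ->
  (forall n, \sum_(i < n) nrm mu 1%E (f_ i.+1 - f_ i) <= C) ->
  exists2 f : T -> R, measurable_fun setT f &
    {ae mu, forall x, f_ ^~ x @ \oo --> f x}.
Proof.
move=> fL fC.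
have mf n : measurable_fun setT (f_ n) by exact: Lfun_measurable (fL n).
pose u n x : R := `|f_ n.+1 x - f_ n x|.
have mu' n : measurable_fun setT (EFin \o u n).
  by apply/measurable_EFinP/measurableT_comp => //; exact: measurable_funB.
pose S x := (\sum_(n <oo) (u n x)%:E)%E.
have S0 n x : (0 <= (u n x)%:E)%E by rewrite lee_fin /u.
have iS : (\int[mu]_x S x <= C%:E)%E.
  rewrite integral_nneseries //; apply: lime_le.
    by apply: is_cvg_nneseries => n _ _; exact: integral_ge0.
  apply: nearW => n; rewrite big_mkord.
  rewrite (eq_bigr (fun i : 'I_n => (nrm mu 1%E (f_ i.+1 - f_ i))%:E)); last first.
    move=> i _; rewrite -nrmE ?LfunB // Lnorm1.
    by apply: eq_integral => x _.
  by rewrite sumEFin lee_fin; exact: fC.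
have mS : measurable_fun setT S.
  by by apply: (ge0_emeasurable_sum (P := xpredT)) => [n x _ _|n _]; [exact: S0|exact: mu'].
have aeS : {ae mu, forall x, S x \is a fin_num}.
  have : mu.-integrable setT S.
    apply/integrableP; split=> //; apply: le_lt_trans (ltry C).
    rewrite (le_trans _ iS) // le_eqVlt; apply/orP; left; apply/eqP.
    by apply: eq_integral => x _; rewrite gee0_abs // nneseries_ge0.
  by move/integrable_ae => /(_ measurableT); apply: filterS => x; exact.
(* The upper limit is measurable everywhere and equals the limit wherever the latter exists. *)
exists (fun x => fine (limn_esup (fun n => (f_ n x)%:E))).
  apply: measurableT_comp; first exact: fine_measurable.
  by apply: measurable_fun_limn_esup => n; exact/measurable_EFinP.
apply: filterS aeS => x Sx.
have cf : cvgn (fun n => f_ n x).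
  have cs : cvgn (series (fun n => f_ n.+1 x - f_ n x)).
    apply: normed_cvg; apply: nondecreasing_is_cvgn.
      by apply: nondecreasing_series => n _ _; exact: normr_ge0.
    exists (fine (S x)) => _ [n _ <-]; rewrite -lee_fin fineK //.
    rewrite /series /= -sumEFin; exact: nneseries_lim_ge.
  have -> : (fun n => f_ n x) = (fun n => f_ 0 x + series (fun n => f_ n.+1 x - f_ n x) n).
    apply/funext => n; rewrite /series /= telescope_sumr //.
    by rewrite addrC subrK.
  by apply: is_cvgD => //; exact: is_cvg_cst.
have /cvg_ex[l fl] := cf.
have fl' : (fun n => (f_ n x)%:E) @ \oo --> l%:E by apply: cvg_EFin => //; exact: nearW.
by have [_ ->] := cvg_limn_einf_sup fl'.
Qed.

(** Fatou's lemma for finite exponents. For [+oo], the countably many bounds hold off a single null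
    set and pass to the pointwise limit. Applied to differences, it preserves a rate of convergence
    with its constant. *)
Lemma Lfun_fatou p (h_ : nat -> T -> R) (h : T -> R) (c : R) : (1 <= p)%E -> 0 <= c ->
  (forall n, h_ n \in Lfun mu p) -> (forall n, nrm mu p (h_ n) <= c) ->
  measurable_fun setT h -> {ae mu, forall x, h_ ^~ x @ \oo --> h x} ->
  h \in Lfun mu p /\ nrm mu p h <= c.
Proof.
move=> p1 c0 hL hc mh cv; apply: Lnorm_le_nrm => //.
have mh_ n : measurable_fun setT (h_ n) by exact: Lfun_measurable (hL n).
have hN n : ('N[mu]_p[EFin \o h_ n] <= c%:E)%E by rewrite nrmE ?lee_fin.
case: p p1 hN {hL hc} => [r| |//].
- rewrite lee_fin => r1 hN; have r0 : 0 < r by rewrite (lt_le_trans _ r1).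
  have mpow (g : T -> R) : measurable_fun setT g ->
      measurable_fun setT (fun x => `|g x| `^ r).
    move=> mg; apply: (@measurableT_comp _ _ _ _ _ _ (@powR R ^~ r)) => //.
    exact: measurableT_comp.
  have pow0 (g : T -> R) x : (0 <= (`|g x| `^ r)%:E)%E by rewrite lee_fin powR_ge0.
  have I0 (g : T -> R) : (0 <= \int[mu]_x (`|g x| `^ r)%:E)%E by exact: integral_ge0.
  have hI n : (\int[mu]_x (`|h_ n x| `^ r)%:E <= (c `^ r)%:E)%E.
    have := @powR_Lnorm _ _ _ mu (EFin \o h_ n) r; rewrite gt_eqF // => /(_ isT) <-.
    rewrite -poweR_EFin gt0_ler_poweR ?(ltW r0) //.
    + by rewrite in_itv/= leey Lnorm_ge0.
    + by rewrite in_itv/= leey lee_fin c0.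
  have liminf_le x : h_ ^~ x @ \oo --> h x ->
      ((`|h x| `^ r)%:E <= limn_einf (fun n => (`|h_ n x| `^ r)%:E))%E.
    (* Continuity of the power comes from its derivability at positive reals; where [h x = 0],
       nonnegativity of the lower limit is enough. *)
    move=> cvx; have [h0|h0] := eqVneq (h x) 0.
      rewrite h0 normr0 powR0 ?gt_eqF // limn_einf_lim; apply: lime_ge.
        exact: is_cvg_einfs.
      by apply: nearW => n; apply: le_ereal_inf_tmp => _ [m _ <-].
    have cvp : (fun n => (`|h_ n x| `^ r)%:E) @ \oo --> (`|h x| `^ r)%:E.
      apply: cvg_EFin; first exact: nearW.
      have cc : {for `|h x|, continuous (fun a => a `^ r)}.
        apply/differentiable_continuous/derivable1_diffP/derivable_powR.
        by rewrite in_itv /= andbT normr_gt0.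
      exact: (cvg_comp _ _ (cvg_norm cvx) cc).
    by have [-> _] := cvg_limn_einf_sup cvp.
  have le : (\int[mu]_x (`|h x| `^ r)%:E <= (c `^ r)%:E)%E.
    apply: (@le_trans _ _ (\int[mu]_x limn_einf (fun n => (`|h_ n x| `^ r)%:E))%E).
      apply: ae_ge0_le_integral => //.
      + exact/measurable_EFinP/mpow.
      + move=> x _; rewrite limn_einf_lim; apply: lime_ge; first exact: is_cvg_einfs.
        by apply: nearW => n; apply: le_ereal_inf_tmp => _ [m _ <-].
      + rewrite (_ : (fun _ => _) = (fun x =>
          - limn_esup (fun n => - (`|h_ n x| `^ r)%:E))%E); last first.
          by apply/funext => x; rewrite -limn_einfN; congr limn_einf;
             apply/funext => n; rewrite [RHS]oppeK.
        apply: measurableT_comp => //; apply: measurable_fun_limn_esup => n.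
        by apply: measurableT_comp => //; exact/measurable_EFinP/mpow.
      + by apply: filterS cv => x cvx _; exact: liminf_le.
    apply: le_trans (fatou _ _ _ _) _ => //.
      by move=> n; exact/measurable_EFinP/mpow.
    rewrite limn_einf_lim; apply: lime_le; first exact: is_cvg_einfs.
    apply: nearW => n; apply: le_trans (hI n); apply: ereal_inf_lbound.
    by exists n => /=.
  rewrite unlock -[leRHS](_ : ((c `^ r)%:E `^ r^-1)%E = _); last first.
    by rewrite poweR_EFin -powRrM divff ?gt_eqF // powRr1.
  rewrite gt0_ler_poweR ?invr_ge0 ?(ltW r0) //.
  + by rewrite in_itv/= leey I0.
  + by rewrite in_itv/= leey lee_fin powR_ge0.
- rewrite unlock => _ hN; case: ifP hN => // mu0 hN.
  have h1 n : {ae mu, forall x, `|h_ n x| <= c}.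
    by have /ess_supP := hN n; apply: filterS => x; rewrite /= lee_fin.
  apply/ess_supP; have h2 := ae_foralln h1.
  apply: filterS2 cv h2 => x cvx hx.
  have cvn : (fun n => `|h_ n x|) @ \oo --> `|h x| by exact: cvg_norm cvx.
  rewrite /= lee_fin -(cvg_lim _ cvn) //.
  by apply: limr_le; [exact: cvgP cvn|exact: nearW].
Qed.

End Lp_completeness.

(** * Zero traces under linear combinations and limits *)

Section sobolev_with_zero_trace.
Context {R : realType}.
Local Notation T1 := (measurableTypeR R).
Local Notation T2 := (measurableTypeR R * measurableTypeR R)%type.
Implicit Types (y z : sob2 R) (g h : sob1 R).

Lemma derive1_lin (a : R) (f k : R -> R) : (forall x, derivable f x 1) ->
  (forall x, derivable k x 1) -> derive1 (a *: f + k) = a *: derive1 f + derive1 k.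
Proof.
move=> df dk; apply/funext => x.
rewrite derive1E deriveD //; last exact: derivableZ.
by rewrite deriveZ // -!derive1E.
Qed.

Lemma smooth1_lin (a : R) (f k : R -> R) : smooth1 f -> smooth1 k ->
  smooth1 (a *: f + k).
Proof.
move=> sf sk.
have e n : derive1n n (a *: f + k) = a *: derive1n n f + derive1n n k.
  elim: n => // n IH; rewrite !derive1nS -derive1_lin; [|exact: sf|exact: sk].
  by rewrite IH.
by move=> n x; rewrite e; apply: derivableD; [apply: derivableZ; exact: sf|exact: sk].
Qed.

Lemma derivable_lin (V : normedModType R) (a : R) (f k : V -> R) (x v : V) :
  derivable f x v -> derivable k x v -> derivable (a *: f + k) x v.
Proof. by move=> df dk; apply: derivableD; [exact: derivableZ|exact: dk]. Qed.

Lemma derive_lin (V : normedModType R) (a : R) (f k : V -> R) (x v : V) :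
  derivable f x v -> derivable k x v ->
  'D_v (a *: f + k) x = a * 'D_v f x + 'D_v k x.
Proof.
move=> df dk; rewrite deriveD; [|exact: derivableZ|exact: dk].
by rewrite deriveZ.
Qed.

Lemma Ck2_lin n (a : R) (f k : R * R -> R) : Ck2 n f -> Ck2 n k ->
  Ck2 n (a *: f + k).
Proof.
elim: n f k => [|n IH] f k /= [cf df] [ck dk].
  by split=> // x; apply: continuousD; [apply: continuousZr; exact: cf|exact: ck].
split; first by move=> x; apply: continuousD; [apply: continuousZr; exact: cf|exact: ck].
case: df => df f1 f2; case: dk => dk k1 k2.
have e v : (forall x, derivable f x v) -> (forall x, derivable k x v) ->
    'D_v (a *: f + k) = a *: 'D_v f + 'D_v k.
  by move=> dfv dkv; apply/funext => x; exact: derive_lin.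
split.
- move=> x; have [? ?] := df x; have [? ?] := dk x.
  by split; exact: derivable_lin.
- rewrite e; [exact: IH|by move=> x; case: (df x)|by move=> x; case: (dk x)].
- rewrite e; [exact: IH|by move=> x; case: (df x)|by move=> x; case: (dk x)].
Qed.

Lemma smooth2_lin (a : R) (f k : R * R -> R) : smooth2 f -> smooth2 k ->
  smooth2 (a *: f + k).
Proof. by move=> sf sk n; exact: Ck2_lin. Qed.

Lemma grad_lin (a : R) (f k : R * R -> R) : smooth2 f -> smooth2 k ->
  grad (a *: f + k) = a *: grad f + grad k.
Proof.
move=> sf sk; have [_ [df _ _]] := sf 1%N; have [_ [dk _ _]] := sk 1%N.
apply/funext => x; apply/matrixP => i j; rewrite !mxE.
have [? ?] := df x; have [? ?] := dk x.
by case: ifP => _; exact: derive_lin.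
Qed.

(** Zero trace in the form given by [trace1_0P]; likewise [approx2] with [trace2_0P]. *)
Definition approx1 g := forall e : R, 0 < e -> exists f, near_smooth1 g e f.
Definition approx2 y := forall e : R, 0 < e -> exists f, near_smooth2 y e f.

Lemma funlinB (U : Type) (V : lmodType R) (a : R) (f1 f2 k1 k2 : U -> V) :
  a *: f1 + f2 - (a *: k1 + k2) = a *: (f1 - k1) + (f2 - k2).
Proof. by rewrite scalerBr opprD addrACA. Qed.

Lemma nrm_lin_le d (T : measurableType d) (mu : {measure set T -> \bar R})
    p (a e1 e2 : R) (f k : T -> R) : (1 <= p)%E ->
  f \in Lfun mu p -> k \in Lfun mu p -> nrm mu p f <= e1 -> nrm mu p k <= e2 ->
  a *: f + k \in Lfun mu p /\ nrm mu p (a *: f + k) <= `|a| * e1 + e2.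
Proof.
move=> p1 fL kL fe ke; have aL := LfunZ a p1 fL.
split; first exact: LfunD.
rewrite (le_trans (nrmD p1 aL kL)) // nrmZ // lerD // ler_wpM2l //.
Qed.

Lemma vnrm_lin_le d (T : measurableType d) (mu : {measure set T -> \bar R})
    p (a e1 e2 : R) (Y Z : T -> 'cV[R]_2) : (1 <= p)%E ->
  vLfun mu p Y -> vLfun mu p Z -> vnrm mu p Y <= e1 -> vnrm mu p Z <= e2 ->
  vLfun mu p (a *: Y + Z) /\ vnrm mu p (a *: Y + Z) <= `|a| * e1 + e2.
Proof.
move=> p1 fL kL fe ke; have aL := vLfunZ a p1 fL.
split; first exact: vLfunD.
rewrite (le_trans (vnrmD p1 aL kL)) // vnrmZ // lerD // ler_wpM2l //.
Qed.

Lemma eps_lin (a e : R) : 0 < e -> exists2 e' : R, 0 < e' & `|a| * e' + e' <= e.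
Proof.
move=> e0; have a1 : 0 < `|a| + 1 by rewrite ltr_wpDl.
exists (e / (`|a| + 1)); first exact: divr_gt0.
by rewrite -{2}[e / _]mul1r -mulrDl mulrC divfK ?gt_eqF.
Qed.

Lemma approx1_lin (a : R) g h : approx1 g -> approx1 h -> approx1 (a *: g + h).
Proof.
move=> ag ah e /(eps_lin a)[e' e'0 ee'].
have [f [sf [f1 f1'] [f2 f2'] f3 f4]] := ag _ e'0.
have [k [sk [k1 k1'] [k2 k2'] k3 k4]] := ah _ e'0.
have bd (x : R) : `|f x| <= e' -> `|k x| <= e' -> `|(a *: f + k) x| <= e.
  move=> fx kx; apply: le_trans ee'; rewrite (le_trans (ler_normD _ _)) //.
  by rewrite lerD // normrM ler_wpM2l.
exists (a *: f + k); split.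
- exact: smooth1_lin.
- rewrite funlinB; have [L N] := nrm_lin_le a (lexx 1%E) f1 k1 f1' k1'.
  by split=> //; exact: le_trans ee'.
- rewrite derive1_lin; [|exact: (sf 0%N)|exact: (sk 0%N)].
  rewrite funlinB; have [L N] := nrm_lin_le a (lexx 1%E) f2 k2 f2' k2'.
  by split=> //; exact: le_trans ee'.
- exact: bd.
- exact: bd.
Qed.

Lemma lin_sum4_le (A u0 u1 u2 u3 v0 v1 v2 v3 w0 w1 w2 w3 : R) :
  w0 <= A * u0 + v0 -> w1 <= A * u1 + v1 -> w2 <= A * u2 + v2 ->
  w3 <= A * u3 + v3 ->
  w0 + w1 + w2 + w3 <= A * (u0 + u1 + u2 + u3) + (v0 + v1 + v2 + v3).
Proof. by lra. Qed.

Lemma approx2_lin (a : R) y z : approx2 y -> approx2 z -> approx2 (a *: y + z).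
Proof.
move=> ag ah e /(eps_lin a)[e' e'0 ee'].
have [f [sf [f1 f1'] [f2 f2'] f3]] := ag _ e'0.
have [k [sk [k1 k1'] [k2 k2'] k3]] := ah _ e'0.
have [cf _ _] := smooth2_continuous sf; have [ck _ _] := smooth2_continuous sk.
exists (a *: f + k); split.
- exact: smooth2_lin.
- rewrite funlinB; have [L N] := nrm_lin_le a (lexx 1%E) f1 k1 f1' k1'.
  by split=> //; exact: le_trans ee'.
- rewrite grad_lin // funlinB.
  have [L N] := vnrm_lin_le a (lexx 1%E) f2 k2 f2' k2'.
  by split=> //; exact: le_trans ee'.
- have ib (g : R * R -> R) : continuous g -> muI.-integrable setT (EFin \o bnd_abs g).
    by move=> cg; apply: integrable_muI; exact: bnd_abs_continuous.
  have [sc _ _] := smooth2_continuous (smooth2_lin a sf sk).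
  apply: (@le_trans _ _ (\int[muI]_s (`|a| * bnd_abs f s + bnd_abs k s))).
    apply: ae_le_Rintegral; first exact: ib.
      exact: (integrable_addr (integrable_mulr `|a| (ib _ cf)) (ib _ ck)).
    apply: nearW => s; rewrite /bnd_abs.
    have bd x : `|(a *: f + k) x| <= `|a| * `|f x| + `|k x|.
      by rewrite -normrM ler_normD.
    exact: lin_sum4_le.
  rewrite RintegralD //; [|exact: (integrable_mulr `|a| (ib _ cf))|exact: ib].
  rewrite (Rintegral_mulr _ (ib _ cf)); apply: le_trans ee'.
  by rewrite lerD // ler_wpM2l.
Qed.

(** A smooth approximant of a nearby [h] is also one of [g]; its boundary values are taken over
    unchanged, so only the two L^1 distances add up. *)
Lemma approx1_closed g : (forall e : R, 0 < e -> exists h, [/\ approx1 h,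
    g.1 - h.1 \in Lfun muI 1%E /\ nrm muI 1%E (g.1 - h.1) <= e &
    g.2 - h.2 \in Lfun muI 1%E /\ nrm muI 1%E (g.2 - h.2) <= e]) -> approx1 g.
Proof.
move=> H e e0; have e2 : 0 < e / 2 by rewrite divr_gt0.
have [h [/(_ _ e2)[f [sf [L1 N1] [L2 N2] f0 f1]] [D1 M1] [D2 M2]]] := H _ e2.
have tri (u v w : T1 -> R) : u - v \in Lfun muI 1%E -> v - w \in Lfun muI 1%E ->
    nrm muI 1%E (u - v) <= e / 2 -> nrm muI 1%E (v - w) <= e / 2 ->
    u - w \in Lfun muI 1%E /\ nrm muI 1%E (u - w) <= e.
  move=> uv vw Nuv Nvw; rewrite -(subrK v u) -addrA; split; first exact: LfunD.
  by rewrite (le_trans (nrmD _ uv vw)) // (splitr e) lerD.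
exists f; split=> //.
- exact: tri D1 L1 M1 N1.
- exact: tri D2 L2 M2 N2.
- by rewrite (le_trans f0) // ler_pdivrMr // mulr2n mulrDr mulr1 lerDl ltW.
- by rewrite (le_trans f1) // ler_pdivrMr // mulr2n mulrDr mulr1 lerDl ltW.
Qed.

Lemma approx2_closed y : (forall e : R, 0 < e -> exists z, [/\ approx2 z,
    y.1 - z.1 \in Lfun muO 1%E /\ nrm muO 1%E (y.1 - z.1) <= e &
    vLfun muO 1%E (y.2 - z.2) /\ vnrm muO 1%E (y.2 - z.2) <= e]) -> approx2 y.
Proof.
move=> H e e0; have e2 : 0 < e / 2 by rewrite divr_gt0.
have [z [/(_ _ e2)[f [sf [L1 N1] [L2 N2] fb]] [D1 M1] [D2 M2]]] := H _ e2.
exists f; split=> //.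
- rewrite -(subrK z.1 y.1) -addrA; split; first exact: LfunD.
  by rewrite (le_trans (nrmD _ D1 L1)) // (splitr e) lerD.
- rewrite -(subrK z.2 y.2) -addrA; split; first exact: vLfunD.
  by rewrite (le_trans (vnrmD _ D2 L2)) // (splitr e) lerD.
- by rewrite (le_trans fb) // ler_pdivrMr // mulr2n mulrDr mulr1 lerDl ltW.
Qed.

End sobolev_with_zero_trace.

(** * Weak derivatives under linear combinations and limits *)

Section weak_derivatives.
Context {R : realType}.
Local Notation T1 := (measurableTypeR R).
Local Notation T2 := (measurableTypeR R * measurableTypeR R)%type.
Implicit Types (y z : sob2 R) (g h : sob1 R).

Lemma continuous_bounded_dom1 (f : R -> R) : continuous f ->
  exists c, {ae @muI R, forall x : T1, `|f x| <= c}.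
Proof.
move=> cf.
have cK : compact (f @` `[0, 1]).
  by apply: continuous_compact; [exact: continuous_subspaceT|exact: segment_compact].
have [M [Mr Mf]] := compact_bounded cK.
exists (M + 1); apply: (ae_mp _ (@ae_muI_dom1 R)) => x dx.
apply: (Mf (M + 1)); first by rewrite ltrDl.
by exists x => //; move: dx; rewrite /dom1 /= !in_itv /= => /andP[x0 x1]; rewrite !ltW.
Qed.

Lemma continuous_bounded_dom2 (f : R * R -> R) : continuous f ->
  exists c, {ae @muO R, forall x : T2, `|f x| <= c}.
Proof.
move=> cf.
have cK : compact (f @` (`[0, 1] `*` `[0, 1])).
  apply: continuous_compact; first exact: continuous_subspaceT.
  by apply: compact_setX; exact: segment_compact.
have [M [Mr Mf]] := compact_bounded cK.
exists (M + 1); apply: (ae_mp _ (@ae_muO_dom2 R)) => x [d1 d2].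
apply: (Mf (M + 1)); first by rewrite ltrDl.
exists x => //; split; move: d1 d2; rewrite /dom1 /= !in_itv /= => /andP[? ?] /andP[? ?];
  by rewrite !ltW.
Qed.

Definition weak1 g := forall phi, test1 phi ->
  \int[muI]_x (g.1 x * derive1 phi x) = - \int[muI]_x (g.2 x * phi x).

Definition weak2 y := forall phi, test2 phi -> forall i,
  \int[muO]_x (y.1 x * grad phi x i 0) = - \int[muO]_x (y.2 x i 0 * phi x).

Lemma test1_bounded (phi : R -> R) : test1 phi -> exists c, [/\
  measurable_fun [set: T1] phi, measurable_fun [set: T1] (derive1 phi),
  {ae @muI R, forall x : T1, `|phi x| <= c} &
  {ae @muI R, forall x : T1, `|derive1 phi x| <= c}].
Proof.
move=> [sphi _]; have [c1 _ c2] := smooth1_continuous sphi.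
have [M1 h1] := continuous_bounded_dom1 c1.
have [M2 h2] := continuous_bounded_dom1 c2.
exists (Num.max M1 M2); split; [exact: continuous_measurable_fun
  |exact: continuous_measurable_fun|..].
- by apply: ae_mp h1 => x hx; rewrite le_max hx.
- by apply: ae_mp h2 => x hx; rewrite le_max hx orbT.
Qed.

Lemma test2_bounded (phi : R * R -> R) : test2 phi -> exists c, [/\
  measurable_fun [set: T2] phi,
  forall i, measurable_fun [set: T2] (fun x => grad phi x i 0),
  {ae @muO R, forall x : T2, `|phi x| <= c} &
  forall i, {ae @muO R, forall x : T2, `|grad phi x i 0| <= c}].
Proof.
move=> [sphi _]; have [c0 c1 c2] := smooth2_continuous sphi.
have [M0 h0] := continuous_bounded_dom2 c0.
have [M1 h1] := continuous_bounded_dom2 c1.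
have [M2 h2] := continuous_bounded_dom2 c2.
exists (Num.max M0 (Num.max M1 M2)); split; [exact: continuous2_measurable_fun
  |by move=> i; exact: measurable_grad|..].
- by apply: ae_mp h0 => x hx; rewrite le_max hx.
- move=> i; apply: ae_mp2 h1 h2 => x hx1 hx2; rewrite /grad mxE.
  by case: ifP => _; rewrite !le_max; apply/or3P; [apply: Or32; exact: hx1|apply: Or33; exact: hx2].
Qed.

(** The bounded weights [p1] and [p2] stand for a derivative of a test function and for the test
    function itself. In this form the statement covers the interval and each partial derivative on
    the square. *)
Lemma weak_lin d (T : measurableType d) (mu : {measure set T -> \bar R})
    (a : R) (f1 f2 k1 k2 p1 p2 : T -> R) (c : R) :
  measurable_fun setT p1 -> measurable_fun setT p2 ->
  {ae mu, forall x, `|p1 x| <= c} -> {ae mu, forall x, `|p2 x| <= c} ->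
  f1 \in Lfun mu 1%E -> f2 \in Lfun mu 1%E ->
  k1 \in Lfun mu 1%E -> k2 \in Lfun mu 1%E ->
  \int[mu]_x (f1 x * p1 x) = - (\int[mu]_x (f2 x * p2 x)) ->
  \int[mu]_x (k1 x * p1 x) = - (\int[mu]_x (k2 x * p2 x)) ->
  \int[mu]_x ((a *: f1 + k1) x * p1 x) = - \int[mu]_x ((a *: f2 + k2) x * p2 x).
Proof.
move=> m1 m2 b1 b2 F1 F2 K1 K2 ef ek.
have e (u v p : T -> R) : measurable_fun setT p -> {ae mu, forall x, `|p x| <= c} ->
    u \in Lfun mu 1%E -> v \in Lfun mu 1%E ->
    \int[mu]_x ((a *: u + v) x * p x) = a * \int[mu]_x (u x * p x) + \int[mu]_x (v x * p x).
  move=> mp bp U V.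
  have [iu _] := bounded_mul_le U mp bp; have [iv _] := bounded_mul_le V mp bp.
  rewrite -(Rintegral_mulr _ iu) -RintegralD //; last exact: integrable_mulr.
  by apply: eq_Rintegral => x _; rewrite /= mulrDl mulrA.
by rewrite !(e _ _ _ m1 b1) // !(e _ _ _ m2 b2) // ef ek opprD mulrN.
Qed.

(** Integration against a bounded weight is continuous for the L^1 norm, so both sides of the
    identity pass to the limit. *)
Lemma weak_closed d (T : measurableType d) (mu : {measure set T -> \bar R})
    (f1 f2 p1 p2 : T -> R) (c : R) :
  measurable_fun setT p1 -> measurable_fun setT p2 ->
  {ae mu, forall x, `|p1 x| <= c} -> {ae mu, forall x, `|p2 x| <= c} ->
  f1 \in Lfun mu 1%E -> f2 \in Lfun mu 1%E ->
  (forall e : R, 0 < e -> exists k1, exists k2, [/\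
    \int[mu]_x (k1 x * p1 x) = - \int[mu]_x (k2 x * p2 x),
    f1 - k1 \in Lfun mu 1%E /\ nrm mu 1%E (f1 - k1) <= e &
    f2 - k2 \in Lfun mu 1%E /\ nrm mu 1%E (f2 - k2) <= e]) ->
  \int[mu]_x (f1 x * p1 x) = - \int[mu]_x (f2 x * p2 x).
Proof.
move=> m1 m2 b1 b2 F1 F2 H.
apply/eqP; rewrite -subr_eq0 opprK -normr_le0; apply/ler_addgt0Pl => e e0; rewrite addr0.
(* The summand 1 keeps the denominator nonzero, as nothing excludes [c = 0]; the factor 2 splits the
   error between the two sides. *)
have C0 : 0 < 2 * (`|c| + 1) by rewrite mulr_gt0 // ltr_wpDl.
have [k1 [k2 [ek [L1 N1] [L2 N2]]]] := H _ (divr_gt0 e0 C0).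
have split_k (u k p : T -> R) : measurable_fun setT p ->
    {ae mu, forall x, `|p x| <= c} -> u \in Lfun mu 1%E -> u - k \in Lfun mu 1%E ->
    nrm mu 1%E (u - k) <= e / (2 * (`|c| + 1)) ->
    `|\int[mu]_x (u x * p x) - \int[mu]_x (k x * p x)| <= e / 2.
  move=> mp bp U UK N.
  have K : k \in Lfun mu 1%E by rewrite -(subKr u k); exact: LfunB.
  have [iu _] := bounded_mul_le U mp bp; have [ik _] := bounded_mul_le K mp bp.
  have [_] := bounded_mul_le UK mp bp.
  under eq_Rintegral do rewrite -[(u - k) _]/(_ - _) mulrBl.
  rewrite RintegralB // => le; apply: (le_trans le).
  apply: (@le_trans _ _ ((`|c| + 1) * (e / (2 * (`|c| + 1))))).
    apply: (@le_trans _ _ ((`|c| + 1) * nrm mu 1%E (u - k))).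
      by rewrite ler_wpM2r ?nrm_ge0 // (le_trans (ler_norm c)) // lerDl.
    by rewrite ler_wpM2l // addr_ge0.
  have -> : (`|c| + 1) * (e / (2 * (`|c| + 1))) = e / 2.
    have c1 : `|c| + 1 != 0 by rewrite gt_eqF // ltr_wpDl.
    by field.
  by [].
have := split_k _ _ _ m1 b1 F1 L1 N1; have := split_k _ _ _ m2 b2 F2 L2 N2.
rewrite ek => h2 h1; rewrite (splitr e).
rewrite (le_trans _ (lerD h1 h2)) // (le_trans _ (ler_normD _ _)) //.
have e3 (A B C : R) : A - - B + (C - B) = A + C by ring.
by rewrite e3.
Qed.

Lemma weak1_lin (a : R) g h : g.1 \in Lfun muI 1%E -> g.2 \in Lfun muI 1%E ->
  h.1 \in Lfun muI 1%E -> h.2 \in Lfun muI 1%E ->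
  weak1 g -> weak1 h -> weak1 (a *: g + h).
Proof.
move=> g1 g2 h1 h2 wg wh phi tphi; have [c [m1 m2 b1 b2]] := test1_bounded tphi.
by apply: (weak_lin a m2 m1 b2 b1) => //; [exact: wg|exact: wh].
Qed.

Lemma weak2_lin (a : R) y z : y.1 \in Lfun muO 1%E -> vLfun muO 1%E y.2 ->
  z.1 \in Lfun muO 1%E -> vLfun muO 1%E z.2 ->
  weak2 y -> weak2 z -> weak2 (a *: y + z).
Proof.
move=> g1 g2 h1 h2 wg wh phi tphi i; have [c [m1 m2 b1 b2]] := test2_bounded tphi.
have := weak_lin a (m2 i) m1 (b2 i) b1 g1 (g2 i) h1 (h2 i) (wg _ tphi i) (wh _ tphi i).
move=> ->; congr (- _); apply: eq_Rintegral => x _; congr (_ * _).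
by rewrite !mxE.
Qed.

Lemma weak1_closed g : g.1 \in Lfun muI 1%E -> g.2 \in Lfun muI 1%E ->
  (forall e : R, 0 < e -> exists h, [/\ weak1 h,
    g.1 - h.1 \in Lfun muI 1%E /\ nrm muI 1%E (g.1 - h.1) <= e &
    g.2 - h.2 \in Lfun muI 1%E /\ nrm muI 1%E (g.2 - h.2) <= e]) -> weak1 g.
Proof.
move=> g1 g2 H phi tphi; have [c [m1 m2 b1 b2]] := test1_bounded tphi.
apply: (weak_closed m2 m1 b2 b1) => // e /H[h [wh h1 h2]].
by exists h.1, h.2; split=> //; exact: wh.
Qed.

Lemma vnrm_coord_le d (T : measurableType d) (mu : {measure set T -> \bar R})
    p (Y : T -> 'cV[R]_2) i : (1 <= p)%E -> vLfun mu p Y ->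
  nrm mu p (fun x => Y x i 0) <= vnrm mu p Y.
Proof.
move=> p1 YL.
apply: (le_Lfun p1 (Lfun_measurable (YL i)) (vLfun_enorm p1 YL) _).2.
by apply: nearW => x; rewrite [leRHS]ger0_norm ?enorm_ge0 //; exact: le_norm_enorm.
Qed.

Lemma weak2_closed y : y.1 \in Lfun muO 1%E -> vLfun muO 1%E y.2 ->
  (forall e : R, 0 < e -> exists z, [/\ weak2 z,
    y.1 - z.1 \in Lfun muO 1%E /\ nrm muO 1%E (y.1 - z.1) <= e &
    vLfun muO 1%E (y.2 - z.2) /\ vnrm muO 1%E (y.2 - z.2) <= e]) -> weak2 y.
Proof.
move=> g1 g2 H phi tphi i; have [c [m1 m2 b1 b2]] := test2_bounded tphi.
apply: (weak_closed (m2 i) m1 (b2 i) b1 g1 (g2 i)) => // e /H[z [wz z1 [z2 z2e]]].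
exists z.1, (fun x => z.2 x i 0); split=> //; first exact: wz.
have e2 : (fun x => y.2 x i 0) - (fun x => z.2 x i 0) = (fun x => (y.2 - z.2) x i 0).
  by apply/funext => x; rewrite vfun_subE.
by rewrite e2; split; [exact: z2|apply: le_trans z2e; exact: vnrm_coord_le].
Qed.

Lemma W10IP (r : \bar R) g : (1 <= r)%E -> W10I r g <->
  [/\ g.1 \in Lfun muI r, g.2 \in Lfun muI r, weak1 g & approx1 g].
Proof.
move=> r1; split.
  move=> [[g1 g2 wg] tg].
  by have ag := (trace1_0P (Lfun_measurable g1) (Lfun_measurable g2)).1 tg.
move=> [g1 g2 wg ag].
by have tg := (trace1_0P (Lfun_measurable g1) (Lfun_measurable g2)).2 ag.
Qed.

Lemma W10OP (r : \bar R) y : (1 <= r)%E -> W10O r y <->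
  [/\ y.1 \in Lfun muO r, vLfun muO r y.2, weak2 y & approx2 y].
Proof.
move=> r1; split.
  move=> [[g1 g2 wg] tg].
  by have ag := (trace2_0P (Lfun_measurable g1) (vLfun_measurable g2)).1 tg.
move=> [g1 g2 wg ag].
by have tg := (trace2_0P (Lfun_measurable g1) (vLfun_measurable g2)).2 ag.
Qed.

Lemma Lfun1_I (r : \bar R) (f : T1 -> R) : (1 <= r)%E ->
  f \in Lfun muI r -> f \in Lfun muI 1%E.
Proof. by move=> r1; apply: Lfun_le => //; exact: muI_setT. Qed.

Lemma Lfun1_O (r : \bar R) (f : T2 -> R) : (1 <= r)%E ->
  f \in Lfun muO r -> f \in Lfun muO 1%E.
Proof. by move=> r1; apply: Lfun_le => //; exact: muO_setT. Qed.

Lemma vLfun1_O (r : \bar R) (Y : T2 -> 'cV[R]_2) : (1 <= r)%E ->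
  vLfun muO r Y -> vLfun muO 1%E Y.
Proof. by move=> r1 YL i; exact: Lfun1_O (YL i). Qed.

Lemma W10I_lin (r : \bar R) (a : R) g h : (1 <= r)%E ->
  W10I r g -> W10I r h -> W10I r (a *: g + h).
Proof.
move=> r1 /(W10IP _ r1)[g1 g2 wg ag] /(W10IP _ r1)[h1 h2 wh ah].
apply/W10IP => //; split.
- by apply: LfunD => //; exact: LfunZ.
- by apply: LfunD => //; exact: LfunZ.
- by apply: weak1_lin => //; apply: Lfun1_I r1 _.
- exact: approx1_lin.
Qed.

Lemma W10O_lin (r : \bar R) (a : R) y z : (1 <= r)%E ->
  W10O r y -> W10O r z -> W10O r (a *: y + z).
Proof.
move=> r1 /(W10OP _ r1)[g1 g2 wg ag] /(W10OP _ r1)[h1 h2 wh ah].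
apply/W10OP => //; split.
- by apply: LfunD => //; exact: LfunZ.
- by apply: vLfunD => //; exact: vLfunZ.
- by apply: weak2_lin => //; first [apply: Lfun1_O r1 _; done|apply: vLfun1_O r1 _; done].
- exact: approx2_lin.
Qed.

End weak_derivatives.

(** * Completeness of the zero-trace spaces *)

Section completeness.
Context {R : realType}.
Local Notation T1 := (measurableTypeR R).
Local Notation T2 := (measurableTypeR R * measurableTypeR R)%type.
Implicit Types (y z : sob2 R) (g h : sob1 R).

Lemma W10I_sub (r : \bar R) g h : (1 <= r)%E -> W10I r g -> W10I r h -> W10I r (g - h).
Proof.
by move=> r1 gW hW; rewrite addrC -scaleN1r; exact: W10I_lin.
Qed.

Lemma W10O_sub (r : \bar R) y z : (1 <= r)%E -> W10O r y -> W10O r z -> W10O r (y - z).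
Proof.
by move=> r1 yW zW; rewrite addrC -scaleN1r; exact: W10O_lin.
Qed.

Lemma W10I_ae_le (r : \bar R) g : (1 <= r)%E -> W10I r g ->
  {ae @muI R, forall x : T1, 2 * `|g.1 x| <= nrm muI 1%E g.2}.
Proof.
move=> r1 /(W10IP _ r1)[g1 g2 _ ag].
by apply: poincare1 => //; [exact: Lfun1_I r1 g1|exact: Lfun1_I r1 g2].
Qed.

Lemma nrm1_le_oo (f : T1 -> R) : f \in Lfun muI +oo%E ->
  nrm muI 1%E f <= nrm muI +oo%E f.
Proof.
move=> fL; have := Lfun_oo_ae muI_setT fL.
rewrite nrm1E -[leRHS](Rintegral_cst_muI (nrm muI +oo%E f)) => fb.
apply: ae_le_Rintegral fb.
  apply/Lfun1_integrable; apply: (Lfun_normr (lexx 1%E)).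
  exact: Lfun1_I (leey _) fL.
exact: finite_measure_integrable_cst.
Qed.

Lemma W10O_nrm1_le (r : \bar R) y : (1 <= r)%E -> W10O r y ->
  nrm muO 1%E y.1 <= vnrm muO 1%E y.2.
Proof.
move=> r1 /(W10OP _ r1)[y1 y2 _ ay].
have L1 := Lfun1_O r1 y1; have L2 := vLfun1_O r1 y2.
have := poincare2 L1 L2 ay.
have [_ i2 e2] := fubini_slice ((Lfun1_integrable _ _).1 (vLfun_enorm (lexx 1%E) L2)).
have [i3 e3] := integrable_snd i2.
have -> : vnrm muO 1%E y.2 = \int[muO]_x (\int[muI]_s enorm (y.2 (s, x.2))).
  rewrite e3 e2 /vnrm nrm1E; apply: eq_Rintegral => x _.
  by rewrite /= ger0_norm // enorm_ge0.
move=> h; rewrite nrm1E; apply: ae_le_Rintegral => //.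
  by apply/Lfun1_integrable; exact: (Lfun_normr (lexx 1%E) L1).
apply: ae_mp h => x; have := normr_ge0 (y.1 x); set a := \int[_]_s _; lra.
Qed.

Lemma sum_half_le (C : R) n : 0 <= C -> \sum_(i < n) C * 2^-1 ^+ i <= 2 * C.
Proof.
move=> C0; rewrite -mulr_sumr mulrC ler_wpM2r //.
suff -> : \sum_(i < n) 2^-1 ^+ i = 2 - 2 * 2^-1 ^+ n :> R.
  by rewrite gerBl mulr_ge0 // exprn_ge0 // invr_ge0.
elim: n => [|n IH]; first by rewrite big_ord0 expr0; ring.
by rewrite big_ord_recr /= IH exprS; field.
Qed.

Lemma half_expr_small (C e : R) : 0 < e -> exists n : nat, C * 2^-1 ^+ n <= e.
Proof.
move=> e0.
have : geometric C (2^-1 : R) @ \oo --> 0.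
  by apply: cvg_geometric; rewrite ger0_norm ?invr_ge0 // invf_lt1 // ltr1n.
move/cvgr0_norm_le => /(_ e e0) [n _ h]; exists n.
by apply: le_trans (h n _) => //=; exact: ler_norm.
Qed.

(** Only the derivatives are assumed to be Cauchy; Poincare's inequality hands their rate to the
    functions. A geometric rate makes the increments summable, which gives limits almost everywhere,
    and Fatou's lemma on the tail from index [n] on keeps the bound at [n]. Weak derivative and zero
    trace then pass to the limit by closeness in L^1. *)
Lemma W10I_complete (g_ : nat -> sob1 R) (C : R) : 0 <= C ->
  (forall n, W10I +oo%E (g_ n)) ->
  (forall n m, (n <= m)%N ->
     nrm muI +oo%E ((g_ m).2 - (g_ n).2) <= C * 2^-1 ^+ n) ->
  exists g, W10I +oo%E g /\
    forall n, nrm muI +oo%E (g.2 - (g_ n).2) <= C * 2^-1 ^+ n.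
Proof.
move=> C0 gW gC; have oo1 : (1 <= +oo :> \bar R)%E by exact: leey.
have gL n := (W10IP _ oo1).1 (gW n).
have C1 n : 0 <= C * 2^-1 ^+ n by rewrite mulr_ge0 // exprn_ge0 // invr_ge0.
have L1 n : (g_ n).1 \in Lfun muI +oo%E by case: (gL n).
have L2 n : (g_ n).2 \in Lfun muI +oo%E by case: (gL n).
have D2 n m : (g_ m).2 - (g_ n).2 \in Lfun muI +oo%E by exact: LfunB.
have D1 n m : (g_ m).1 - (g_ n).1 \in Lfun muI +oo%E by exact: LfunB.
have N2 n m : (n <= m)%N -> nrm muI 1%E ((g_ m).2 - (g_ n).2) <= C * 2^-1 ^+ n.
  by move=> nm; apply: le_trans (nrm1_le_oo (D2 n m)) (gC n m nm).
have N1 n m : (n <= m)%N -> nrm muI +oo%E ((g_ m).1 - (g_ n).1) <= C * 2^-1 ^+ n.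
  move=> nm; apply: (ae_le_Lfun_oo (C1 n) (Lfun_measurable (D1 n m)) _).2.
  apply: ae_mp (W10I_ae_le oo1 (W10I_sub oo1 (gW m) (gW n))) => x hx.
  have le2 (a b : R) : 0 <= a -> 2 * a <= b -> a <= b by lra.
  exact: le2 (normr_ge0 _) (le_trans hx (N2 n m nm)).
have lim (f : nat -> T1 -> R) : (forall n, f n \in Lfun muI +oo%E) ->
    (forall n m, (n <= m)%N -> nrm muI +oo%E (f m - f n) <= C * 2^-1 ^+ n) ->
    exists F, F \in Lfun muI +oo%E /\
      forall n, nrm muI +oo%E (F - f n) <= C * 2^-1 ^+ n.
  move=> fL fC.
  have fB m n : f m - f n \in Lfun muI +oo%E by exact: LfunB.
  have [F mF cF] : exists2 F : T1 -> R, measurable_fun setT F &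
      {ae @muI R, forall x, f ^~ x @ \oo --> F x}.
    apply: (@ae_cvg_of_summable _ _ _ _ f (2 * C)).
      by move=> n; exact: Lfun1_I oo1 (fL n).
    move=> n; apply: le_trans (sum_half_le n C0); apply: ler_sum => i _.
    by apply: le_trans (nrm1_le_oo (fB _ _)) (fC _ _ _).
  have FB n : F - f n \in Lfun muI +oo%E /\ nrm muI +oo%E (F - f n) <= C * 2^-1 ^+ n.
    apply: (@Lfun_fatou _ _ _ _ _ (fun j => f (j + n)%N - f n)) => //.
    - by move=> j; apply: fC; exact: leq_addl.
    - by apply: measurable_funB => //; exact: Lfun_measurable (fL n).
    - apply: ae_mp cF => x cx; apply: cvgB; last exact: cvg_cst.
      by move: cx; rewrite -(cvg_shiftn n).
  exists F; split=> [|n]; last by have [] := FB n.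
  by rewrite -(subrK (f 0%N) F) LfunD //; have [] := FB 0%N.
have [F1 [F1L F1C]] := lim (fun n => (g_ n).1) L1 N1.
have [F2 [F2L F2C]] := lim (fun n => (g_ n).2) L2 gC.
exists (F1, F2); split=> //; apply/W10IP => //; split=> //=.
- apply: weak1_closed => /=; [exact: Lfun1_I oo1 F1L|exact: Lfun1_I oo1 F2L|].
  move=> e /(half_expr_small C)[n ne]; exists (g_ n); split; first by case: (gL n).
  + have L : F1 - (g_ n).1 \in Lfun muI +oo%E by exact: LfunB.
    split; first exact: Lfun1_I oo1 L.
    by rewrite (le_trans (nrm1_le_oo L)) // (le_trans (F1C n)).
  + have L : F2 - (g_ n).2 \in Lfun muI +oo%E by exact: LfunB.
    split; first exact: Lfun1_I oo1 L.
    by rewrite (le_trans (nrm1_le_oo L)) // (le_trans (F2C n)).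
- apply: approx1_closed => e /(half_expr_small C)[n ne]; exists (g_ n).
  split; first by case: (gL n).
  + have L : F1 - (g_ n).1 \in Lfun muI +oo%E by exact: LfunB.
    split; first exact: Lfun1_I oo1 L.
    by rewrite (le_trans (nrm1_le_oo L)) // (le_trans (F1C n)).
  + have L : F2 - (g_ n).2 \in Lfun muI +oo%E by exact: LfunB.
    split; first exact: Lfun1_I oo1 L.
    by rewrite (le_trans (nrm1_le_oo L)) // (le_trans (F2C n)).
Qed.

Lemma vnrm1_le (p : R) (Y : T2 -> 'cV[R]_2) : 1 < p -> vLfun muO p%:E Y ->
  vnrm muO 1%E Y <= vnrm muO p%:E Y.
Proof.
move=> p1 YL; apply: nrm1_le => //; first exact: muO_setT.
by apply: vLfun_enorm => //; rewrite lee_fin ltW.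
Qed.

(** The gradient components converge separately almost everywhere, but Fatou's lemma is applied to
    the Euclidean norm of the difference, so that [C] is not enlarged. The functions converge in L^1
    only, and [Lfun_poincare2] puts the limit in L^p. *)
Lemma W10O_complete (p C : R) (y_ : nat -> sob2 R) : 1 < p -> 0 <= C ->
  (forall n, W10O p%:E (y_ n)) ->
  (forall n m, (n <= m)%N ->
     vnrm muO p%:E ((y_ m).2 - (y_ n).2) <= C * 2^-1 ^+ n) ->
  exists y, W10O p%:E y /\
    forall n, vnrm muO p%:E (y.2 - (y_ n).2) <= C * 2^-1 ^+ n.
Proof.
move=> p1 C0 yW yC; have pe : (1 <= p%:E)%E by rewrite lee_fin ltW.
have yL n := (W10OP _ pe).1 (yW n).
have C1 n : 0 <= C * 2^-1 ^+ n by rewrite mulr_ge0 // exprn_ge0 // invr_ge0.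
have L1 n : (y_ n).1 \in Lfun muO p%:E by case: (yL n).
have L2 n : vLfun muO p%:E (y_ n).2 by case: (yL n).
have D2 n m : vLfun muO p%:E ((y_ m).2 - (y_ n).2) by exact: vLfunB.
have N2 n m : (n <= m)%N -> vnrm muO 1%E ((y_ m).2 - (y_ n).2) <= C * 2^-1 ^+ n.
  by move=> nm; apply: le_trans (vnrm1_le p1 (D2 n m)) (yC n m nm).
have N1 n m : (n <= m)%N -> nrm muO 1%E ((y_ m).1 - (y_ n).1) <= C * 2^-1 ^+ n.
  move=> nm; apply: le_trans (N2 n m nm).
  exact: (W10O_nrm1_le pe (W10O_sub pe (yW m) (yW n))).
have lim (f : nat -> T2 -> R) : (forall n, f n \in Lfun muO 1%E) ->
    (forall n m, (n <= m)%N -> nrm muO 1%E (f m - f n) <= C * 2^-1 ^+ n) ->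
    exists2 F : T2 -> R, measurable_fun setT F &
      {ae @muO R, forall x, f ^~ x @ \oo --> F x}.
  move=> fL fC; apply: (@ae_cvg_of_summable _ _ _ _ f (2 * C)) => // n.
  by apply: le_trans (sum_half_le n C0); apply: ler_sum => i _; exact: fC.
have [F mF cF] := lim (fun n => (y_ n).1) (fun n => Lfun1_O pe (L1 n)) N1.
have Hi i : exists2 K : T2 -> R, measurable_fun setT K &
    {ae @muO R, forall x, (fun n => (y_ n).2 x i 0) @ \oo --> K x}.
  apply: (lim (fun n x => (y_ n).2 x i 0)).
    by move=> n; exact: Lfun1_O pe (L2 n i).
  move=> n m nm; apply: le_trans (N2 n m nm).
  have := vnrm_coord_le i (lexx 1%E) (vLfun1_O pe (D2 n m)).
  by under eq_fun do rewrite vfun_subE.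
have [K0 mK0 cK0] := Hi 0; have [K1 mK1 cK1] := Hi 1.
pose Y (x : T2) : 'cV[R]_2 := \col_i (if i == 0 then K0 x else K1 x).
have mY i : measurable_fun [set: T2] (fun x => Y x i 0).
  rewrite (_ : (fun x => _) = if i == 0 then K0 else K1); first by case: ifP.
  by apply/funext => x; rewrite /Y mxE; case: ifP.
have YN n : enorm \o (Y - (y_ n).2) \in Lfun muO p%:E /\
    nrm muO p%:E (enorm \o (Y - (y_ n).2)) <= C * 2^-1 ^+ n.
  apply: (@Lfun_fatou _ T2 R muO p%:E
    (fun j => enorm \o ((y_ (j + n)%N).2 - (y_ n).2))) => //.
  - by move=> j; exact: vLfun_enorm.
  - by move=> j; apply: yC; exact: leq_addl.
  - apply: measurable_enorm => i; under eq_fun do rewrite vfun_subE.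
    by apply: measurable_funB => //; exact: Lfun_measurable (L2 n i).
  - apply: ae_mp2 cK0 cK1 => x c0 c1.
    have cB (K : T2 -> R) i : (fun n => (y_ n).2 x i 0) @ \oo --> K x ->
        (fun j => ((y_ (j + n)%N).2 - (y_ n).2) x i 0) @ \oo --> K x - (y_ n).2 x i 0.
      move=> cK; under eq_fun do rewrite vfun_subE.
      by apply: cvgB; [move: cK; rewrite -(cvg_shiftn n)|exact: cvg_cst].
    have b0 := cB _ _ c0; have b1 := cB _ _ c1.
    pose Z j : 'cV[R]_2 := ((y_ (j + n)%N).2 - (y_ n).2) x.
    have cd : (fun j => dot (Z j) (Z j)) @ \oo --> dot ((Y - (y_ n).2) x) ((Y - (y_ n).2) x).
      rewrite dotE !vfun_subE {1 2 3 4}/Y !mxE /=.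
      rewrite (_ : (fun j => _) = (fun j => Z j 0 0 * Z j 0 0 + Z j 1 0 * Z j 1 0)).
        by apply: cvgD; apply: cvgM.
      by apply/funext => j; rewrite dotE.
    exact: (cvg_comp _ _ cd (@sqrt_continuous _ _)).
have YB n : vLfun muO p%:E (Y - (y_ n).2).
  apply: (vLfun_le_enorm pe _ (YN n).1).
    move=> i; under eq_fun do rewrite vfun_subE.
    by apply: measurable_funB => //; exact: Lfun_measurable (L2 n i).
  by apply: nearW => x; exact: ler_norm.
have YL : vLfun muO p%:E Y.
  by rewrite -(subrK (y_ 0%N).2 Y); apply: vLfunD.
have FN n : F - (y_ n).1 \in Lfun muO 1%E /\ nrm muO 1%E (F - (y_ n).1) <= C * 2^-1 ^+ n.
  apply: (@Lfun_fatou _ T2 R muO 1%E (fun j => (y_ (j + n)%N).1 - (y_ n).1)) => //.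
  - by move=> j; exact: Lfun1_O pe (LfunB pe (L1 _) (L1 _)).
  - by move=> j; apply: N1; exact: leq_addl.
  - by apply: measurable_funB => //; exact: Lfun_measurable (L1 n).
  - apply: ae_mp cF => x cx; apply: cvgB; last exact: cvg_cst.
    by move: cx; rewrite -(cvg_shiftn n).
have FL : F \in Lfun muO 1%E.
  by rewrite -(subrK (y_ 0%N).1 F) LfunD ?(FN 0%N).1 //; exact: Lfun1_O pe (L1 0%N).
have close e : 0 < e -> exists n,
    (F - (y_ n).1 \in Lfun muO 1%E /\ nrm muO 1%E (F - (y_ n).1) <= e) /\
    (vLfun muO 1%E (Y - (y_ n).2) /\ vnrm muO 1%E (Y - (y_ n).2) <= e).
  move=> /(half_expr_small C)[n ne]; exists n; split.
    by have [L N] := FN n; split=> //; exact: le_trans ne.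
  split; first exact: vLfun1_O pe (YB n).
  by rewrite (le_trans (vnrm1_le p1 (YB n))) // (le_trans (YN n).2).
have aY : approx2 (F, Y).
  apply: approx2_closed => e /close[n [c1 c2]]; exists (y_ n); split=> //.
  by case: (yL n).
exists (F, Y); split=> [|n]; last exact: (YN n).2.
apply/W10OP => //; split=> //=.
- by apply: (@Lfun_poincare2 _ p (F, Y)).
- apply: weak2_closed => //=; first exact: vLfun1_O pe YL.
  by move=> e /close[n [c1 c2]]; exists (y_ n); split=> //; case: (yL n).
Qed.

End completeness.

(** * The coefficient matrix, its derivative and its Taylor remainder *)

Section coefficient_matrix.
Context {R : realType}.
Local Notation T1 := (measurableTypeR R).
Local Notation T2 := (measurableTypeR R * measurableTypeR R)%type.
Implicit Types (g h : sob1 R).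

Lemma mx22P (M N : 'M[R]_2) : M 0 0 = N 0 0 -> M 0 1 = N 0 1 ->
  M 1 0 = N 1 0 -> M 1 1 = N 1 1 -> M = N.
Proof.
move=> e00 e01 e10 e11; apply/matrixP => i j.
have ord2 (k : 'I_2) : k = 0 \/ k = 1.
  by case: k => -[|[|//]] Hk; [left|right]; exact/val_inj.
by case: (ord2 i) => ->; case: (ord2 j) => ->.
Qed.

Lemma is_derive_affine (a b : R) (x : R) : is_derive x 1 (fun t : R => a + t * b) b.
Proof.
have h := @is_deriveD R R R (cst a) (b \*: id) x 1 0 b.
rewrite (_ : (fun t => _) = cst a + b \*: id); last by apply/funext => t; rewrite /= mulrC.
by apply: is_derive_eq; rewrite add0r /GRing.scale /= mulr1.
Qed.

Lemma derive1_affine (a b : R) (x : R) : derive1 (fun t : R => a + t * b) x = b.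
Proof. by rewrite derive1E; have [_ ->] := is_derive_affine a b x. Qed.

(* Also when [a = 0]: if [c <> 0] the difference quotients diverge, and both
   the derivative and the right-hand side take the junk value 0. *)
Lemma derive1_quot (a b c d s : R) :
  derive1 (fun t : R => (1 + ((b + t * d) * s) ^+ 2) / (a + t * c)) 0
  = 2 * b * d * s ^+ 2 / a - (1 + (b * s) ^+ 2) * c / a ^+ 2.
Proof.
pose w := fun t : R => b + t * d.
have dw : is_derive (0 : R) (1 : R) w d := is_derive_affine b d 0.
have dw2 : is_derive (0 : R) (1 : R) (w * w) (w 0 *: d + w 0 *: d) by exact: is_deriveM.
have d1 : is_derive (0 : R) (1 : R) (cst 1 : R -> R) 0 by exact: is_derive_cst.
pose N : R -> R := cst 1 + (s ^+ 2) \*: (w * w).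
have dN : is_derive (0 : R) (1 : R) N (0 + (s ^+ 2) *: (w 0 *: d + w 0 *: d)).
  by apply: is_deriveD; exact: is_deriveZ.
have NE t : N t = 1 + ((b + t * d) * s) ^+ 2.
  by rewrite -[N t]/(1 + s ^+ 2 * (w t * w t)) /w; ring.
have [->|a0] := eqVneq a 0.
  rewrite expr0n /= invr0 !mulr0 subr0.
  have [->|c0] := eqVneq c 0.
    under eq_fun do rewrite mulr0 addr0 invr0 mulr0.
    by rewrite derive1_cst.
  rewrite /derive1 dvgP //= => /cvg_ex[l fl].
  have cN : N t @[t --> (0:R)^'] --> N 0.
    have cN0 : N t @[t --> (0:R)] --> N 0.
      by apply/differentiable_continuous/derivable1_diffP; case: dN.
    by apply: cvg_trans cN0; apply: cvg_app; exact: cvg_within.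
  have cid : (t : R) @[t --> (0:R)^'] --> (0:R) by exact: cvg_within.
  pose f (t : R) := (1 + ((b + t * d) * s) ^+ 2) / (0 + t * c).
  (* A limit [l] of the quotients would make their product with [t * t] tend to 0. For nonzero [t]
     this product is [N t / c], which tends to [N 0 / c], and [N 0] is at least 1. *)
  have cl : (fun t => t * t * (t^-1 *: (f (t + 0) - f 0))) t @[t --> (0:R)^'] --> 0 * 0 * l.
    by apply: cvgM; [exact: cvgM|exact: fl].
  have cr : N t / c @[t --> (0:R)^'] --> 0 * 0 * l.
    apply: cvg_trans cl; apply: near_eq_cvg; near=> t.
    have t0 : t != 0 by near: t; exact: nbhs_dnbhs_neq.
    rewrite /f /GRing.scale /= !addr0 !add0r !mul0r invr0 mulr0 subr0.
    by rewrite NE; field; rewrite t0 c0.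
  have e : N 0 * c^-1 = 0 * 0 * l.
    exact: (cvg_unique (@norm_hausdorff _ _) (cvgM cN (cvg_cst c^-1)) cr).
  move/eqP : e; rewrite !mul0r.
  by rewrite mulf_eq0 invr_eq0 (negbTE c0) orbF NE gt_eqF // ltr_pwDl // sqr_ge0.
pose u := fun t : R => a + t * c.
have du : is_derive (0 : R) (1 : R) u c := is_derive_affine a c 0.
have u0 : u 0 != 0 by rewrite /u mul0r addr0.
have dq := is_deriveM dN (is_deriveV u0 du).
rewrite derive1E (_ : (fun t => _) = N * (fun t => (u t)^-1)); last first.
  by apply/funext => t; rewrite -[RHS]/(N t * (u t)^-1) NE.
have [_ ->] := dq.
rewrite /GRing.scale /= NE /u /w !mul0r !addr0; field.
by rewrite a0.
Unshelve. all: by end_near. Qed.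

Definition DAform g h (x : R * R) : 'M[R]_2 :=
  let a := 1 + g.1 x.1 in let b := g.2 x.1 in
  let c := h.1 x.1 in let d := h.2 x.1 in
  mx22 c (- (d * x.2)) (- (d * x.2))
    (2 * b * d * x.2 ^+ 2 / a - (1 + (b * x.2) ^+ 2) * c / a ^+ 2).

(** [derive1_quot] also covers the zeros of [1 + g.1], so the formula holds at every point.
    Linearity in [h] and measurability follow everywhere, with no exceptional set. *)
Lemma DAmxE g h x : DAmx g h x = DAform g h x.
Proof.
apply: mx22P; rewrite !mxE /=.
- rewrite (_ : (fun t => _) = (fun t => (1 + g.1 x.1) + t * h.1 x.1)).
    exact: derive1_affine.
  by apply/funext => t; rewrite !mxE /= -addrA.
- rewrite (_ : (fun t => _) = (fun t => - (g.2 x.1 * x.2) + t * (- (h.2 x.1 * x.2)))).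
    exact: derive1_affine.
  by apply/funext => t; rewrite !mxE /= -[(g.2 + _) _]/(g.2 x.1 + t * h.2 x.1); ring.
- rewrite (_ : (fun t => _) = (fun t => - (g.2 x.1 * x.2) + t * (- (h.2 x.1 * x.2)))).
    exact: derive1_affine.
  by apply/funext => t; rewrite !mxE /= -[(g.2 + _) _]/(g.2 x.1 + t * h.2 x.1); ring.
- rewrite -derive1_quot; congr (derive1 _ _).
  by apply/funext => t; rewrite !mxE /= addrA.
Qed.

Lemma DAmx_lin g h1 h2 (a : R) x :
  DAmx g (a *: h1 + h2) x = a *: DAmx g h1 x + DAmx g h2 x.
Proof.
rewrite !DAmxE; apply: mx22P; rewrite !mxE /=
  -?[(a *: h1.1 + h2.1) _]/(a * h1.1 x.1 + h2.1 x.1)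
  -?[(a *: h1.2 + h2.2) _]/(a * h1.2 x.1 + h2.2 x.1); ring.
Qed.

Lemma DAmxZ g h (a : R) x : DAmx g (a *: h) x = a *: DAmx g h x.
Proof.
rewrite !DAmxE; apply: mx22P; rewrite !mxE /=
  -?[(a *: h.1) _]/(a * h.1 x.1) -?[(a *: h.2) _]/(a * h.2 x.1); ring.
Qed.

(** The inverse is written as [x] times a real power of the nonnegative number [x ^+ 2]; at 0 both
    sides are 0. *)
Lemma measurable_inv_fun : measurable_fun setT (fun x : R => x^-1).
Proof.
rewrite (_ : (fun x => _) = (fun x => x * (x ^+ 2) `^ (-1))); last first.
  apply/funext => x; rewrite powR_inv1 ?sqr_ge0 // expr2 invfM mulrA.
  have [->|x0] := eqVneq x 0; first by rewrite invr0 !mulr0.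
  by rewrite divff // mul1r.
apply: measurable_funM => //.
exact: (@measurableT_comp _ _ _ _ _ _ (@powR R ^~ (-1))).
Qed.

Lemma measurable_Amx g i j : measurable_fun [set: T1] g.1 ->
  measurable_fun [set: T1] g.2 -> measurable_fun [set: T2] (fun x => Amx g x i j).
Proof.
move=> m1 m2.
have n1 : measurable_fun [set: T2] (fun x => 1 + g.1 x.1).
  by apply: measurable_funD => //; apply: measurableT_comp => //; exact: measurable_fst.
have n2 : measurable_fun [set: T2] (fun x => g.2 x.1 * x.2).
  by apply: measurable_funM; [apply: measurableT_comp => //; exact: measurable_fst
    |exact: measurable_snd].
rewrite (_ : (fun x => _) = if i == 0
  then (if j == 0 then (fun x => 1 + g.1 x.1) else (fun x => - (g.2 x.1 * x.2)))
  else (if j == 0 then (fun x => - (g.2 x.1 * x.2)) else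
    (fun x => (1 + (g.2 x.1 * x.2) ^+ 2) / (1 + g.1 x.1)))); last first.
  by apply/funext => x; rewrite !mxE; case: ifP => _; case: ifP.
have n3 : measurable_fun [set: T2] (fun x => (1 + g.1 x.1)^-1).
  exact: measurableT_comp measurable_inv_fun n1.
case: (i == 0); case: (j == 0) => //; try exact: measurableT_comp n2.
apply: measurable_funM n3.
by apply: measurable_funD => //; exact: measurable_funX.
Qed.

Lemma measurable_DAmx g h i j : measurable_fun [set: T1] g.1 ->
  measurable_fun [set: T1] g.2 -> measurable_fun [set: T1] h.1 ->
  measurable_fun [set: T1] h.2 -> measurable_fun [set: T2] (fun x => DAmx g h x i j).
Proof.
move=> m1 m2 k1 k2.
have fst_meas (f : T1 -> R) : measurable_fun setT f ->
    measurable_fun [set: T2] (fun x => f x.1).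
  by move=> mf; apply: measurableT_comp => //; exact: measurable_fst.
have snd_meas : measurable_fun [set: T2] (fun x : T2 => x.2) by exact: measurable_snd.
have n1 : measurable_fun [set: T2] (fun x => (1 + g.1 x.1)^-1).
  apply: measurableT_comp measurable_inv_fun _.
  by apply: measurable_funD => //; exact: fst_meas.
have n2 : measurable_fun [set: T2] (fun x => - (h.2 x.1 * x.2)).
  apply: measurableT_comp => //.
  by apply: measurable_funM => //; exact: fst_meas.
pose F (x : T2) : R := 2 * g.2 x.1 * h.2 x.1 * x.2 ^+ 2 / (1 + g.1 x.1)
  - (1 + (g.2 x.1 * x.2) ^+ 2) * h.1 x.1 * (1 + g.1 x.1)^-1 ^+ 2.
have n3 : measurable_fun [set: T2] F.
  apply: measurable_funB.
    apply: measurable_funM => //; apply: measurable_funM; last exact: measurable_funX.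
    apply: measurable_funM; last exact: fst_meas.
    by apply: measurable_funM => //; exact: fst_meas.
  apply: measurable_funM; last exact: measurable_funX.
  apply: measurable_funM; last exact: fst_meas.
  apply: measurable_funD => //; apply: measurable_funX.
  by apply: measurable_funM => //; exact: fst_meas.
rewrite (_ : (fun x => _) = if i == 0
  then (if j == 0 then (fun x => h.1 x.1) else (fun x => - (h.2 x.1 * x.2)))
  else (if j == 0 then (fun x => - (h.2 x.1 * x.2)) else F)); last first.
  apply/funext => x; rewrite DAmxE !mxE; case: ifP => _; case: ifP => // _.
  by rewrite /F exprVn.
by case: (i == 0); case: (j == 0) => //; exact: fst_meas.
Qed.

(** Three entries of [Amx] are affine in [g], so only the last one contributes. Its exact remainder
    is a sum of three terms, each carrying two increments among [c] and [d]. Both inverses are at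
    most 2 and [b], [s] at most 1 in absolute value, so the terms are at most 16, 8 and 2 times
    [m ^+ 2], which gives 26. *)
Lemma remainder_le g h x (m : R) : 1 / 2 <= 1 + g.1 x.1 ->
  1 / 2 <= 1 + (g + h).1 x.1 -> `|g.2 x.1| <= 1 -> dom1 x.2 ->
  `|h.1 x.1| <= m -> `|h.2 x.1| <= m ->
  opnorm (Amx (g + h) x - Amx g x - DAmx g h x) <= 26 * m ^+ 2.
Proof.
case: x => x s /=; rewrite -[(g.1 + h.1) x]/(g.1 x + h.1 x) => a0 ac0 b1 ds c1 d1.
move: ds; rewrite /dom1 /= in_itv /= => /andP[s0 s1].
rewrite (le_trans (opnorm_le_sum _)) // DAmxE /mxsum.
set b := g.2 x in b1 *; set c := h.1 x in ac0 c1 *; set d := h.2 x in d1 *.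
pose a := 1 + g.1 x; rewrite -/a in a0; rewrite addrA -/a in ac0.
have a_n0 : a != 0 by rewrite gt_eqF //; lra.
have ac_n0 : a + c != 0 by rewrite gt_eqF //; lra.
have z0 : `|0 : R| = 0 by exact: normr0.
rewrite (_ : (Amx (g + h) (x, s) - Amx g (x, s) - DAform g h (x, s)) 0 0 = 0); last first.
  by rewrite !mxE /= -[(g.1 + h.1) x]/(g.1 x + h.1 x); ring.
rewrite (_ : (Amx (g + h) (x, s) - Amx g (x, s) - DAform g h (x, s)) 0 1 = 0); last first.
  by rewrite !mxE /= -[(g.2 + h.2) x]/(g.2 x + h.2 x); ring.
rewrite (_ : (Amx (g + h) (x, s) - Amx g (x, s) - DAform g h (x, s)) 1 0 = 0); last first.
  by rewrite !mxE /= -[(g.2 + h.2) x]/(g.2 x + h.2 x); ring.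
rewrite (_ : (Amx (g + h) (x, s) - Amx g (x, s) - DAform g h (x, s)) 1 1 =
  (1 + (b * s) ^+ 2) * a^-1 ^+ 2 * (a + c)^-1 * c ^+ 2
  - 2 * b * s ^+ 2 * (a^-1 * (a + c)^-1) * (d * c) + s ^+ 2 * (a + c)^-1 * d ^+ 2); last first.
  rewrite !mxE /= -[(g.2 + h.2) x]/(b + d) -[(g.1 + h.1) x]/(g.1 x + c) -/b -/c -/d.
  rewrite addrA -/a; field.
  by rewrite a_n0 ac_n0.
rewrite z0 !add0r.
have m0 : 0 <= m by exact: le_trans (normr_ge0 _) c1.
have ia : 0 <= a^-1 <= 2.
  by rewrite invr_ge0 -[2]invrK lef_pV2 ?posrE; lra.
have ic : 0 <= (a + c)^-1 <= 2.
  by rewrite invr_ge0 -[2]invrK lef_pV2 ?posrE; lra.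
case/andP: ia => ia0 ia2; case/andP: ic => ic0 ic2.
have mulb (u v U V : R) : `|u| <= U -> `|v| <= V -> `|u * v| <= U * V.
  by move=> hu hv; rewrite normrM ler_pM.
have nia : `|a^-1| <= 2 by rewrite ger0_norm.
have nic : `|(a + c)^-1| <= 2 by rewrite ger0_norm.
have ns : `|s| <= 1 by rewrite ger0_norm ltW.
have ns2 : `|s ^+ 2| <= 1 by rewrite expr2 -[1]mulr1; exact: (mulb).
have nb : `|1 + (b * s) ^+ 2| <= 2.
  rewrite (le_trans (ler_normD _ _)) // normr1 -[2]/(1 + 1) lerD2l expr2 -[1]mulr1.
  by apply: (mulb _ _ 1 1); rewrite -[1]mulr1; apply: (mulb).
have t1 : `|(1 + (b * s) ^+ 2) * a^-1 ^+ 2 * (a + c)^-1 * c ^+ 2| <= 2 * (2 * 2) * 2 * (m * m).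
  rewrite [c ^+ 2]expr2 [a^-1 ^+ 2]expr2; apply: (mulb); last exact: (mulb).
  by apply: (mulb) => //; apply: (mulb) => //; exact: (mulb).
have t2 : `|2 * b * s ^+ 2 * (a^-1 * (a + c)^-1) * (d * c)| <= 2 * 1 * 1 * (2 * 2) * (m * m).
  apply: (mulb); last exact: (mulb).
  by apply: (mulb); [do 2?[apply: (mulb) => //]; rewrite ger0_norm|exact: (mulb)].
have t3 : `|s ^+ 2 * (a + c)^-1 * d ^+ 2| <= 1 * 2 * (m * m).
  by rewrite [d ^+ 2]expr2; apply: (mulb); exact: (mulb).
rewrite (le_trans (ler_normD _ _)) // (le_trans (lerD (ler_normB _ _) (lexx _))) //.
rewrite (le_trans (lerD (lerD t1 t2) t3)) // expr2; lra.
Qed.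

End coefficient_matrix.

(** * A direction of unit seminorm *)

Section unit_direction.
Context {R : realType}.
Local Notation T1 := (measurableTypeR R).
Implicit Types (g h : sob1 R).

Lemma semi1E (r : \bar R) g : semi1 r g = 'N[muI]_r[EFin \o g.2]%E.
Proof. by []. Qed.

Lemma parabola_derive (x : R) :
  is_derive x (1 : R) (fun t : R => t * (1 - t)) (1 - 2 * x).
Proof.
have d1 : is_derive x (1 : R) (fun t : R => 0 + t * 1) 1 by exact: is_derive_affine.
have d2 : is_derive x (1 : R) (fun t : R => 1 + t * -1) (-1) by exact: is_derive_affine.
rewrite (_ : (fun t => _) = (fun t : R => 0 + t * 1) * (fun t : R => 1 + t * -1)).
  apply: is_derive_eq; rewrite /GRing.scale /=; ring.
by apply/funext => t; rewrite -[RHS]/((0 + t * 1) * (1 + t * -1)); ring.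
Qed.

Lemma parabola_derive1 : derive1 (fun t : R => t * (1 - t)) = (fun t => 1 + t * -2).
Proof.
apply/funext => x; rewrite derive1E; have [_ ->] := parabola_derive x; ring.
Qed.

Lemma parabola_smooth1 : smooth1 (fun t : R => t * (1 - t)).
Proof.
have d2 : derive1 (fun t : R => 1 + t * -2) = cst (-2).
  by apply/funext => x; rewrite derive1_affine.
have dc (c : R) : derive1 (cst c : R -> R) = cst 0.
  by apply/funext => x; rewrite derive1_cst.
have dn (n : nat) (c : R) : exists c', derive1n n (cst c : R -> R) = cst c'.
  elim: n => [|n [c' IH]]; first by exists c.
  by exists 0; rewrite derive1nS IH dc.
case=> [x|[x|n x]].
- by have [] := parabola_derive x.
- by rewrite derive1nS derive1n0 parabola_derive1; have [] := is_derive_affine 1 (-2) x.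
- have e : derive1n n.+2 (fun t : R => t * (1 - t)) = derive1n n (cst (-2 : R) : R -> R).
    by rewrite /derive1n !iterSr parabola_derive1 d2.
  by have [c' ec] := dn n (-2); rewrite e ec; exact: derivable_cst.
Qed.

Lemma test1_boundary (phi : R -> R) : test1 phi -> phi 0 = 0 /\ phi 1 = 0.
Proof.
move=> [_ [K [_ Kd K0]]]; split; apply: K0 => /Kd; rewrite /dom1 /= in_itv /=.
  by rewrite ltxx.
by rewrite ltxx andbF.
Qed.

Lemma smooth1_weak1 (f : R -> R) : smooth1 f -> weak1 (f, derive1 f).
Proof.
move=> sf phi tphi; have [p0 p1] := test1_boundary tphi; have [sphi _] := tphi.
have [cf df cf'] := smooth1_continuous sf.
have [cp dp cp'] := smooth1_continuous sphi.
have dE : derive1 (f * phi) = (fun x => f x * derive1 phi x + derive1 f x * phi x).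
  apply/funext => x; rewrite derive1E deriveM // -!derive1E.
  by rewrite /GRing.scale /= [derive1 f x * _]mulrC.
have c1 : continuous (fun x => f x * derive1 phi x).
  by move=> x; apply: cvgM; [exact: cf|exact: cp'].
have c2 : continuous (fun x => derive1 f x * phi x).
  by move=> x; apply: cvgM; [exact: cf'|exact: cp].
have cd : continuous (derive1 (f * phi)).
  by rewrite dE => x; apply: cvgD; [exact: c1|exact: c2].
have dd x : derivable (f * phi) x 1 by exact: derivableM.
have := Rintegral_derive1 ler01 dd cd; rewrite -(Rintegral_muI cd) dE.
rewrite RintegralD //; [|exact: integrable_muI|exact: integrable_muI].
rewrite -[(f * phi) 1]/(f 1 * phi 1) -[(f * phi) 0]/(f 0 * phi 0) p0 p1 !mulr0 subr0.
by move/eqP; rewrite addr_eq0 => /eqP.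
Qed.

Lemma smooth1_W10I (f : R -> R) : smooth1 f -> f 0 = 0 -> f 1 = 0 ->
  W10I +oo%E (f, derive1 f).
Proof.
move=> sf f0 f1; have [cf df cf'] := smooth1_continuous sf.
have Loo (k : R -> R) : continuous k -> k \in Lfun muI +oo%E.
  move=> ck; have [c kc] := continuous_bounded_dom1 ck.
  have c0 : 0 <= Num.max 0 c by rewrite le_max lexx.
  apply: (ae_le_Lfun_oo c0 _ _).1; first exact: continuous_measurable_fun.
  by apply: ae_mp kc => x; rewrite le_max orbC => ->.
have l0 : (0 : T1 -> R) \in Lfun muI 1%E by apply: Lfun_cst1 => //; exact: muI_setT.
have n0 : nrm muI 1%E (0 : T1 -> R) = 0.
  by have := nrmZ 0 (lexx 1%E) l0; rewrite scale0r normr0 mul0r.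
apply/W10IP; first exact: leey.
split; [exact: Loo|exact: Loo|exact: smooth1_weak1|].
move=> e e0; exists f; split=> //=; rewrite ?f0 ?f1 ?normr0; last 2 first; try exact: ltW.
- by rewrite subrr; split=> //; rewrite (_ : nrm _ _ _ = 0) ?ltW //; exact: n0.
- by rewrite subrr; split=> //; rewrite (_ : nrm _ _ _ = 0) ?ltW //; exact: n0.
Qed.

(** The suprema in [A_bound] range over unit directions and would be [-oo] over an empty set. The
    normalized parabola [t * (1 - t)] shows that they are nonnegative, so that each term of the sum
    can be bounded by the whole. *)
Lemma exists_unit_W10I : exists h, W10I +oo%E h /\ semi1 +oo%E h = 1%E.
Proof.
pose f (t : R) := t * (1 - t); have oo1 : (1 <= +oo :> \bar R)%E by exact: leey.
have fW : W10I +oo%E (f, derive1 f).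
  apply: smooth1_W10I; first exact: parabola_smooth1.
    by rewrite /f mul0r.
  by rewrite /f subrr mulr0.
have [_ f2L _ _] := (W10IP _ oo1).1 fW.
(* A zero seminorm would make the parabola vanish almost everywhere by Poincare's inequality,
   although it is positive on the interval. *)
have N0 : nrm muI +oo%E (derive1 f) != 0.
  apply/eqP => N0; have := W10I_ae_le oo1 fW.
  have := nrm1_le_oo f2L; rewrite N0 => N1.
  move=> fae; have : {ae @muI R, forall x : T1, False}.
    apply: ae_mp2 fae (@ae_muI_dom1 R) => x /= fx.
    rewrite /dom1 /= in_itv /= => /andP[x0 x1].
    have : 0 < f x by rewrite /f mulr_gt0 // subr_gt0.
    move: (le_trans fx N1) => {fx}; have := ler_norm (f x).
    set a := `|_|; set b := f x; lra.
  move=> [N [mN NN0 NF]]; have := muI_setT (R := R).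
  suff -> : [set: T1] = N by rewrite NN0 => /eqP; rewrite eq_sym onee_eq0.
  by apply/seteqP; split=> x // _; exact: (NF x).
exists ((nrm muI +oo%E (derive1 f))^-1 *: (f, derive1 f)); split.
  rewrite -[_ *: _]addr0; apply: W10I_lin => //.
  have := W10I_sub oo1 fW fW; by rewrite subrr.
have L := LfunZ (nrm muI +oo%E (derive1 f))^-1 oo1 f2L.
rewrite semi1E (nrmE L) nrmZ // ger0_norm ?invr_ge0 ?nrm_ge0 //.
by rewrite mulVf.
Qed.

End unit_direction.

(** * Almost everywhere bounds for the coefficients *)

Section coefficient_bounds.
Context {R : realType}.
Local Notation T1 := (measurableTypeR R).
Local Notation T2 := (measurableTypeR R * measurableTypeR R)%type.
Implicit Types (g h : sob1 R).

Lemma mxLinf_le_ae (M : R * R -> 'M[R]_2) (c : R) : (mxLinf M <= c%:E)%E ->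
  {ae @muO R, forall x : T2, opnorm (M x) <= c}.
Proof.
rewrite /mxLinf unlock muO_setT lte01 => /ess_supP; apply: ae_mp => x.
by rewrite /= lee_fin ger0_norm ?opnorm_ge0.
Qed.

Lemma mxLinf_ge0 (M : R * R -> 'M[R]_2) : (0 <= mxLinf M)%E.
Proof. exact: Lnorm_ge0. Qed.

Let oo1 : (1 <= +oo :> \bar R)%E. Proof. exact: leey. Qed.

Lemma W10I_oo_ae (g : sob1 R) : W10I +oo%E g ->
  {ae @muI R, forall x : T1, `|g.1 x| <= nrm muI +oo%E g.2 /\
    `|g.2 x| <= nrm muI +oo%E g.2}.
Proof.
move=> gW; have [_ g2 _ _] := (W10IP _ oo1).1 gW.
have := W10I_ae_le oo1 gW; have := Lfun_oo_ae muI_setT g2.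
apply: ae_mp2 => x h2 h1; split=> //.
have le2 (a b : R) : 0 <= a -> 2 * a <= b -> a <= b by lra.
exact: le2 (normr_ge0 _) (le_trans h1 (nrm1_le_oo g2)).
Qed.

(** The state constraint bounds the L^1 norm of the derivative by 1, and the factor 2 in Poincare's
    inequality turns this into [g.1 >= - 1 / 2]. *)
Lemma admissible_half_le g : admissible g ->
  {ae @muI R, forall x : T1, 1 / 2 <= 1 + g.1 x /\ `|g.2 x| <= 1}.
Proof.
move=> [gW g1]; have [_ g2 _ _] := (W10IP _ oo1).1 gW.
have := W10I_ae_le oo1 gW.
have n1 : nrm muI 1%E g.2 <= 1.
  apply: le_trans (nrm1_le_oo g2) _.
  exact: (ae_le_Lfun_oo ler01 (Lfun_measurable g2) g1).2.
move=> h; apply: (ae_mp2 _ h g1) => x hx g1x; split=> //.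
have := le_trans hx n1; have := ler_norm (- g.1 x); rewrite normrN.
set a := `|_|; lra.
Qed.

Lemma admissible_segment g g' (t : R) : 0 <= t <= 1 -> admissible g ->
  admissible g' -> admissible (g + t *: (g' - g)).
Proof.
move=> /andP[t0 t1] [gW g1] [g'W g'1]; split.
  by rewrite addrC; apply: W10I_lin => //; exact: W10I_sub.
apply: (ae_mp2 _ g1 g'1) => x h1 h2.
rewrite -[(g + _).2 x]/(g.2 x + t * (g'.2 x - g.2 x)).
have -> : g.2 x + t * (g'.2 x - g.2 x) = (1 - t) * g.2 x + t * g'.2 x by ring.
rewrite (le_trans (ler_normD _ _)) // !normrM (ger0_norm t0).
rewrite ger0_norm ?subr_ge0 //.
have := ler_wpM2l t0 h2; have t1' : 0 <= 1 - t by rewrite subr_ge0.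
by have := ler_wpM2l t1' h1; set a := _ * `|_|; set b := _ * `|_|; lra.
Qed.

Lemma DAmx_eq0 g h x : h.1 x.1 = 0 -> h.2 x.1 = 0 -> DAmx g h x = 0.
Proof.
by move=> h1 h2; rewrite DAmxE; apply: mx22P;
  rewrite !mxE /= ?h1 ?h2 ?(mulr0, mul0r, oppr0, subrr).
Qed.

(** Once all terms of the sum in [A_bound] are known to be nonnegative, each is at most [CA];
    homogeneity of [DAmx] in [h] removes the normalization of the direction. *)
Lemma A_boundP (CA : R) : A_bound CA -> [/\ 0 <= CA,
  forall g, admissible g -> {ae @muO R, forall x : T2, opnorm (Amx g x) <= CA} &
  forall g h, admissible g -> W10I +oo%E h ->
    {ae @muO R, forall x : T2, opnorm (DAmx g h x) <= CA * nrm muI +oo%E h.2}].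
Proof.
move=> CAb; have [h0 [h0W h01]] := @exists_unit_W10I R.
have b g : admissible g -> (mxLinf (Amx g) <= CA%:E)%E /\
    forall h, W10I +oo%E h -> semi1 +oo%E h = 1%E -> (mxLinf (DAmx g h) <= CA%:E)%E.
  move=> /CAb; set S1 := ereal_sup _; set S2 := ereal_sup _.
  have s1 h : W10I +oo%E h -> semi1 +oo%E h = 1%E -> (mxLinf (DAmx g h) <= S1)%E.
    by move=> hW h1; apply: ereal_sup_ubound; exists h.
  have S10 : (0 <= S1)%E by apply: le_trans (s1 h0 h0W h01); exact: mxLinf_ge0.
  have S20 : (0 <= S2)%E.
    apply: le_trans (mxLinf_ge0 (D2Amx g h0 h0)) _.
    by apply: ereal_sup_ubound; exists (h0, h0).
  move=> le; split.
    by apply: le_trans le; rewrite -addeA leeDl // adde_ge0.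
  move=> h hW h1; apply: le_trans le; apply: le_trans (s1 h hW h1) _.
  by rewrite addeAC leeDr // adde_ge0 // mxLinf_ge0.
have a0 : admissible (0 : sob1 R).
  split; first by have := W10I_sub oo1 h0W h0W; rewrite subrr.
  by apply: nearW => x; rewrite normr0.
have CA0 : 0 <= CA.
  by rewrite -lee_fin; apply: le_trans (b 0 a0).1; exact: mxLinf_ge0.
split=> // [g /b[h _]|g h ga hW]; first exact: mxLinf_le_ae.
have [_ h2 _ _] := (W10IP _ oo1).1 hW.
(* A direction of seminorm 0 cannot be normalized, but it vanishes almost everywhere together with
   its derivative, and so does [DAmx g h]. *)
have [m0|m0] := eqVneq (nrm muI +oo%E h.2) 0.
  have := ae_muO_fst (W10I_oo_ae hW); apply: ae_mp => x; rewrite m0 mulr0.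
  by rewrite !normr_le0 => -[/eqP h1x /eqP h2x];
    rewrite DAmx_eq0 // (le_trans (opnorm_le_sum _)) // /mxsum !mxE normr0 !addr0.
set m := nrm _ _ _ in m0 *.
have m_gt0 : 0 < m by rewrite lt_neqAle eq_sym m0 nrm_ge0.
have hW' : W10I +oo%E (m^-1 *: h).
  rewrite -[_ *: _]addr0; apply: W10I_lin => //.
  by have := W10I_sub oo1 hW hW; rewrite subrr.
have h1' : semi1 +oo%E (m^-1 *: h) = 1%E.
  have L := LfunZ m^-1 oo1 h2.
  by rewrite semi1E (nrmE L) nrmZ // ger0_norm ?invr_ge0 ?nrm_ge0 // mulVf.
have := mxLinf_le_ae ((b g ga).2 _ hW' h1'); apply: ae_mp => x.
rewrite DAmxZ opnormZ ger0_norm ?invr_ge0 ?nrm_ge0 //.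
by rewrite ler_pdivrMl // mulrC.
Qed.

Lemma Amx_remainder g h : admissible g -> admissible (g + h) -> W10I +oo%E h ->
  {ae @muO R, forall x : T2, opnorm (Amx (g + h) x - Amx g x - DAmx g h x)
    <= 26 * nrm muI +oo%E h.2 ^+ 2}.
Proof.
move=> ga gha hW.
have h1 := ae_muO_fst (admissible_half_le ga).
have h2 := ae_muO_fst (admissible_half_le gha).
have h3 := ae_muO_fst (W10I_oo_ae hW).
have h4 := ae_muO_snd (@ae_muI_dom1 R).
have h12 := ae_mp2 (fun x a b => conj a b) h1 h2.
have h34 := ae_mp2 (fun x a b => conj a b) h3 h4.
apply: (ae_mp2 _ h12 h34) => x [[a1 b1] [a2 _]] [[c1 d1] e1].
exact: remainder_le.
Qed.

(* The segment is cut into N pieces; the first-order bound on each piece and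
   the second-order remainder give the Lipschitz constant CA + O(1/N). *)
Lemma Amx_lipschitz (CA : R) g g' : A_bound CA -> admissible g -> admissible g' ->
  {ae @muO R, forall x : T2,
    opnorm (Amx g' x - Amx g x) <= CA * nrm muI +oo%E (g'.2 - g.2)}.
Proof.
move=> /A_boundP[CA0 _ DAb] ga g'a.
have hW : W10I +oo%E (g' - g) by apply: W10I_sub => //; [case: g'a|case: ga].
set h := g' - g in hW; pose m := nrm muI +oo%E h.2.
have [_ h2 _ _] := (W10IP _ oo1).1 hW.
pose gN (N k : nat) : sob1 R := g + (k%:R / N.+1%:R) *: h.
have gNa N k : (k <= N.+1)%N -> admissible (gN N k).
  move=> kN; apply: admissible_segment => //.
  by rewrite divr_ge0 //= ler_pdivrMr ?ltr0n // mul1r ler_nat.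
have zW : W10I +oo%E (0 : sob1 R) by have := W10I_sub oo1 hW hW; rewrite subrr.
have hNW N : W10I +oo%E (N.+1%:R^-1 *: h).
  by rewrite -[_ *: _]addr0; exact: W10I_lin.
have nN N : nrm muI +oo%E (N.+1%:R^-1 *: h).2 = m / N.+1%:R.
  by rewrite [LHS](nrmZ _ oo1 h2) ger0_norm ?invr_ge0 // mulrC.
have gNS N k : gN N k.+1 = gN N k + N.+1%:R^-1 *: h.
  by rewrite /gN -addrA -scalerDl -natr1 mulrDl mul1r.
(* The null sets depend on [N] and [k]. Their countable union is formed before a point is fixed, so
   that [N] may tend to infinity at that point. *)
have step (i : nat * nat) : {ae @muO R, forall x : T2, (i.2 < i.1.+1)%N ->
    opnorm (Amx (gN i.1 i.2.+1) x - Amx (gN i.1 i.2) x)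
      <= CA * (m / i.1.+1%:R) + 26 * (m / i.1.+1%:R) ^+ 2}.
  case: i => N k /=; case: (ltnP k N.+1) => kN; last by apply: nearW.
  have ak := gNa N k (ltnW kN); have ak1 := gNa N k.+1 kN; rewrite gNS in ak1 *.
  have h1 := DAb _ _ ak (hNW N); have h3 := Amx_remainder ak ak1 (hNW N).
  apply: (ae_mp2 _ h1 h3) => x hx1 hx2 _; rewrite -nN.
  rewrite -(subrK (DAmx (gN N k) (N.+1%:R^-1 *: h) x) (_ - Amx (gN N k) x)).
  by rewrite addrC (le_trans (opnormD _ _)) // lerD.
have stepN N : {ae @muO R, forall x : T2, forall k, (k < N.+1)%N ->
    opnorm (Amx (gN N k.+1) x - Amx (gN N k) x)
      <= CA * (m / N.+1%:R) + 26 * (m / N.+1%:R) ^+ 2}.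
  exact: (ae_foralln (fun k => step (N, k))).
have stepNN := ae_foralln stepN.
apply: (ae_mp _ stepNN) => x hx.
have all_N N : opnorm (Amx g' x - Amx g x) <= CA * m + 26 * m ^+ 2 / N.+1%:R.
  have sum_k k : (k <= N.+1)%N -> opnorm (Amx (gN N k) x - Amx g x)
      <= k%:R * (CA * (m / N.+1%:R) + 26 * (m / N.+1%:R) ^+ 2).
    elim: k => [_|k IH kN].
      rewrite /gN !mul0r scale0r addr0 subrr (le_trans (opnorm_le_sum _)) //.
      by rewrite /mxsum !mxE normr0 !addr0.
    have -> : Amx (gN N k.+1) x - Amx g x =
        (Amx (gN N k.+1) x - Amx (gN N k) x) + (Amx (gN N k) x - Amx g x).
      by rewrite addrA subrK.
    have e (c : R) : k.+1%:R * c = c + k%:R * c by rewrite -natr1 mulrDl mul1r addrC.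
    rewrite e; apply: le_trans (opnormD _ _) _; apply: lerD; first exact: hx.
    exact: IH (ltnW kN).
  have := sum_k N.+1 (leqnn _).
  have -> : gN N N.+1 = g'.
    by rewrite /gN divff ?pnatr_eq0 // scale1r addrC subrK.
  move=> le; apply: le_trans le _; rewrite le_eqVlt; apply/orP; left; apply/eqP.
  have N0 : N.+1%:R != 0 :> R by rewrite pnatr_eq0.
  by move: (N.+1%:R : R) N0 => n n0; field.
apply/ler_addgt0Pl => e e0.
have [N] := ltr_add_invr (divr_gt0 e0 (ltr_pwDr (ltr01) (mulr_ge0 (ler0n R 26) (sqr_ge0 m)))).
rewrite add0r => Ne; apply: le_trans (all_N N) _; rewrite addrC lerD2r.
have K0 : 0 < 26 * m ^+ 2 + 1.
  by rewrite ltr_pwDr // mulr_ge0 // sqr_ge0.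
apply: (@le_trans _ _ ((26 * m ^+ 2 + 1) / N.+1%:R)).
  by rewrite ler_wpM2r ?invr_ge0 // lerDl.
by rewrite mulrC -ler_pdivlMr // ltW.
Qed.

End coefficient_bounds.

(** * Continuity and linearity of the bilinear forms and of the load *)

Section forms_bounds.
Context {R : realType}.
Local Notation T1 := (measurableTypeR R).
Local Notation T2 := (measurableTypeR R * measurableTypeR R)%type.
Implicit Types (g h s : sob1 R) (y z : sob2 R) (M : T2 -> 'M[R]_2) (p q : R).

Definition mx_measurable M := forall i j, measurable_fun [set: T2] (fun x => M x i j).

Lemma mx_measurableB M N : mx_measurable M -> mx_measurable N ->
  mx_measurable (fun x => M x - N x).
Proof.
move=> mM mN i j; under eq_fun do rewrite !mxE.
by apply: measurable_funB; [exact: mM|exact: mN].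
Qed.

Definition mx_bounded M (m : R) :=
  mx_measurable M /\ {ae @muO R, forall x : T2, opnorm (M x) <= m}.

Definition conjugate p q := [/\ 1 < p, 1 < q & p^-1 + q^-1 = 1].

Lemma BO_bound p q y z M (m : R) : conjugate p q -> mx_bounded M m ->
  vLfun muO p%:E y.2 -> vLfun muO q%:E z.2 ->
  muO.-integrable setT (EFin \o (fun x : T2 => dot (M x *m y.2 x) (z.2 x))) /\
  `|BO y z M| <= m * vnrm muO p%:E y.2 * vnrm muO q%:E z.2.
Proof.
move=> [p1 q1 pq] [mM bM] yL zL.
have p0 : 0 < p by exact: lt_trans p1. have q0 : 0 < q by exact: lt_trans q1.
have pe : (1 <= p%:E)%E by rewrite lee_fin ltW.
have qe : (1 <= q%:E)%E by rewrite lee_fin ltW.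
have [ie le] := hoelder_nrm p0 q0 pq (vLfun_enorm pe yL) (vLfun_enorm qe zL).
have mdot : measurable_fun [set: T2] (fun x => dot (M x *m y.2 x) (z.2 x)).
  apply: measurable_dot => [i|]; last exact: vLfun_measurable zL.
  under eq_fun do rewrite mulmx2E.
  by apply: measurable_funD; apply: measurable_funM;
    [exact: mM|exact: vLfun_measurable yL _|exact: mM|exact: vLfun_measurable yL _].
have [|ii bi] := @ae_dominated _ _ _ muO _ (fun x => m * (enorm (y.2 x) * enorm (z.2 x)))
    mdot (integrable_mulr m ie).
  apply: (ae_mp _ bM) => x hM; rewrite (le_trans (dot_mulmx_le _ _ _)) // -mulrA.
  by rewrite ler_wpM2r // mulr_ge0 ?enorm_ge0.
split=> //; apply: (le_trans bi).
(* [opnorm] is nonnegative, so a negative [m] would make the almost everywhere bound fail on the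
   whole square, which has measure 1. *)
have m0 : 0 <= m.
  have [N [mN N0 NM]] := bM; rewrite leNgt; apply/negP => mneg.
  have : [set: T2] = N.
    apply/seteqP; split=> x // _; apply: (NM x) => /= hM.
    by have := opnorm_ge0 (M x); rewrite leNgt (le_lt_trans hM mneg).
  by move=> NT; have := muO_setT (R := R); rewrite NT N0 => /eqP; rewrite eq_sym onee_eq0.
rewrite (Rintegral_mulr m ie) -mulrA ler_wpM2l //; apply: le_trans le.
rewrite le_eqVlt; apply/orP; left; apply/eqP; apply: eq_Rintegral => x _.
by rewrite /= ger0_norm // mulr_ge0 ?enorm_ge0.
Qed.

Lemma BO_linl p q (a : R) y1 y2 z M (m : R) : conjugate p q -> mx_bounded M m ->
  vLfun muO p%:E y1.2 -> vLfun muO p%:E y2.2 -> vLfun muO q%:E z.2 ->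
  BO (a *: y1 + y2) z M = a * BO y1 z M + BO y2 z M.
Proof.
move=> pq bM y1L y2L zL.
have [i1 _] := BO_bound pq bM y1L zL; have [i2 _] := BO_bound pq bM y2L zL.
rewrite /BO -(Rintegral_mulr a i1) -RintegralD //; last exact: integrable_mulr.
apply: eq_Rintegral => x _.
by rewrite -[(a *: y1 + y2).2 x]/(a *: y1.2 x + y2.2 x) mulmxDr -scalemxAr dotDl dotZl.
Qed.

Lemma BO_addr p q y z1 z2 M (m : R) : conjugate p q -> mx_bounded M m ->
  vLfun muO p%:E y.2 -> vLfun muO q%:E z1.2 -> vLfun muO q%:E z2.2 ->
  BO y (z1 + z2) M = BO y z1 M + BO y z2 M.
Proof.
move=> pq bM yL z1L z2L.
have [i1 _] := BO_bound pq bM yL z1L; have [i2 _] := BO_bound pq bM yL z2L.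
rewrite /BO -RintegralD //; apply: eq_Rintegral => x _.
by rewrite -[(z1 + z2).2 x]/(z1.2 x + z2.2 x) dotDr.
Qed.

Lemma BO_linM p q (a : R) y z M M1 M2 (m1 m2 : R) : conjugate p q ->
  mx_bounded M1 m1 -> mx_bounded M2 m2 ->
  vLfun muO p%:E y.2 -> vLfun muO q%:E z.2 ->
  (forall x, M x = a *: M1 x + M2 x) ->
  BO y z M = a * BO y z M1 + BO y z M2.
Proof.
move=> pq b1 b2 yL zL e.
have [i1 _] := BO_bound pq b1 yL zL; have [i2 _] := BO_bound pq b2 yL zL.
rewrite /BO -(Rintegral_mulr a i1) -RintegralD //; last exact: integrable_mulr.
apply: eq_Rintegral => x _.
by rewrite e mulmxDl -scalemxAl dotDl dotZl.
Qed.

Lemma BG_bound (kappa : R) g s : 0 <= kappa -> g.2 \in Lfun muI +oo%E ->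
  s.2 \in Lfun muI 1%E ->
  muI.-integrable setT (EFin \o (fun x : T1 => g.2 x * s.2 x)) /\
  `|BG kappa g s| <= kappa * (nrm muI +oo%E g.2 * nrm muI 1%E s.2).
Proof.
move=> k0 gL sL.
have [] := bounded_mul_le sL (Lfun_measurable gL) (Lfun_oo_ae muI_setT gL).
rewrite /BG; under [X in (_ -> `|X| <= _ -> _)]eq_Rintegral do rewrite mulrC.
move=> i1 b1; split.
  by apply: eq_integrable i1 => // x _; rewrite /= mulrC.
by rewrite normrM ger0_norm // ler_wpM2l.
Qed.

Lemma BG_linl (kappa a : R) g1 g2 s : 0 <= kappa -> g1.2 \in Lfun muI +oo%E ->
  g2.2 \in Lfun muI +oo%E -> s.2 \in Lfun muI 1%E ->
  BG kappa (a *: g1 + g2) s = a * BG kappa g1 s + BG kappa g2 s.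
Proof.
move=> k0 g1L g2L sL.
have [i1 _] := BG_bound k0 g1L sL; have [i2 _] := BG_bound k0 g2L sL.
rewrite /BG mulrCA -mulrDr -(Rintegral_mulr a i1) -RintegralD //; last exact: integrable_mulr.
congr (_ * _); apply: eq_Rintegral => x _.
by rewrite -[(a *: g1 + g2).2 x]/(a * g1.2 x + g2.2 x) mulrDl mulrA.
Qed.

(** Both embeddings have constant at most 1: Poincare's inequality bounds [s.1] uniformly, and the
    L^1 norm is at most the L^2 norm on a space of unit mass. Hence no further constant appears in
    front of the control norm in the final estimate. *)
Lemma load_bound (u : R -> R) s : u \in Lfun muI 2%:E -> W10I 1%E s ->
  muI.-integrable setT (EFin \o (fun x : T1 => u x * s.1 x)) /\
  `|\int[muI]_x (u x * s.1 x)| <= nrm muI 2%:E u * nrm muI 1%E s.2.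
Proof.
move=> uL sW; have [s1 s2 _ _] := (W10IP _ (lexx 1%E)).1 sW.
have e2 : (1 <= 2%:E :> \bar R)%E by rewrite lee_fin ler1n.
have b : {ae @muI R, forall x : T1, `|s.1 x| <= nrm muI 1%E s.2}.
  apply: (ae_mp _ (W10I_ae_le (lexx 1%E) sW)) => x hx.
  have le2 (a c : R) : 0 <= a -> 2 * a <= c -> a <= c by lra.
  exact: le2 hx.
have [i1 b1] := bounded_mul_le (Lfun1_I e2 uL) (Lfun_measurable s1) b.
split=> //; apply: (le_trans b1); rewrite mulrC ler_wpM2r ?nrm_ge0 //.
by apply: nrm1_le => //; [exact: muI_setT|rewrite ltr1n].
Qed.

Lemma load_lin (a : R) (u1 u2 : R -> R) s : u1 \in Lfun muI 2%:E ->
  u2 \in Lfun muI 2%:E -> W10I 1%E s ->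
  \int[muI]_x ((a *: u1 + u2) x * s.1 x) =
  a * \int[muI]_x (u1 x * s.1 x) + \int[muI]_x (u2 x * s.1 x).
Proof.
move=> u1L u2L sW.
have [i1 _] := load_bound u1L sW; have [i2 _] := load_bound u2L sW.
rewrite -(Rintegral_mulr a i1) -RintegralD //; last exact: integrable_mulr.
by apply: eq_Rintegral => x _; rewrite /= mulrDl mulrA.
Qed.

End forms_bounds.

(** * Stability of the coupled system *)

Section stability.
Context {R : realType}.
Local Notation T1 := (measurableTypeR R).
Local Notation T2 := (measurableTypeR R * measurableTypeR R)%type.
Context (kappa CA alpha beta Q P p q CE theta2 : R) (E : sob1 R -> sob2 R) (v : sob2 R).
Context (kappa_gt0 : 0 < kappa) (CA_bound : A_bound CA)
  (alpha_gt0 : 0 < alpha) (alpha_infsup : infsupI kappa alpha)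
  (QP : Q < 2 < P) (beta_gt0 : 0 < beta) (beta_infsup : infsupO Q P beta)
  (p_range : 2 < p < P) (q_def : q = p / (p - 1))
  (CE_ge1 : 1 <= CE) (E_ext : bounded_extension q CE E)
  (theta2_range : 0 < theta2 < 1) (v_W1p : W1O p%:E v)
  (v_small2 : (semi2 p%:E v <=
     ((1 - theta2) * (alpha * CE * CA * (1 + beta * CA) ^+ 2)^-1)%:E)%E).
Implicit Types (g h s : sob1 R) (y z : sob2 R) (w : sob1 R * sob2 R).

Lemma conj_pq : conjugate p q.
Proof.
case/andP: p_range => p2 _; have p1 : 1 < p by lra.
have p10 : 0 < p - 1 by rewrite subr_gt0.
split=> //; first by rewrite q_def ltr_pdivlMr // mul1r gtrBl.
by rewrite q_def invf_div -[X in X + _]div1r -mulrDl subrKC divff // gt_eqF //; lra.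
Qed.

Let p1 : 1 < p. Proof. by case: conj_pq. Qed.
Let pe : (1 <= p%:E)%E. Proof. by rewrite lee_fin ltW. Qed.
Let qe : (1 <= q%:E)%E. Proof. by rewrite lee_fin ltW //; case: conj_pq. Qed.
Let oo1 : (1 <= +oo :> \bar R)%E. Proof. exact: leey. Qed.
Let CA0 : 0 <= CA. Proof. by case: (A_boundP CA_bound). Qed.

Definition N_oo g : R := nrm muI +oo%E g.2.
Definition N_1 g : R := nrm muI 1%E g.2.
Definition N_p y : R := vnrm muO p%:E y.2.
Definition N_q y : R := vnrm muO q%:E y.2.
Let V := N_p v.
Let B := 1 + beta * CA.

Lemma v_grad : vLfun muO p%:E v.2.
Proof. by case: v_W1p. Qed.

Lemma semi2E (r : R) y : (1 <= r%:E)%E -> vLfun muO r%:E y.2 ->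
  semi2 r%:E y = (vnrm muO r%:E y.2)%:E.
Proof. by move=> r1 yL; rewrite /semi2 nrmE // vLfun_enorm. Qed.

Let B1 : 1 <= B. Proof. by rewrite lerDl mulr_ge0 // ltW. Qed.
Let B0 : 0 <= B. Proof. exact: le_trans ler01 B1. Qed.
Let beta0 : 0 <= beta. Proof. exact: ltW. Qed.
Let alpha0 : 0 <= alpha. Proof. exact: ltW. Qed.
Let V0 : 0 <= V. Proof. exact: nrm_ge0. Qed.
Let CE0 : 0 <= CE. Proof. exact: le_trans CE_ge1. Qed.

Lemma smallness : alpha * CE * CA * B ^+ 2 * V <= 1 - theta2.
Proof.
have := v_small2; rewrite (semi2E pe v_grad) lee_fin -/(N_p v) -/V -/B.
set K := alpha * CE * CA * B ^+ 2 => le.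
have K0 : 0 <= K by rewrite !mulr_ge0 ?exprn_ge0 ?(ltW alpha_gt0) // (le_trans _ B1).
(* [K] vanishes when [CA] does, and then it cannot be moved across the inequality; the claim reduces
   to [theta2 <= 1]. *)
have [K00|K00] := eqVneq K 0.
  by rewrite K00 mul0r subr_ge0; case/andP: theta2_range => _ /ltW.
by rewrite mulrC -ler_pdivlMr // lt_neqAle eq_sym K00.
Qed.

(** The inf-sup condition read as an a priori estimate, with [F] a bound for the dual norm of the
    functional generated by [g]. *)
Lemma infsupI_le g (F : R) : 0 <= F -> W10I +oo%E g ->
  (forall s, W10I 1%E s -> `|BG kappa g s| <= F * N_1 s) -> N_oo g <= alpha * F.
Proof.
move=> F0 gW gF; have [g1 g2 _ _] := (W10IP _ oo1).1 gW.
have := alpha_infsup.1 g gW; rewrite semi1E (nrmE g2) => le.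
rewrite -lee_fin; apply: (le_trans le); rewrite EFinM lee_pmul2l // ?lte_fin //.
apply: ge_ereal_sup => _ [s [sW _] <-]; rewrite lee_fin.
have [s1 s2 _ _] := (W10IP _ (lexx 1%E)).1 sW.
rewrite semi1E (nrmE s2) /= -/(N_1 s).
(* A test function of zero seminorm contributes the quotient 0, by the convention for division by
   0. *)
have [s0|s0] := eqVneq (N_1 s) 0; first by rewrite s0 invr0 mulr0.
rewrite ler_pdivrMr; last by rewrite lt_neqAle eq_sym s0 nrm_ge0.
by apply: le_trans (gF s sW); exact: ler_norm.
Qed.

Lemma infsupO_le g y (F : R) : 0 <= F -> admissible g -> W10O p%:E y ->
  (forall z, W10O q%:E z -> `|BO y z (Amx g)| <= F * N_q z) -> N_p y <= beta * F.
Proof.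
move=> F0 ga yW yF; have [y1 y2 _ _] := (W10OP _ pe).1 yW.
have [_ _ pq] := conj_pq.
have pr : Q < p < P by case/andP: p_range => p2 ->; case/andP: QP => Q2 _; lra.
have := beta_infsup pr pq ga yW; rewrite (semi2E pe y2) => le.
rewrite -lee_fin; apply: (le_trans le); rewrite EFinM lee_pmul2l // ?lte_fin //.
apply: ge_ereal_sup => _ [z [zW _] <-]; rewrite lee_fin.
have [z1 z2 _ _] := (W10OP _ qe).1 zW.
rewrite (semi2E qe z2) /= -/(N_q z).
have [s0|s0] := eqVneq (N_q z) 0; first by rewrite s0 invr0 mulr0.
rewrite ler_pdivrMr; last by rewrite lt_neqAle eq_sym s0 nrm_ge0.
by apply: le_trans (yF z zW); exact: ler_norm.
Qed.

Lemma Amx_bounded g : admissible g -> mx_bounded (Amx g) CA.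
Proof.
move=> ga; have [_ Ab _] := A_boundP CA_bound; split; last exact: Ab.
have [g1 g2 _ _] := (W10IP _ oo1).1 ga.1.
by move=> i j; apply: measurable_Amx; [exact: Lfun_measurable g1|exact: Lfun_measurable g2].
Qed.

Lemma DAmx_bounded g h : admissible g -> W10I +oo%E h ->
  mx_bounded (DAmx g h) (CA * N_oo h).
Proof.
move=> ga hW; have [_ _ DAb] := A_boundP CA_bound; split; last exact: DAb.
have [g1 g2 _ _] := (W10IP _ oo1).1 ga.1; have [h1 h2 _ _] := (W10IP _ oo1).1 hW.
by move=> i j; apply: measurable_DAmx; [exact: Lfun_measurable g1|
  exact: Lfun_measurable g2|exact: Lfun_measurable h1|exact: Lfun_measurable h2].
Qed.

Lemma E_grad s : W10I 1%E s -> vLfun muO q%:E (E s).2 /\ N_q (E s) <= CE * N_1 s.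
Proof.
move=> sW; have [E1 _ E3] := E_ext; have [[_ EL _] _] := E1 s sW.
have [_ s2 _ _] := (W10IP _ (lexx 1%E)).1 sW.
split=> //; have := E3 s sW.
by rewrite (semi2E qe EL) semi1E (nrmE s2) -EFinM lee_fin.
Qed.

Lemma W10O_grad z (r : R) : (1 <= r%:E)%E -> W10O r%:E z -> vLfun muO r%:E z.2.
Proof. by move=> r1 /(W10OP _ r1)[]. Qed.

(** [gm] and [y] are the interface and bulk increments, [Y] is a full state, [M] is the coefficient
    increment caused by [gm], and [F1], [F2] bound the residuals in dual norms. The bulk inf-sup
    condition bounds [y] by [gm]; inserted into the interface estimate, this leaves [gm] on the
    right with a factor at most [1 - theta2], which is absorbed. *)
Lemma stability g (gm : sob1 R) y (Y : sob2 R) M (F1 F2 : R) :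
  admissible g -> W10I +oo%E gm -> W10O p%:E y ->
  vLfun muO p%:E Y.2 -> N_p Y <= B * V ->
  mx_bounded M (CA * N_oo gm) -> 0 <= F1 -> 0 <= F2 ->
  (forall z, W10O q%:E z -> `|BO y z (Amx g) + BO Y z M| <= F1 * N_q z) ->
  (forall s, W10I 1%E s -> `|BG kappa gm s + (BO y (E s) (Amx g) + BO Y (E s) M)|
     <= F2 * N_1 s) ->
  N_oo gm <= alpha / theta2 * (F2 + CE * CA * beta * F1) /\
  N_p y <= beta * (CA * N_oo gm * (B * V) + F1).
Proof.
move=> ga gmW yW YL YV bM F10 F20 H1 H2.
have yL := W10O_grad pe yW.
have n0 : 0 <= N_oo gm by exact: nrm_ge0.
have BV0 : 0 <= B * V by rewrite mulr_ge0 // (le_trans _ B1).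
have Ny : N_p y <= beta * (CA * N_oo gm * (B * V) + F1).
  apply: (infsupO_le _ ga yW); first by rewrite addr_ge0 // !mulr_ge0.
  move=> z zW; have zL := W10O_grad qe zW.
  have [_ b2] := BO_bound conj_pq bM YL zL.
  have z0 : 0 <= N_q z by exact: nrm_ge0.
  have -> : BO y z (Amx g) = (BO y z (Amx g) + BO Y z M) - BO Y z M by rewrite addrK.
  rewrite (le_trans (ler_normB _ _)) // mulrDl addrC lerD ?H1 //.
  apply: (le_trans b2); rewrite ler_wpM2r //.
  by rewrite ler_wpM2l // mulr_ge0.
split=> //.
have Ng : N_oo gm <= alpha * (F2 + CE * CA * (N_p y + N_oo gm * (B * V))).
  have y0 : 0 <= N_p y by exact: nrm_ge0.
  apply: (infsupI_le _ gmW).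
    by rewrite addr_ge0 // !mulr_ge0 // addr_ge0 // mulr_ge0.
  move=> s sW; have [EL EN] := E_grad sW.
  have s0 : 0 <= N_1 s by exact: nrm_ge0.
  have [_ b1] := BO_bound conj_pq (Amx_bounded ga) yL EL.
  have [_ b2] := BO_bound conj_pq bM YL EL.
  have -> : BG kappa gm s = (BG kappa gm s + (BO y (E s) (Amx g) + BO Y (E s) M))
    - (BO y (E s) (Amx g) + BO Y (E s) M) by rewrite addrK.
  rewrite (le_trans (ler_normB _ _)) // mulrDl lerD ?H2 //.
  apply: (le_trans (ler_normD _ _)).
  have -> : CE * CA * (N_p y + N_oo gm * (B * V)) * N_1 s =
    CA * N_p y * (CE * N_1 s) + CA * N_oo gm * (B * V) * (CE * N_1 s) by ring.
  apply: lerD.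
    by apply: (le_trans b1); rewrite ler_wpM2l // mulr_ge0.
  apply: (le_trans b2); apply: ler_pM => //; first by rewrite !mulr_ge0 // nrm_ge0.
    exact: nrm_ge0.
  by rewrite ler_wpM2l // mulr_ge0.
case/andP: theta2_range => t20 t21.
rewrite mulrAC ler_pdivlMr // mulrC.
have aC0 : 0 <= alpha * CE * CA by rewrite !mulr_ge0 // ltW.
have h1 := ler_wpM2l aC0 Ny.
have h2 := ler_wpM2r n0 smallness.
have e1 : alpha * (F2 + CE * CA * (N_p y + N_oo gm * (B * V))) =
  alpha * F2 + alpha * CE * CA * N_p y + alpha * CE * CA * (N_oo gm * (B * V)) by ring.
(* The indirect feedback through [y] and the direct one through [M] carry [beta * CA] and 1, which
   add up to [B]; the other factor [B] comes from the bound on [Y]. *)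
have e2 : alpha * CE * CA * (beta * (CA * N_oo gm * (B * V) + F1)) +
  alpha * CE * CA * (N_oo gm * (B * V)) =
  alpha * CE * CA * B ^+ 2 * V * N_oo gm + alpha * CE * CA * beta * F1.
  by rewrite /B; ring.
have e3 : alpha * (F2 + CE * CA * beta * F1) = alpha * F2 + alpha * CE * CA * beta * F1.
  by ring.
rewrite e3; move: Ng; rewrite e1 => Ng.
by move: Ng h1 h2 e2; move: (N_oo gm) (N_p y) => n m;
  set a := alpha * CE * CA * m; set b := alpha * CE * CA * (beta * _);
  set c := alpha * CE * CA * (n * _); set d := alpha * F2;
  set e := alpha * CE * CA * beta * F1; set f := _ * n; lra.
Qed.

(** * A priori and Lipschitz estimates for states *)

Lemma state_admissible u w : is_state kappa p q E v u w -> admissible w.1.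
Proof. by case=> [[w1 _] w2 _ _]; split. Qed.

(** The bulk equation says that [w.2] generates the negative of the functional of [v], so its
    seminorm is at most [beta * CA * V]; adding [v] itself gives [B]. *)
Lemma state_grad u w : is_state kappa p q E v u w ->
  vLfun muO p%:E (w.2 + v).2 /\ N_p (w.2 + v) <= B * V.
Proof.
move=> sw; have wa := state_admissible sw; case: sw => [[w1 w2] _ H _].
have wL := W10O_grad pe w2; have vL := v_grad.
split; first exact: vLfunD.
have Nw : N_p w.2 <= beta * (CA * V).
  apply: (infsupO_le _ wa w2); first by rewrite mulr_ge0.
  move=> z zW; have zL := W10O_grad qe zW.
  have [_ bv] := BO_bound conj_pq (Amx_bounded wa) vL zL.
  have := H z zW.
  have -> : w.2 + v = 1 *: w.2 + v by rewrite scale1r.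
  rewrite (BO_linl 1 conj_pq (Amx_bounded wa) wL vL zL) mul1r.
  by move/eqP; rewrite addr_eq0 => /eqP ->; rewrite normrN.
rewrite (le_trans (vnrmD pe wL vL)) // -/(N_p w.2) -/(N_p v) -/V /B mulrDl mul1r addrC.
by rewrite lerD2l -mulrA.
Qed.

(** [L1] and [L2] are the Lipschitz constants of the interface and the bulk component of a state
    with respect to the control, as [stability] delivers them when the bulk residual is zero. *)
Definition L1 : R := alpha / theta2.
Definition L2 : R := beta * (CA * (B * V)) * L1.

Lemma L1_ge0 : 0 <= L1.
Proof. by case/andP: theta2_range => t0 _; rewrite divr_ge0 // ltW. Qed.

Let BV0 : 0 <= B * V.
Proof. by rewrite mulr_ge0 // (le_trans _ B1). Qed.

(** Writing [w'.2 + v] as the increment plus [w.2 + v] puts the coefficients of [w'] on the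
    increment and their difference on the old state. This system is exact, so [stability] applies
    with [F1 = 0]. *)
Lemma state_diff u u' w w' : u \in Lfun muI 2%:E -> u' \in Lfun muI 2%:E ->
  is_state kappa p q E v u w -> is_state kappa p q E v u' w' ->
  [/\ Wspace p (w' - w),
    N_oo (w' - w).1 <= L1 * nrm muI 2%:E (u' - u) &
    N_p (w' - w).2 <= L2 * nrm muI 2%:E (u' - u)] /\
  let D := fun x => Amx w'.1 x - Amx w.1 x in
  [/\ mx_bounded D (CA * N_oo (w' - w).1),
    forall z, W10O q%:E z -> BO (w' - w).2 z (Amx w'.1) + BO (w.2 + v) z D = 0 &
    forall s, W10I 1%E s -> BG kappa (w' - w).1 s + (BO (w' - w).2 (E s) (Amx w'.1)
      + BO (w.2 + v) (E s) D) = \int[muI]_x ((u' - u) x * s.1 x)].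
Proof.
move=> uL u'L sw sw'.
have wa := state_admissible sw; have w'a := state_admissible sw'.
have [YL YN] := state_grad sw; have [Y'L _] := state_grad sw'.
case: sw => [[w1 w2] _ Hz Hs]; case: sw' => [[w'1 w'2] _ H'z H's].
have d1 : W10I +oo%E (w' - w).1 by exact: W10I_sub.
have d2 : W10O p%:E (w' - w).2 by exact: W10O_sub.
have dL := W10O_grad pe d2.
have Ab := Amx_bounded wa; have A'b := Amx_bounded w'a.
have Db : mx_bounded (fun x => Amx w'.1 x - Amx w.1 x) (CA * N_oo (w' - w).1).
  split; last exact: Amx_lipschitz.
  by apply: mx_measurableB; [case: A'b|case: Ab].
have key z : vLfun muO q%:E z.2 ->
    BO (w' - w).2 z (Amx w'.1) + BO (w.2 + v) z (fun x => Amx w'.1 x - Amx w.1 x)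
    = BO (w'.2 + v) z (Amx w'.1) - BO (w.2 + v) z (Amx w.1).
  move=> zL.
  have e : w'.2 + v = 1 *: (w' - w).2 + (w.2 + v).
    by rewrite scale1r -[(w' - w).2]/(w'.2 - w.2) addrA subrK.
  rewrite e (BO_linl 1 conj_pq A'b dL YL zL) mul1r.
  have eD x : Amx w'.1 x - Amx w.1 x = -1 *: Amx w.1 x + Amx w'.1 x.
    by rewrite scaleN1r addrC.
  rewrite (BO_linM conj_pq Ab A'b YL zL eD).
  by rewrite mulN1r addrA addrAC.
have kz z : W10O q%:E z -> BO (w' - w).2 z (Amx w'.1) +
    BO (w.2 + v) z (fun x => Amx w'.1 x - Amx w.1 x) = 0.
  by move=> zW; rewrite (key _ (W10O_grad qe zW)) Hz // H'z // subrr.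
have ks s : W10I 1%E s -> BG kappa (w' - w).1 s + (BO (w' - w).2 (E s) (Amx w'.1)
    + BO (w.2 + v) (E s) (fun x => Amx w'.1 x - Amx w.1 x))
    = \int[muI]_x ((u' - u) x * s.1 x).
  move=> sW; have [EL _] := E_grad sW; rewrite key //.
  have [_ s2 _ _] := (W10IP _ (lexx 1%E)).1 sW.
  have [_ w12 _ _] := (W10IP _ oo1).1 w1; have [_ w'12 _ _] := (W10IP _ oo1).1 w'1.
  have -> : (w' - w).1 = -1 *: w.1 + w'.1 by rewrite scaleN1r addrC.
  have -> : u' - u = -1 *: u + u' by rewrite scaleN1r addrC.
  rewrite (load_lin (-1) uL u'L sW) (BG_linl (-1) (ltW kappa_gt0) w12 w'12 s2).
  rewrite -(Hs s sW) -(H's s sW).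
  have id4 (a b c d : R) : -1 * a + b + (c - d) = -1 * (a + d) + (b + c) by ring.
  exact: id4.
split; last by [].
have duL : u' - u \in Lfun muI 2%:E by apply: LfunB => //; rewrite lee_fin ler1n.
have [] := @stability w'.1 (w' - w).1 (w' - w).2 (w.2 + v) _ 0 (nrm muI 2%:E (u' - u))
  w'a d1 d2 YL YN Db (lexx 0) (nrm_ge0 _ _ _).
- by move=> z zW; rewrite kz // normr0 mul0r.
- by move=> s sW; rewrite ks //; exact: (load_bound duL sW).2.
rewrite mulr0 addr0 addr0 => n1 n2; split=> //.
apply: (le_trans n2).
have -> : beta * (CA * N_oo (w' - w).1 * (B * V)) =
  beta * (CA * (B * V)) * N_oo (w' - w).1 by ring.
by rewrite /L2 -[leRHS]mulrA ler_wpM2l // !mulr_ge0.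
Qed.

(** Constant of the quadratic residual: the coefficient difference acting on the state increment
    gives [CA * L1 * L2], and the Taylor remainder of [A] acting on the old state gives
    [26 * L1 ^+ 2 * (B * V)]. *)
Definition K2 : R := CA * L1 * L2 + 26 * L1 ^+ 2 * (B * V).

Lemma K2_ge0 : 0 <= K2.
Proof.
have L20 : 0 <= L2 := mulr_ge0 (mulr_ge0 beta0 (mulr_ge0 CA0 BV0)) L1_ge0.
apply: addr_ge0; first exact: (mulr_ge0 (mulr_ge0 CA0 L1_ge0) L20).
by apply: mulr_ge0 => //; rewrite mulr_ge0 // exprn_ge0 // L1_ge0.
Qed.

(** The linearized form differs from the exact system of [state_diff] in two places: [Amx w.1]
    replaces [Amx w'.1] on the increment, and [DAmx] replaces the coefficient difference [D]. Both
    corrections are products of two increments or bounded by the square of one. *)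
Lemma linearization u u' w w' : u \in Lfun muI 2%:E -> u' \in Lfun muI 2%:E ->
  is_state kappa p q E v u w -> is_state kappa p q E v u' w' ->
  let d := nrm muI 2%:E (u' - u) in
  (forall z, W10O q%:E z -> `|DO v (w' - w) z w.1 w.2| <= K2 * d ^+ 2 * N_q z) /\
  (forall s, W10I 1%E s -> `|BG kappa (w' - w).1 s + DO v (w' - w) (E s) w.1 w.2
      - \int[muI]_x ((u' - u) x * s.1 x)| <= CE * (K2 * d ^+ 2) * N_1 s).
Proof.
move=> uL u'L sw sw' d.
have [[[d1 d2] n1 n2] [Db kz ks]] := state_diff uL u'L sw sw'.
have wa := state_admissible sw; have w'a := state_admissible sw'.
have [YL YN] := state_grad sw.
have dL := W10O_grad pe d2.
have Ab := Amx_bounded wa; have A'b := Amx_bounded w'a.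
have DAb := DAmx_bounded wa d1.
set D := fun x => _ in Db kz ks.
pose Rm x := D x - DAmx w.1 (w' - w).1 x.
have gE : w.1 + (w' - w).1 = w'.1 by rewrite -[(w' - w).1]/(w'.1 - w.1) addrC subrK.
have Rb : mx_bounded Rm (26 * N_oo (w' - w).1 ^+ 2).
  split; first by apply: mx_measurableB; [case: Db|case: DAb].
  have := @Amx_remainder _ w.1 (w' - w).1 wa; rewrite gE => /(_ w'a d1).
  exact: ae_mp.
have m0 : 0 <= N_oo (w' - w).1 by exact: nrm_ge0.
have d0 : 0 <= d by exact: nrm_ge0.
have key z : vLfun muO q%:E z.2 ->
    DO v (w' - w) z w.1 w.2 = (BO (w' - w).2 z (Amx w'.1) + BO (w.2 + v) z D)
      - (BO (w' - w).2 z D + BO (w.2 + v) z Rm) /\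
    `|BO (w' - w).2 z D + BO (w.2 + v) z Rm| <= K2 * d ^+ 2 * N_q z.
  move=> zL; split.
    have e1 x : D x = -1 *: Amx w.1 x + Amx w'.1 x by rewrite scaleN1r addrC.
    have e2 x : Rm x = -1 *: DAmx w.1 (w' - w).1 x + D x by rewrite scaleN1r addrC.
    rewrite (BO_linM conj_pq Ab A'b dL zL e1) (BO_linM conj_pq DAb Db YL zL e2).
    have id4 (a b c e : R) : a + b = (c + e) - ((-1 * a + c) + (-1 * b + e)) by ring.
    exact: id4.
  have [_ b1] := BO_bound conj_pq Db dL zL; have [_ b2] := BO_bound conj_pq Rb YL zL.
  have z0 : 0 <= N_q z by exact: nrm_ge0.
  have y0 : 0 <= N_p (w' - w).2 by exact: nrm_ge0.
  apply: (le_trans (ler_normD _ _)); apply: (le_trans (lerD b1 b2)).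
  rewrite -mulrDl ler_wpM2r //.
  have -> : K2 * d ^+ 2 = CA * (L1 * d) * (L2 * d) + 26 * (L1 * d) ^+ 2 * (B * V).
    by rewrite /K2; ring.
  apply: lerD; apply: ler_pM => //.
  - by rewrite mulr_ge0.
  - by rewrite ler_wpM2l.
  - by rewrite mulr_ge0 // exprn_ge0.
  - exact: nrm_ge0.
  - rewrite ler_wpM2l // !expr2; apply: ler_pM => //.
split=> [z zW|s sW].
  have [-> b] := key z (W10O_grad qe zW).
  by rewrite kz // sub0r normrN.
have [EL EN] := E_grad sW; have [-> b] := key _ EL.
rewrite addrA ks // addrAC subrr sub0r normrN; apply: (le_trans b).
have -> : CE * (K2 * d ^+ 2) * N_1 s = K2 * d ^+ 2 * (CE * N_1 s) by ring.
by rewrite ler_wpM2l // mulr_ge0 ?K2_ge0 // exprn_ge0.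
Qed.

(** * The linearized system with residuals *)

Definition linearized w (f : R -> R) dw : Prop :=
  [/\ Wspace p dw,
    forall z, W10O q%:E z -> DO v dw z w.1 w.2 = 0 &
    forall s, W10I 1%E s -> BG kappa dw.1 s + DO v dw (E s) w.1 w.2
      = \int[muI]_x (f x * s.1 x)].

Lemma DO_bound u w dw z : is_state kappa p q E v u w -> Wspace p dw ->
  vLfun muO q%:E z.2 ->
  `|DO v dw z w.1 w.2| <= (CA * N_p dw.2 + CA * (B * V) * N_oo dw.1) * N_q z.
Proof.
move=> sw [d1 d2] zL; have wa := state_admissible sw; have [YL YN] := state_grad sw.
have [_ b1] := BO_bound conj_pq (Amx_bounded wa) (W10O_grad pe d2) zL.
have [_ b2] := BO_bound conj_pq (DAmx_bounded wa d1) YL zL.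
apply: (le_trans (ler_normD _ _)); apply: (le_trans (lerD b1 b2)).
rewrite -mulrDl ler_wpM2r ?nrm_ge0 // lerD2l.
have -> : CA * (B * V) * N_oo dw.1 = CA * N_oo dw.1 * (B * V) by ring.
by rewrite ler_wpM2l // mulr_ge0 // nrm_ge0.
Qed.

Lemma DO_lin u w (a : R) dw1 dw2 z : is_state kappa p q E v u w ->
  Wspace p dw1 -> Wspace p dw2 -> vLfun muO q%:E z.2 ->
  DO v (a *: dw1 + dw2) z w.1 w.2 = a * DO v dw1 z w.1 w.2 + DO v dw2 z w.1 w.2.
Proof.
move=> sw [d1 d2] [e1 e2] zL.
have wa := state_admissible sw; have [YL YN] := state_grad sw.
have h1 := BO_linl a conj_pq (Amx_bounded wa) (W10O_grad pe d2) (W10O_grad pe e2) zL.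
have h2 := BO_linM conj_pq (DAmx_bounded wa d1) (DAmx_bounded wa e1) YL zL
  (fun x => DAmx_lin w.1 dw1.1 dw2.1 a x).
have id4 (b c e f : R) : a * b + c + (a * e + f) = a * (b + e) + (c + f) by ring.
by rewrite /DO h1 h2; exact: id4.
Qed.

Lemma Wspace_lin (a : R) dw1 dw2 : Wspace p dw1 -> Wspace p dw2 ->
  Wspace p (a *: dw1 + dw2).
Proof. by move=> [d1 d2] [e1 e2]; split; [exact: W10I_lin|exact: W10O_lin]. Qed.

Lemma linear_stability u w dw (F1 F2 : R) : is_state kappa p q E v u w ->
  Wspace p dw -> 0 <= F1 -> 0 <= F2 ->
  (forall z, W10O q%:E z -> `|DO v dw z w.1 w.2| <= F1 * N_q z) ->
  (forall s, W10I 1%E s -> `|BG kappa dw.1 s + DO v dw (E s) w.1 w.2| <= F2 * N_1 s) ->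
  N_oo dw.1 <= alpha / theta2 * (F2 + CE * CA * beta * F1) /\
  N_p dw.2 <= beta * (CA * N_oo dw.1 * (B * V) + F1).
Proof.
move=> sw [d1 d2] F10 F20 H1 H2.
have wa := state_admissible sw; have [YL YN] := state_grad sw.
exact: (stability wa d1 d2 YL YN (DAmx_bounded wa d1) F10 F20 H1 H2).
Qed.

Let e2 : (1 <= 2%:E :> \bar R)%E. Proof. by rewrite lee_fin ler1n. Qed.

Lemma Wspace_sub dw1 dw2 : Wspace p dw1 -> Wspace p dw2 -> Wspace p (dw1 - dw2).
Proof. by move=> W1 W2; rewrite addrC -scaleN1r; exact: Wspace_lin. Qed.

(** Residuals are measured in the dual norms that [stability] takes. The notion is compatible with
    linear combinations, so Cauchy estimates, uniqueness and the remainder estimate all reduce to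
    one bound for a combination; zero residuals give [linearized]. *)
Definition approx_linearized w (f : R -> R) dw (F1 F2 : R) : Prop :=
  [/\ Wspace p dw,
    forall z, W10O q%:E z -> `|DO v dw z w.1 w.2| <= F1 * N_q z &
    forall s, W10I 1%E s -> `|BG kappa dw.1 s + DO v dw (E s) w.1 w.2
      - \int[muI]_x (f x * s.1 x)| <= F2 * N_1 s].

Lemma linearizedP w f dw : linearized w f dw <-> approx_linearized w f dw 0 0.
Proof.
split=> -[dW H1 H2]; split=> //.
- by move=> z zW; rewrite H1 // normr0 mul0r.
- by move=> s sW; rewrite H2 // subrr normr0 mul0r.
- by move=> z zW; apply/eqP; rewrite -normr_le0 -[leRHS](mul0r (N_q z)); exact: H1.
- move=> s sW; apply/eqP; rewrite -subr_eq0 -normr_le0 -[leRHS](mul0r (N_1 s)).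
  exact: H2.
Qed.

Lemma approx_linearized_lin u w (a : R) f1 f2 dw1 dw2 (F1 F2 K1 M2 : R) :
  is_state kappa p q E v u w -> f1 \in Lfun muI 2%:E -> f2 \in Lfun muI 2%:E ->
  approx_linearized w f1 dw1 F1 F2 -> approx_linearized w f2 dw2 K1 M2 ->
  approx_linearized w (a *: f1 + f2) (a *: dw1 + dw2)
    (`|a| * F1 + K1) (`|a| * F2 + M2).
Proof.
move=> sw f1L f2L [W1 H1 H2] [W2 J1 J2]; split; first exact: Wspace_lin.
  move=> z zW; rewrite (DO_lin _ sw W1 W2 (W10O_grad qe zW)).
  rewrite (le_trans (ler_normD _ _)) // normrM mulrDl -mulrA lerD ?J1 //.
  by rewrite ler_wpM2l // H1.
move=> s sW; have [EL _] := E_grad sW.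
have [_ s2 _ _] := (W10IP _ (lexx 1%E)).1 sW.
have [_ g1 _ _] := (W10IP _ oo1).1 W1.1; have [_ g2 _ _] := (W10IP _ oo1).1 W2.1.
have hD := DO_lin a sw W1 W2 EL.
have hG := BG_linl a (ltW kappa_gt0) g1 g2 s2.
have hL := load_lin a f1L f2L sW.
have id6 (b c d b' c' d' : R) : a * b + b' + (a * c + c') - (a * d + d')
  = a * (b + c - d) + (b' + c' - d') by ring.
have -> : BG kappa (a *: dw1 + dw2).1 s + DO v (a *: dw1 + dw2) (E s) w.1 w.2
    - \int[muI]_x ((a *: f1 + f2) x * s.1 x) =
  a * (BG kappa dw1.1 s + DO v dw1 (E s) w.1 w.2 - \int[muI]_x (f1 x * s.1 x))
  + (BG kappa dw2.1 s + DO v dw2 (E s) w.1 w.2 - \int[muI]_x (f2 x * s.1 x)).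
  by rewrite hD hL -id6; congr (_ + _ - _); exact: hG.
rewrite (le_trans (ler_normD _ _)) // normrM mulrDl -mulrA lerD ?J2 //.
by rewrite ler_wpM2l // H2.
Qed.

Lemma approx_linearized_bound u w f dw (F1 F2 : R) :
  is_state kappa p q E v u w -> f \in Lfun muI 2%:E -> 0 <= F1 -> 0 <= F2 ->
  approx_linearized w f dw F1 F2 ->
  N_oo dw.1 <= alpha / theta2 * (nrm muI 2%:E f + F2 + CE * CA * beta * F1) /\
  N_p dw.2 <= beta * (CA * N_oo dw.1 * (B * V) + F1).
Proof.
move=> sw fL F10 F20 [dW H1 H2].
apply: (linear_stability sw dW F10 _ H1); first by rewrite addr_ge0 ?nrm_ge0.
move=> s sW; have [_ b] := load_bound fL sW.
rewrite -[X in `|X|](subrK (\int[muI]_x (f x * s.1 x))) (le_trans (ler_normD _ _)) //.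
by rewrite addrC mulrDl lerD // H2.
Qed.

Lemma Lfun2_0 : (0 : R -> R) \in Lfun muI 2%:E.
Proof. by apply: Lfun_cst1 => //; exact: muI_setT. Qed.

Lemma nrm2_0 : nrm muI 2%:E (0 : R -> R) = 0.
Proof. by have := nrmZ 0 e2 Lfun2_0; rewrite scale0r normr0 mul0r. Qed.

(** * Construction of the derivative from difference quotients *)

Context (theta1 : R) (G : (R -> R) -> sob1 R * sob2 R)
  (G_def : control_to_state kappa p q theta1 alpha E v G).

Lemma controlsP u : controls theta1 alpha u <->
  u \in Lfun muI 2%:E /\ nrm muI 2%:E u < theta1 / alpha.
Proof.
split=> -[uL uN]; split=> //; last by rewrite /L2norm (nrmE uL) lte_fin.
by move: uN; rewrite /L2norm (nrmE uL) lte_fin.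
Qed.

Lemma controls_room u (h : R -> R) : controls theta1 alpha u -> h \in Lfun muI 2%:E ->
  exists2 t0 : R, 0 < t0 &
    forall t, 0 <= t <= t0 -> controls theta1 alpha (u + t *: h).
Proof.
move=> /controlsP[uL uN] hL; pose H := nrm muI 2%:E h.
have H1 : 0 < H + 1 by rewrite ltr_wpDl // nrm_ge0.
(* The distance of [u] to the sphere bounding the set of controls, divided by [H + 1] rather than
   [H] because [h] may be 0. *)
exists ((theta1 / alpha - nrm muI 2%:E u) / (H + 1)); first by rewrite divr_gt0 // subr_gt0.
move=> t /andP[t0]; rewrite ler_pdivlMr // => tH.
have thL := LfunZ t e2 hL; apply/controlsP; split; first exact: LfunD.
apply: le_lt_trans (nrmD e2 uL thL) _; rewrite nrmZ // ger0_norm //.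
have [->|t_neq0] := eqVneq t 0; first by rewrite mul0r addr0.
have : 0 < t by rewrite lt_neqAle eq_sym t_neq0.
by move: tH; rewrite -/H; nra.
Qed.

Lemma difference_quotient u (h : R -> R) (t : R) : h \in Lfun muI 2%:E ->
  controls theta1 alpha u -> controls theta1 alpha (u + t *: h) -> 0 < t ->
  let c := K2 * nrm muI 2%:E h ^+ 2 * t in
  approx_linearized (G u) h (t^-1 *: (G (u + t *: h) - G u)) c (CE * c).
Proof.
move=> hL cu ct t0 c.
have [sw _] := G_def cu; have [sw' _] := G_def ct.
have [uL _] := (controlsP u).1 cu; have [u'L _] := (controlsP _).1 ct.
have [[dW _ _] _] := state_diff uL u'L sw sw'.
have [H1 H2] := linearization uL u'L sw sw'.
have thL := LfunZ t e2 hL.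
have du : u + t *: h - u = t *: h by rewrite addrC addKr.
have A1 : approx_linearized (G u) (t *: h) (G (u + t *: h) - G u) (c * t) (CE * c * t).
  rewrite du (nrmZ _ e2 hL) ger0_norm ?(ltW t0) // in H1 H2.
  have ec : K2 * (t * nrm muI 2%:E h) ^+ 2 = c * t by rewrite /c; ring.
  split=> // [z zW|s sW]; first by rewrite -ec; exact: H1.
  by rewrite -[CE * c * t]mulrA -ec; exact: H2.
(* [approx_linearized_lin] forms [a *: d1 + d2]; the zero pair serves as second summand when the
   increment is divided by [t]. *)
have A0 : approx_linearized (G u) 0 0 0 0.
  have := approx_linearized_lin (-1) sw thL thL A1 A1.
  rewrite !scaleN1r !addNr => -[W0 Z1 Z2]; split=> // [z zW|s sW].
    have := DO_lin (-1) sw dW dW (W10O_grad qe zW).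
    by rewrite scaleN1r addNr mulN1r addNr => ->; rewrite normr0 mul0r.
  have [EL _] := E_grad sW.
  have := DO_lin (-1) sw dW dW EL; rewrite scaleN1r addNr mulN1r addNr => ->.
  have [_ s2 _ _] := (W10IP _ (lexx 1%E)).1 sW.
  have [_ g1 _ _] := (W10IP _ oo1).1 dW.1.
  have := BG_linl (-1) (ltW kappa_gt0) g1 g1 s2.
  rewrite scaleN1r addNr mulN1r addNr => ->.
  have := load_lin (-1) hL hL sW; rewrite scaleN1r addNr mulN1r addNr => ->.
  by rewrite addr0 subr0 normr0 mul0r.
have := approx_linearized_lin t^-1 sw thL Lfun2_0 A1 A0.
rewrite !addr0 scalerA mulVf ?gt_eqF // scale1r.
rewrite ger0_norm ?invr_ge0 ?(ltW t0) // ![_ * t]mulrC !mulKf ?gt_eqF //.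
Qed.

Lemma linearized_exists u (h : R -> R) : controls theta1 alpha u -> h \in Lfun muI 2%:E ->
  exists dw, linearized (G u) h dw.
Proof.
move=> cu hL; have [t0 t0_gt0 room] := controls_room cu hL.
have [sw _] := G_def cu.
(* Halving the steps turns residuals proportional to [t n] into the geometric rate that the
   completeness lemmas ask for. *)
pose t n : R := t0 * 2^-1 ^+ n.
have half n : 0 < 2^-1 ^+ n :> R by rewrite exprn_gt0 // invr_gt0.
have t_gt0 n : 0 < t n by rewrite mulr_gt0.
have t_le n m : (n <= m)%N -> t m <= t n.
  move=> nm; rewrite ler_wpM2l ?(ltW t0_gt0) //.
  by apply: ler_wiXn2l => //; rewrite ?invr_ge0 // invf_le1 // ler1n.
have t_le0 n : t n <= t0 by have := t_le 0%N n isT; rewrite {2}/t expr0 mulr1.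
pose c0 := K2 * nrm muI 2%:E h ^+ 2.
have c00 : 0 <= c0 by rewrite mulr_ge0 ?K2_ge0 ?exprn_ge0 ?nrm_ge0.
pose w_ n := (t n)^-1 *: (G (u + t n *: h) - G u).
have wA n : approx_linearized (G u) h (w_ n) (c0 * t n) (CE * (c0 * t n)).
  by apply: difference_quotient => //; apply: room; rewrite (ltW (t_gt0 n)) t_le0.
have wW n : Wspace p (w_ n) by case: (wA n).
(* The difference of two quotients carries no load and has a residual proportional to [t n + t m],
   at most [2 * t n]; [C1] and [C2] are the bounds of [stability] for it, with [2^-1 ^+ n] taken
   out. *)
pose C1 := alpha / theta2 * (CE * (c0 * (2 * t0)) + CE * CA * beta * (c0 * (2 * t0))).
pose C2 := beta * (CA * C1 * (B * V) + c0 * (2 * t0)).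
have at0 : 0 <= alpha / theta2 := L1_ge0.
have ct0 : 0 <= c0 * (2 * t0) by rewrite mulr_ge0 // mulr_ge0 // ltW.
have C10 : 0 <= C1.
  apply: mulr_ge0 => //; apply: addr_ge0; first exact: mulr_ge0.
  by apply: mulr_ge0 => //; rewrite !mulr_ge0.
have C20 : 0 <= C2.
  by apply: mulr_ge0 => //; apply: addr_ge0 => //; apply: mulr_ge0 => //; exact: mulr_ge0.
have cau n m : (n <= m)%N -> N_oo (w_ m - w_ n).1 <= C1 * 2^-1 ^+ n /\
    N_p (w_ m - w_ n).2 <= C2 * 2^-1 ^+ n.
  move=> nm; pose d := t n + t m.
  have A : approx_linearized (G u) 0 (w_ m - w_ n) (c0 * d) (CE * (c0 * d)).
    have := approx_linearized_lin (-1) sw hL hL (wA n) (wA m).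
    rewrite !scaleN1r normrN1 !mul1r addNr [- w_ n + _]addrC.
    have -> : c0 * d = c0 * t n + c0 * t m by rewrite mulrDr.
    by rewrite [CE * (_ + _)]mulrDr.
  have d0 : 0 <= d by rewrite addr_ge0 // ltW.
  have dle : d <= 2 * t0 * 2^-1 ^+ n.
    by rewrite -mulrA -/(t n) mulr2n mulrDl mul1r lerD2l; exact: t_le.
  have cd0 : 0 <= c0 * d by rewrite mulr_ge0.
  have cdle : c0 * d <= c0 * (2 * t0) * 2^-1 ^+ n by rewrite -mulrA ler_wpM2l.
  have [] := approx_linearized_bound sw Lfun2_0 cd0 (mulr_ge0 CE0 cd0) A.
  rewrite nrm2_0 add0r => n1 n2.
  have n1' : N_oo (w_ m - w_ n).1 <= C1 * 2^-1 ^+ n.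
    apply: (le_trans n1); rewrite /C1 -[leRHS]mulrA ler_wpM2l // mulrDl.
    have a0 : 0 <= CE * CA * beta by rewrite !mulr_ge0.
    apply: lerD; rewrite -[leRHS]mulrA; first exact: ler_wpM2l.
    exact: ler_wpM2l.
  split=> //; apply: (le_trans n2); rewrite /C2 -[leRHS]mulrA ler_wpM2l //.
  rewrite [leRHS]mulrDl lerD //.
  have -> : CA * C1 * (B * V) * 2^-1 ^+ n = CA * (C1 * 2^-1 ^+ n) * (B * V) by ring.
  by rewrite ler_wpM2r // ler_wpM2l.
have [g [gW gC]] : exists g, W10I +oo%E g /\
    forall n, nrm muI +oo%E (g.2 - (w_ n).1.2) <= C1 * 2^-1 ^+ n.
  apply: W10I_complete => //; first by move=> n; case: (wW n).
  by move=> n m nm; have [] := cau n m nm.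
have [y [yW yC]] : exists y, W10O p%:E y /\
    forall n, vnrm muO p%:E (y.2 - (w_ n).2.2) <= C2 * 2^-1 ^+ n.
  apply: W10O_complete => //; first by move=> n; case: (wW n).
  by move=> n m nm; have [] := cau n m nm.
have dW : Wspace p (g, y) by [].
exists (g, y).
have small (a C : R) : (forall n, a <= C * 2^-1 ^+ n) -> a <= 0.
  move=> aC; apply/ler_addgt0Pl => e e0; rewrite addr0.
  by have [n] := half_expr_small C e0; exact: le_trans.
have DOn z n : vLfun muO q%:E z.2 ->
    `|DO v ((g, y) - w_ n) z (G u).1 (G u).2|
      <= (CA * C2 + CA * (B * V) * C1) * N_q z * 2^-1 ^+ n.
  move=> zL; apply: (le_trans (DO_bound sw (Wspace_sub dW (wW n)) zL)).
  rewrite [leRHS]mulrAC ler_wpM2r ?nrm_ge0 // [leRHS]mulrDl.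
  apply: lerD; rewrite -[leRHS]mulrA ler_wpM2l //; [exact: yC|exact: mulr_ge0|].
  exact: gC.
(* The limit is split into its distance to the n-th quotient, small by continuity of the forms, and
   the quotient, whose residual is small. Both contributions decay like [2^-1 ^+ n], so the residual
   of the limit is 0. *)
have split_w n : (g, y) = 1 *: ((g, y) - w_ n) + w_ n by rewrite scale1r subrK.
have DOs z n : vLfun muO q%:E z.2 -> DO v (g, y) z (G u).1 (G u).2 =
    DO v ((g, y) - w_ n) z (G u).1 (G u).2 + DO v (w_ n) z (G u).1 (G u).2.
  move=> zL; rewrite {1}(split_w n).
  by rewrite (DO_lin 1 sw (Wspace_sub dW (wW n)) (wW n) zL) mul1r.
apply/linearizedP; split=> // [z zW|s sW]; rewrite mul0r.
  have zL := W10O_grad qe zW; apply: (small _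
    ((CA * C2 + CA * (B * V) * C1) * N_q z + c0 * t0 * N_q z)) => n.
  rewrite (DOs z n zL); apply: (le_trans (ler_normD _ _)); rewrite [leRHS]mulrDl.
  apply: lerD; first exact: DOn.
  have [_ H _] := wA n; apply: (le_trans (H z zW)).
  by rewrite /t -!mulrA [2^-1 ^+ n * _]mulrC.
have [EL EN] := E_grad sW; have [_ s2 _ _] := (W10IP _ (lexx 1%E)).1 sW.
have [_ g2 _ _] := (W10IP _ oo1).1 gW.
apply: (small _ (kappa * (C1 * N_1 s) + (CA * C2 + CA * (B * V) * C1) * N_q (E s)
  + CE * (c0 * t0) * N_1 s)) => n.
have [_ wn2 _ _] := (W10IP _ oo1).1 (wW n).1.
have [_ d2 _ _] := (W10IP _ oo1).1 (Wspace_sub dW (wW n)).1.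
have BGs : BG kappa g s = BG kappa ((g, y) - w_ n).1 s + BG kappa (w_ n).1 s.
  have := BG_linl 1 (ltW kappa_gt0) d2 wn2 s2; rewrite mul1r => <-.
  by congr (BG _ _ _); rewrite scale1r -[((g, y) - w_ n).1]/(g - (w_ n).1) subrK.
rewrite -[BG kappa (g, y).1 s]/(BG kappa g s) BGs (DOs _ n EL).
have id5 (a b c d e : R) : a + b + (c + d) - e = (a + c) + (b + d - e) by ring.
rewrite id5; apply: (le_trans (ler_normD _ _)); rewrite [leRHS]mulrDl.
apply: lerD.
  apply: (le_trans (ler_normD _ _)); rewrite [leRHS]mulrDl.
  apply: lerD; last exact: DOn.
  have [_ b] := BG_bound (ltW kappa_gt0) d2 s2; apply: (le_trans b).
  rewrite -[leRHS]mulrA ler_wpM2l ?(ltW kappa_gt0) // [leRHS]mulrAC.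
  by rewrite ler_wpM2r ?nrm_ge0 //; exact: gC.
have [_ _ H] := wA n; apply: (le_trans (H s sW)).
by rewrite /t -!mulrA [2^-1 ^+ n * _]mulrC.
Qed.

Lemma WnormE dw : Wspace p dw ->
  Wnorm p beta CA v dw = (B * V * N_oo dw.1 + N_p dw.2)%:E.
Proof.
move=> [d1 d2]; rewrite /Wnorm (semi2E pe v_grad) (semi2E pe (W10O_grad pe d2)).
by have [_ g2 _ _] := (W10IP _ oo1).1 d1; rewrite semi1E (nrmE g2).
Qed.

(** The seminorms see derivatives only; Poincare's inequality turns their vanishing into equality of
    the functions almost everywhere. *)
Lemma Weq_of_N0 dw1 dw2 : Wspace p dw1 -> Wspace p dw2 ->
  N_oo (dw1 - dw2).1 <= 0 -> N_p (dw1 - dw2).2 <= 0 -> Weq dw1 dw2.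
Proof.
move=> W1 W2 n1 n2; have [d1 d2] := Wspace_sub W1 W2.
have [_ g2 _ _] := (W10IP _ oo1).1 d1; have [y1 y2 _ _] := (W10OP _ pe).1 d2.
split.
  apply: (ae_mp _ (W10I_ae_le oo1 d1)) => x hx.
  have := le_trans hx (le_trans (nrm1_le_oo g2) n1).
  by rewrite pmulr_rle0 // normr_le0 subr_eq0 => /eqP.
have n0 : nrm muO 1%E (dw1 - dw2).2.1 = 0.
  apply/eqP; rewrite eq_le nrm_ge0 andbT (le_trans (W10O_nrm1_le pe d2)) //.
  exact: le_trans (vnrm1_le p1 y2) n2.
apply: (ae_mp _ (nrm_eq0_ae (lexx 1%E) (Lfun1_O pe y1) n0)) => x /eqP.
by rewrite subr_eq0 => /eqP.
Qed.

Lemma linearized_Wnorm u f dw : controls theta1 alpha u -> f \in Lfun muI 2%:E ->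
  linearized (G u) f dw ->
  (Wnorm p beta CA v dw <= (alpha / theta2 * B ^+ 2)%:E * semi2 p%:E v * L2norm f)%E.
Proof.
move=> cu fL /linearizedP A; have [sw _] := G_def cu.
have [] := approx_linearized_bound sw fL (lexx 0) (lexx 0) A.
rewrite !mulr0 !addr0 => n1 n2.
have dW : Wspace p dw by case: A.
rewrite (WnormE dW) (semi2E pe v_grad) /L2norm (nrmE fL) -!EFinM lee_fin.
(* The weight [B * V] of the interface part and the factor [beta * CA * B * V] in the bulk bound add
   up to [B ^+ 2 * V], which is the square in the final estimate. *)
apply: (@le_trans _ _ (B ^+ 2 * V * N_oo dw.1)).
  have -> : B ^+ 2 * V * N_oo dw.1 =
    B * V * N_oo dw.1 + beta * (CA * N_oo dw.1 * (B * V)) by rewrite /B; ring.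
  by rewrite lerD2l.
have -> : alpha / theta2 * B ^+ 2 * vnrm muO p%:E v.2 * nrm muI 2%:E f =
  B ^+ 2 * V * (alpha / theta2 * nrm muI 2%:E f) by rewrite /V /N_p; ring.
by rewrite ler_wpM2l // mulr_ge0 // exprn_ge0.
Qed.

Lemma linearized_lin u (a : R) (h1 h2 : R -> R) d1 d2 dw : controls theta1 alpha u ->
  h1 \in Lfun muI 2%:E -> h2 \in Lfun muI 2%:E -> linearized (G u) h1 d1 ->
  linearized (G u) h2 d2 -> linearized (G u) (a *: h1 + h2) dw ->
  Weq dw (a *: d1 + d2).
Proof.
move=> cu h1L h2L /linearizedP A1 /linearizedP A2 /linearizedP A.
have [sw _] := G_def cu.
have A12 := approx_linearized_lin a sw h1L h2L A1 A2.
have hL : a *: h1 + h2 \in Lfun muI 2%:E by apply: LfunD => //; exact: LfunZ.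
have := approx_linearized_lin (-1) sw hL hL A12 A.
rewrite !scaleN1r !mulr0 !addr0 !mulr0 addNr [- _ + dw]addrC => AD.
have [] := approx_linearized_bound sw Lfun2_0 (lexx 0) (lexx 0) AD.
rewrite nrm2_0 !mulr0 !addr0 mulr0 => n1 n2.
apply: (Weq_of_N0 _ _ n1); [by case: A|by case: A12|].
apply: (le_trans n2); apply: mulr_ge0_le0 => //; apply: mulr_le0_ge0 => //.
exact: mulr_ge0_le0.
Qed.

(** Subtracting [dw] from the increment of [G] cancels the load, so [stability] bounds the remainder
    by the residual alone, at most a constant times the square of the norm of [h]. *)
Lemma linearized_frechet u : controls theta1 alpha u -> forall eps : R, 0 < eps ->
  exists2 delta : R, 0 < delta & forall (h : R -> R) dw, h \in Lfun muI 2%:E ->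
    nrm muI 2%:E h < delta -> controls theta1 alpha (u + h) ->
    linearized (G u) h dw ->
    (Wnorm p beta CA v (G (u + h) - G u - dw)%R <= eps%:E * L2norm h)%E.
Proof.
move=> cu eps eps0; have [sw _] := G_def cu; have [uL _] := (controlsP u).1 cu.
pose M1 := alpha / theta2 * (CE * K2 + CE * CA * beta * K2).
pose M2 := beta * (CA * M1 * (B * V) + K2).
have at0 : 0 <= alpha / theta2 := L1_ge0.
have k0 := K2_ge0.
have M10 : 0 <= M1.
  apply: mulr_ge0 => //; apply: addr_ge0; first exact: mulr_ge0.
  by apply: mulr_ge0 => //; rewrite !mulr_ge0.
have M20 : 0 <= M2.
  by apply: mulr_ge0 => //; apply: addr_ge0 => //; apply: mulr_ge0 => //; exact: mulr_ge0.
(* [B * V] is the weight of the interface part in [Wnorm]; the summand 1 makes [M] positive, so that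
   [eps / M] is a valid radius. *)
pose M := B * V * M1 + M2 + 1.
have M0 : 0 < M.
  by rewrite ltr_wpDl //; apply: addr_ge0 => //; exact: mulr_ge0.
exists (eps / M); first exact: divr_gt0.
move=> h dw hL hd ch /linearizedP A.
have [sw' _] := G_def ch; have [u'L _] := (controlsP _).1 ch.
have [[dW _ _] _] := state_diff uL u'L sw sw'.
have [] := linearization uL u'L sw sw'.
have -> : u + h - u = h by rewrite addrC addKr.
set H := nrm muI 2%:E h => H1 H2.
have H0 : 0 <= H by exact: nrm_ge0.
have A' : approx_linearized (G u) h (G (u + h) - G u) (K2 * H ^+ 2) (CE * (K2 * H ^+ 2)).
  by split.
have := approx_linearized_lin (-1) sw hL hL A A'.
rewrite !scaleN1r !mulr0 !add0r addNr [- dw + _]addrC => AD.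
have c0 : 0 <= K2 * H ^+ 2 by rewrite mulr_ge0 // exprn_ge0.
have [] := approx_linearized_bound sw Lfun2_0 c0 (mulr_ge0 CE0 c0) AD.
rewrite nrm2_0 add0r => n1 n2.
have DW : Wspace p (G (u + h) - G u - dw) by case: AD.
rewrite (WnormE DW) /L2norm (nrmE hL) -EFinM lee_fin -/H.
have n1' : N_oo (G (u + h) - G u - dw).1 <= M1 * H ^+ 2.
  by apply: (le_trans n1); rewrite le_eqVlt; apply/orP; left; apply/eqP; rewrite /M1; ring.
have n2' : N_p (G (u + h) - G u - dw).2 <= M2 * H ^+ 2.
  apply: (le_trans n2); rewrite /M2 -[leRHS]mulrA ler_wpM2l // [leRHS]mulrDl lerD2r.
  have -> : CA * M1 * (B * V) * H ^+ 2 = CA * (M1 * H ^+ 2) * (B * V) by ring.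
  by rewrite ler_wpM2r // ler_wpM2l.
apply: (@le_trans _ _ (M * H ^+ 2)).
  have := ler_wpM2l BV0 n1'; have := sqr_ge0 H; move: n2'; rewrite /M.
  set a := N_p _; set b := N_oo _; set c := B * V; set d := H ^+ 2; nra.
rewrite expr2 mulrA ler_wpM2r // mulrC -ler_pdivlMr //; exact: ltW.
Qed.

(** It recombines the bulk and interface equations, kept separate in [linearized] because each
    inf-sup condition tests one of them, into the single equation with test function
    [z + E zeta]. *)
Lemma DO_addr u w dw z1 z2 : is_state kappa p q E v u w -> Wspace p dw ->
  vLfun muO q%:E z1.2 -> vLfun muO q%:E z2.2 ->
  DO v dw (z1 + z2) w.1 w.2 = DO v dw z1 w.1 w.2 + DO v dw z2 w.1 w.2.
Proof.
move=> sw [d1 d2] z1L z2L.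
have wa := state_admissible sw; have [YL _] := state_grad sw.
rewrite /DO (BO_addr conj_pq (Amx_bounded wa) (W10O_grad pe d2) z1L z2L).
by rewrite (BO_addr conj_pq (DAmx_bounded wa d1) YL z1L z2L) addrACA.
Qed.

Lemma control_to_state_differentiable :
  exists2 G' : (R -> R) -> (R -> R) -> sob1 R * sob2 R,
    frechet_derivative p beta CA v (controls theta1 alpha) G G' &
    forall ub h : R -> R, controls theta1 alpha ub -> L2I h ->
      [/\ Wspace p (G' ub h),
          forall (zeta : sob1 R) (z : sob2 R), W10I 1%E zeta -> W10O q%:E z ->
            BG kappa (G' ub h).1 zeta
            + DO v (G' ub h) (z + E zeta) (G ub).1 (G ub).2
            = \int[muI]_x (h x * zeta.1 x) &
          (Wnorm p beta CA v (G' ub h) <=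
             (alpha / theta2 * (1 + beta * CA) ^+ 2)%:E * semi2 p%:E v
             * L2norm h)%E].
Proof.
have ex (uh : (R -> R) * (R -> R)) : exists dw, controls theta1 alpha uh.1 ->
    L2I uh.2 -> linearized (G uh.1) uh.2 dw.
  (* [choice] asks for a witness at every pair of functions; outside the domain the implication is
     vacuous and 0 is taken. *)
  have [[cu hL]|n] := pselect (controls theta1 alpha uh.1 /\ L2I uh.2).
    by have [dw ldw] := linearized_exists cu hL; exists dw.
  by exists 0 => cu hL; case: n.
have [G2 HG2] := choice ex.
have HG u (h : R -> R) : controls theta1 alpha u -> L2I h -> linearized (G u) h (G2 (u, h)).
  exact: (HG2 (u, h)).
exists (fun u (h : R -> R) => G2 (u, h)).
  move=> u cu; split.
  - by move=> h hL; case: (HG u h cu hL).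
  - move=> a h1 h2 h1L h2L.
    apply: (linearized_lin cu h1L h2L (HG _ _ cu h1L) (HG _ _ cu h2L)).
    by apply: HG => //; apply: LfunD => //; exact: LfunZ.
  - exists (alpha / theta2 * B ^+ 2 * V) => h hL.
    have := linearized_Wnorm cu hL (HG _ _ cu hL).
    by rewrite (semi2E pe v_grad) -EFinM.
  - move=> eps eps0; have [delta d0 Hd] := linearized_frechet cu eps0.
    exists delta => // h hL hd ch; apply: Hd => //; last exact: HG.
    by move: hd; rewrite /L2norm (nrmE hL) lte_fin.
move=> u h cu hL; have [dW H1 H2] := HG u h cu hL; have [sw _] := G_def cu.
split=> //; last exact: (linearized_Wnorm cu hL (HG _ _ cu hL)).
move=> s z sW zW; have [EL _] := E_grad sW.
by rewrite (DO_addr sw dW (W10O_grad qe zW) EL) (H1 z zW) add0r H2.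
Qed.

End stability.

Theorem theorem4p12 (R : realType)
  (kappa CA alpha beta Q P p q CE : R) (E : sob1 R -> sob2 R)
  (kappa_gt0 : 0 < kappa)
  (CA_bound : A_bound CA)
  (alpha_gt0 : 0 < alpha) (alpha_infsup : infsupI kappa alpha)
  (QP : Q < 2 < P) (QP_conj : Q^-1 + P^-1 = 1)
  (beta_gt0 : 0 < beta) (beta_infsup : infsupO Q P beta)
  (p_range : 2 < p < P) (q_def : q = p / (p - 1))
  (CE_ge1 : 1 <= CE) (E_ext : bounded_extension q CE E)
  (theta1 theta2 : R)
  (theta1_range : beta * CA / (1 + beta * CA) < theta1 < 1)
  (theta2_range : 0 < theta2 < 1)
  (v : sob2 R) (v_W1p : W1O p%:E v) (v_neq0 : semi2 p%:E v <> 0%E)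
  (v_small1 : (semi2 p%:E v <=
     ((1 - theta1) * (alpha * CE * CA * (1 + beta * CA))^-1)%:E)%E)
  (v_small2 : (semi2 p%:E v <=
     ((1 - theta2) * (alpha * CE * CA * (1 + beta * CA) ^+ 2)^-1)%:E)%E)
  (G : (R -> R) -> sob1 R * sob2 R)
  (G_def : control_to_state kappa p q theta1 alpha E v G) :
  exists2 G' : (R -> R) -> (R -> R) -> sob1 R * sob2 R,
    frechet_derivative p beta CA v (controls theta1 alpha) G G' &
    forall ub h : R -> R, controls theta1 alpha ub -> L2I h ->
      [/\ Wspace p (G' ub h),
          forall (zeta : sob1 R) (z : sob2 R), W10I 1%E zeta -> W10O q%:E z ->
            BG kappa (G' ub h).1 zeta
            + DO v (G' ub h) (z + E zeta) (G ub).1 (G ub).2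
            = \int[muI]_x (h x * zeta.1 x) &
          (Wnorm p beta CA v (G' ub h) <=
             (alpha / theta2 * (1 + beta * CA) ^+ 2)%:E * semi2 p%:E v
             * L2norm h)%E].
Proof.
exact: (control_to_state_differentiable kappa_gt0 CA_bound alpha_gt0 alpha_infsup
  QP beta_gt0 beta_infsup p_range q_def CE_ge1 E_ext theta2_range v_W1p v_small2 G_def).
Qed.
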